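(* Let $n\geq 5$, $H=SL_n$ and $\Gamma=SL_n(\mathbb{Z})$. Let $\Sigma$ be a finite generating set of $\Gamma$ and let $X_k$ be the $k$-th step of the corresponding random walk. Then for any pair $\mathcal{G}=(G_1,G_2)$ of subgroups of the alternating group $\mathrm{Alt}(n)$ there exist an algebraic extension $F_{\mathcal G}$ of $\mathbb{Q}$ and sequences of natural numbers $\{n_i(\mathcal G)\}_{i\ge1}$, $\{k_i(\mathcal G)\}_{i\ge1}$ such that for all $i$ $$\mathbb{P}\big(\mathrm{Gal}(F_{\mathcal G}(X_{n_i(\mathcal G)})/F_{\mathcal G})\simeq G_1\big)\geq 1-\frac{1}{2^i},\qquad \mathbb{P}\big(\mathrm{Gal}(F_{\mathcal G}(X_{k_i(\mathcal G)})/F_{\mathcal G})\simeq G_2\big)\geq 1-\frac{1}{2^i}.$$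
   Context: For a field $F$ of characteristic zero and $\gamma\in GL_n(F)$, $F(\gamma)$ denotes the splitting field over $F$ of the characteristic polynomial of $\gamma$. The random walk is $X_k=s_1\cdots s_k$ with $s_1,s_2,\dots$ independent uniformly distributed elements of $\Sigma$; $\mathbb P$ is the probability with respect to it. *)

(* Defs.v *)
From HB Require Import structures.
From mathcomp Require Import all_boot all_order all_algebra all_fingroup all_solvable all_field.
From mathcomp Require Import alt.
From Stdlib Require Import ClassicalEpsilon.
Set Implicit Arguments. Unset Strict Implicit. Unset Printing Implicit Defensive.
Import GRing.Theory Num.Theory.
Local Open Scope ring_scope.

Definition pbool (P : Prop) : bool :=
  if excluded_middle_informative P then true else false.

Definition SLZ (n : nat) (g : 'M[int]_n) : Prop := \det g = 1.

Inductive gen_by (n : nat) (S : seq 'M[int]_n) : 'M[int]_n -> Prop :=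
| gen_one : gen_by S 1%:M
| gen_mem g : g \in S -> gen_by S g
| gen_inv g : gen_by S g -> gen_by S (invmx g)
| gen_mul g h : gen_by S g -> gen_by S h -> gen_by S (g *m h).

Definition generates_SLZ (n : nat) (S : seq 'M[int]_n) : Prop :=
  (forall g, g \in S -> SLZ g) /\ (forall g, SLZ g <-> gen_by S g).

(* Random walk: X_k = s_1 ... s_k, s_j uniform in S (S duplicate free).
   Law: uniform measure on words w in 'I_(size S)^k. *)
Definition walk (n : nat) (S : seq 'M[int]_n) (k : nat)
  (w : k.-tuple 'I_(size S)) : 'M[int]_n :=
  foldr (fun (j : 'I_(size S)) M => nth 1%:M S j *m M) 1%:M w.

Definition prob_walk (n : nat) (S : seq 'M[int]_n) (k : nat)
  (E : 'M[int]_n -> Prop) : rat :=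
  (#|[set w : k.-tuple 'I_(size S) | pbool (E (walk w))]|%:R)
    / ((size S ^ k)%N%:R).

(* Subfields of algC (every algebraic extension of Q embeds in algC). *)
Definition is_subfield (F : algC -> Prop) : Prop :=
  F 0 /\ F 1 /\ (forall x y, F x -> F y -> F (x + y)) /\
  (forall x, F x -> F (- x)) /\ (forall x y, F x -> F y -> F (x * y)) /\
  (forall x, F x -> x != 0 -> F x^-1).

Definition split_field (F : algC -> Prop) (n : nat) (g : 'M[int]_n) : algC -> Prop :=
  fun x => forall K, is_subfield K -> (forall y, F y -> K y) ->
    (forall z, root (char_poly (map_mx intr g)) z -> K z) -> K x.

(* F-automorphisms of K, normalized to be the identity outside K. *)
Definition galAut (F K : algC -> Prop) (s : algC -> algC) : Prop :=
  (forall x, K x -> K (s x)) /\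
  (forall y, K y -> exists x, K x /\ s x = y) /\
  (forall x y, K x -> K y -> s x = s y -> x = y) /\
  (forall x y, K x -> K y -> s (x + y) = s x + s y) /\
  (forall x y, K x -> K y -> s (x * y) = s x * s y) /\
  s 1 = 1 /\
  (forall x, F x -> s x = x) /\
  (forall x, ~ K x -> s x = x).

Definition gal_isog (F K : algC -> Prop) (m : nat) (G : {group 'S_m}) : Prop :=
  exists phi : 'S_m -> (algC -> algC),
    (forall a, a \in G -> galAut F K (phi a)) /\
    (forall s, galAut F K s -> exists2 a, a \in G & phi a = s) /\
    {in G &, injective phi} /\
    {in G &, forall a b, phi (a * b)%g = phi a \o phi b}.

(* Main.v *)
Require Import Defs.
From HB Require Import structures.
From mathcomp Require Import all_boot all_order all_algebra all_fingroup all_solvable all_field.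
From mathcomp Require Import alt ring_quotient generic_quotient zify ring.
From mathcomp Require classical_sets.
From Stdlib Require Classical_Prop FunctionalExtensionality ClassicalEpsilon.
Import Order.TTheory GRing.Theory Num.Theory.
Local Open Scope ring_scope.
Set Implicit Arguments.
Unset Strict Implicit.
Unset Printing Implicit Defensive.

(** Idea.  All Galois groups are realised by field automorphisms of [algC].
    At a prime splitting completely in a number field [M], the factorisation type of the
    characteristic polynomial of [g] is the cycle type of an element of [Gal(M(g)/M)]; an
    (n-1)-cycle, a transposition and a fixed-point free element together generate [S_n].
    Each of these types has density bounded below in [SL_n(F_p)] independently of [p], the
    reductions at different primes are independent, and the walk equidistributes on average
    in finite quotients of [SL_n(Z)]; so at suitable times [Gal(M(X_k)/M) = S_n] with
    probability as close to 1 as desired.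
    Choose such times inductively, alternating between the two groups, [M] being generated
    by all eigenvalues met before.  By simplicity of [Alt n], the splitting fields of the new
    matrices are, over the even automorphisms, either independent of or equal to those of finitely many
    representatives.  Let [H_t] be the automorphisms acting on the representative of stage
    at most [t] through the prescribed subgroup of [Alt n]; then [F] is the union of the fixed
    fields of the [H_t]. *)

(** * Conjugation and residue fields *)

(** Only the existence of arbitrarily large completely split primes is needed, not their density:
    they come from prime divisors of the values of one minimal polynomial. At each prime a single
    residue map from the ring of all algebraic integers serves every matrix, so no ring of integers
    of a number field has to be built. The walk need not converge on a finite quotient, since it may
    be periodic; a Cesaro average still supplies one good time, which is all that the statement
    asks. Alternating groups enter because two matrices may share their quadratic subfield although
    their splitting fields are otherwise unrelated: independence can be expected only of the even
    parts, and there simplicity leaves no case between equal and independent. A union of fixed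
    fields is taken, rather than the fixed field of the intersection of all [H_t], because each of
    its elements is settled at a finite stage, so no compactness argument is required. *)

Lemma conj_aut (x y : algC) :
  root (minCpoly x) y -> exists h : {rmorphism algC -> algC}, h x = y.
Proof.
move=> rxy.
have [r Dr] := closed_field_poly_normal (minCpoly x).
have {}Dr : minCpoly x = \prod_(z <- r) ('X - z%:P).
  by rewrite {1}Dr (monicP (minCpoly_monic x)) scale1r.
have [Qs [QsC [s1 Ds1 gen1]]] := num_field_exists r.
have in_r z : root (minCpoly x) z -> exists2 a, a \in s1 & QsC a = z.
  by rewrite Dr root_prod_XsubC -Ds1 => /mapP[a sa ->]; exists a.
have [a sa Da] := in_r _ (root_minCpoly x).
have [b sb Db] := in_r _ rxy.
have [m [Dm _] dvm] := minCpolyP x.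
have QsCm q : map_poly QsC (map_poly (in_alg Qs) q) = map_poly ratr q.
  by rewrite -map_poly_comp; apply: eq_map_poly => c; rewrite /= alg_num_field fmorph_rat.
pose p := map_poly (in_alg Qs) m.
have Qp : p \is a polyOver 1%VS.
  by apply/polyOverP=> i; rewrite coef_map memvZ ?memv_line.
have splitp : splittingFieldFor 1 p {: Qs}.
  exists s1 => //; suff -> : p = \prod_(z <- s1) ('X - z%:P) by rewrite eqpxx.
  apply: (map_poly_inj QsC); rewrite QsCm -Dm Dr -Ds1 big_map rmorph_prod /=.
  by apply: eq_bigr => z _; rewrite map_polyXsubC.
have root_ab : root (map_poly \1%VF (minPoly 1 a)) b.
  rewrite -(fmorph_root QsC) Db.
  (* The minimal polynomial over [1%VS] has rational coefficients; vanishing at [x], it is a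
     multiple of [minCpoly x] and so vanishes at [y]. *)
  have [q Dq] : exists q, minPoly 1 a = map_poly (in_alg Qs) q.
    have aP i : (minPoly 1 a)`_i \in 1%VS by apply/polyOverP; apply: minPolyOver.
    have a_ i := sig_eqW (vlineP _ _ (aP i)).
    exists (\poly_(i < size (minPoly 1 a)) sval (a_ i)).
    apply/polyP=> i; rewrite coef_map /=.
    rewrite coef_poly; case: ltnP => [_|?]; last by rewrite nth_default // scale0r.
    by case: (a_ i) => c /= ->.
  have -> : map_poly \1%VF (minPoly 1 a) = minPoly 1 a.
    by rewrite map_polyE map_id_in ?polyseqK // => c _; rewrite id_lfunE.
  have : root (map_poly ratr q) x.
    by rewrite -QsCm -Dq -Da fmorph_root root_minPoly.
  rewrite Dq QsCm dvm => /dvdpP[q2 ->].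
  by rewrite rmorphM rootM /= -Dm rxy orbT.
have hom0 : kHom 1 1 (\1%VF : 'End(Qs)) by rewrite kHom1.
have hom1 : kHom 1 <<1; a>> (kHomExtend 1 \1 a b) by rewrite kHomExtendP.
have [f hf fE] := kHom_extends (sub1v _) hom1 Qp
  (splittingFieldForS (sub1v <<1; a>>%AS) (subvf _) splitp).
pose fM := GRing.isMonoidMorphism.Build _ _ f (kHom_monoid_morphism hf).
pose phi : {rmorphism Qs -> Qs} := HB.pack (fun_of_lfun f) fM.
have [nu Dnu] := extend_algC_subfield_aut QsC phi.
exists nu; rewrite -Da -Dnu /= -fE ?memv_adjoin // (kHomExtend_val hom0) //.
Qed.

(** All algebraic integers together: one homomorphism to a field of characteristic [p] then reduces
    the eigenvalues of every matrix at once. *)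
Definition aint := {x : algC | x \in Aint}.
HB.instance Definition _ := SubChoice.on aint.
HB.instance Definition _ := [SubChoice_isSubComNzRing of aint by <:].

Section IdealExtension.
Variables (R : comNzRingType) (P0 : R -> Prop).

Definition is_proper_ideal (P : R -> Prop) : Prop :=
  [/\ P 0, forall x y, P x -> P y -> P (x + y), forall a x, P x -> P (a * x) & ~ P 1].

Lemma exists_maximal_ideal : is_proper_ideal P0 ->
  exists P : R -> Prop, [/\ is_proper_ideal P, forall x, P0 x -> P x &
    forall Q : R -> Prop, is_proper_ideal Q -> (forall x, P x -> Q x) ->
      forall x, Q x -> P x].
Proof.
move=> iP0.
(* Zorn is applied to the ideals [P] such that [P `|` P0] is an ideal: the empty chain then causes no trouble. *)
pose good (P : classical_sets.set R) := is_proper_ideal (fun x => P x \/ P0 x).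
have [|M [gM maxM]] := @classical_sets.Zorn_bigcup R good.
  move=> F FP tot; split.
  - by right; case: iP0.
  - move=> x y.
    have common X Y : F X -> F Y -> exists2 Z, F Z & (forall z, X z -> Z z) /\ (forall z, Y z -> Z z).
      by move=> FX FY; case: (tot _ _ FX FY) => s; [exists Y | exists X].
    move=> [[X FX Xx]|Px] [[Y FY Yy]|Py].
    + have [Z FZ [XZ YZ]] := common _ _ FX FY.
      have [_ add _ _] := FP _ FZ.
      have [] := add x y (or_introl (XZ _ Xx)) (or_introl (YZ _ Yy)); last by right.
      by left; exists Z.
    + have [_ add _ _] := FP _ FX.
      have [] := add x y (or_introl Xx) (or_intror Py); last by right.
      by left; exists X.
    + have [_ add _ _] := FP _ FY.
      have [] := add x y (or_intror Px) (or_introl Yy); last by right.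
      by left; exists Y.
    + by right; case: iP0 => _ add _ _; apply: add.
  - move=> a x [[X FX Xx]|Px].
      have [_ _ mul _] := FP _ FX.
      have [] := mul a x (or_introl Xx); last by right.
      by left; exists X.
    by right; case: iP0 => _ _ mul _; apply: mul.
  - move=> [[X FX X1]|P1]; last by case: iP0.
    by have [_ _ _ []] := FP _ FX; left.
exists (fun x => M x \/ P0 x); split=> //; first by move=> x; right.
move=> Q iQ sMQ x Qx; apply: Classical_Prop.NNPP => nMx.
apply: (maxM (fun x => Q x)).
  split; last by move=> s; apply: nMx; left; apply: s.
  by move=> z Mz; apply: sMQ; left.
have iff_id z : (Q z \/ P0 z) <-> Q z.
  by split=> [[//|Pz]|]; [apply: sMQ; right | left].
by case: iQ => *; split=> [|z t /iff_id ? /iff_id ?|z t /iff_id ?|/iff_id //]; apply/iff_id; auto.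
Qed.

End IdealExtension.

Lemma pboolP (P : Prop) : reflect P (pbool P).
Proof.
by rewrite /pbool; case: ClassicalEpsilon.excluded_middle_informative => h; constructor.
Qed.

Section Quotient.
Variables (R : comNzRingType) (P : R -> Prop).
Hypothesis iP : is_proper_ideal P.
Hypothesis maxP : forall Q : R -> Prop, is_proper_ideal Q -> (forall x, P x -> Q x) ->
  forall x, Q x -> P x.

Let I : {pred R} := fun x => pbool (P x).

Let I_ideal : idealr_closed I.
Proof.
case: iP => P0 PD PM P1; split; first exact/pboolP.
  by apply/pboolP.
by move=> a x y /pboolP Px /pboolP Py; apply/pboolP/PD => //; apply: PM.
Qed.

HB.instance Definition _ := isIdealr.Build R I I_ideal.
Let J : idealr R := I.

(** By maximality, [P] and a representative of [x] generate the whole ring. The implication sits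
    inside the boolean so that [xchoose] applies to every [x]. *)
Let inv_exists (x : {ideal_quot J}) : exists y, (x != 0) ==> (y * x == 1).
Proof.
have [->|nz] := eqVneq x 0; first by exists 0.
case: iP => P0 PD PM P1.
pose r := generic_quotient.repr x.
pose Q z := exists a b, P b /\ z = a * r + b.
have nPr : ~ P r.
  move=> /pboolP Pr; case/eqP: nz; rewrite -[x]reprK -(rmorph0 (\pi_({ideal_quot J})%qT)).
  by apply/eqP; rewrite -Quotient.idealrBE subr0.
have [[a [b [Pb ab]]]|nQ1] := Classical_Prop.classic (Q 1).
  exists (\pi_({ideal_quot J})%qT a); rewrite -{1}[x]reprK -rmorphM -(rmorph1 (\pi_({ideal_quot J})%qT)).
  rewrite -Quotient.idealrBE ab opprD addrA -/r subrr add0r -[- b]mulN1r.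
  exact/pboolP/PM.
case: nPr; apply: (maxP (Q := Q)); last by exists 1, 0; rewrite mul1r addr0.
  split=> //; first by exists 0, 0; rewrite mul0r addr0.
    move=> _ _ [a [b [Pb ->]]] [c [d [Pd ->]]]; exists (a + c), (b + d).
    by split; [apply: PD | rewrite mulrDl addrACA].
  move=> c _ [a [b [Pb ->]]]; exists (c * a), (c * b).
  by split; [apply: PM | rewrite mulrDr mulrA].
by move=> z Pz; exists 0, z; rewrite mul0r add0r.
Qed.

Lemma maximal_ideal_residue :
  exists (k : fieldType) (phi : {rmorphism R -> k}), forall x, P x -> phi x = 0.
Proof.
pose inv (x : {ideal_quot J}) : {ideal_quot J} :=
  if x == 0 then 0 else xchoose (inv_exists x).
have mulV a : a != 0 -> inv a * a = 1.
  move=> nz; have /implyP/(_ nz)/eqP := xchooseP (inv_exists a).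
  by rewrite /inv ifN.
have inv0 : inv 0 = 0 by rewrite /inv ifT.
pose kM := GRing.ComNzRing_isField.Build {ideal_quot J} mulV inv0.
pose k : fieldType := HB.pack {ideal_quot J} kM.
exists k, (\pi_({ideal_quot J})%qT : {rmorphism R -> {ideal_quot J}}) => x Px.
rewrite -[RHS](rmorph0 (\pi_({ideal_quot J})%qT)).
by apply/eqP; rewrite -Quotient.idealrBE subr0; apply/pboolP.
Qed.
End Quotient.

Lemma exists_residue_field (p : nat) : prime p ->
  exists (k : fieldType) (phi : {rmorphism aint -> k}), p \in [pchar k].
Proof.
move=> pr_p; pose P0 (x : aint) := exists y, x = p%:R * y.
have iP0 : is_proper_ideal P0.
  split; first by exists 0; rewrite mulr0.
  - by move=> _ _ [y ->] [z ->]; exists (y + z); rewrite mulrDr.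
  - by move=> a _ [y ->]; exists (a * y); rewrite mulrCA.
  move=> [y /(congr1 val)]; rewrite rmorphM rmorph1 rmorph_nat /=.
  move: (valP y) => /=; move: (\val y) => {}y Ay E.
  have pnz : p%:R != 0 :> algC by rewrite pnatr_eq0 -lt0n prime_gt0.
  (* [1 / p] would be a rational algebraic integer, hence an integer. *)
  have Dy : y = p%:R^-1 by apply: (mulfI pnz); rewrite -E divff.
  have /intrP[m Dm] : y \in Num.int.
    by apply: Cint_rat_Aint _ Ay; rewrite Dy rpredV rpred_nat.
  move: E; rewrite Dm -[p%:R]/(p%:Z%:~R) -intrM -[1]/(1%:~R) => /intr_inj /esym E.
  have := congr1 absz E; rewrite abszM => /eqP; rewrite muln_eq1 => /andP[/eqP p1 _].
  by move: pr_p; rewrite (p1 : p = 1%N).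
have [P [iP sP maxP]] := exists_maximal_ideal iP0.
have [k [phi phi0]] := maximal_ideal_residue iP maxP.
have Pp : P p%:R by apply: sP; exists 1; rewrite mulr1.
by exists k, phi; rewrite inE pr_p -(rmorph_nat phi) (phi0 _ Pp) eqxx.
Qed.

Definition aint_aut (h : {rmorphism algC -> algC}) (x : aint) : aint :=
  insubd 0 (h (\val x)).

Lemma val_aint_aut h x : \val (aint_aut h x) = h (\val x).
Proof. by rewrite insubdK // Aint_aut (valP x). Qed.

Lemma pchar_natr_inj (k : nzRingType) (p : nat) : p \in [pchar k] ->
  {in gtn p &, injective (fun n : nat => n%:R : k)}.
Proof.
move=> chp i j; rewrite !inE; wlog le_ij : i j / (i <= j)%N.
  move=> W lti ltj E; case: (leqP i j) => [|/ltnW] le; first exact: W.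
  by apply/esym/W.
move=> lti ltj E; have /eqP : (j - i)%:R = 0 :> k by rewrite natrB // E subrr.
rewrite -(dvdn_pcharf chp) => /dvdn_leq; case: (posnP (j - i)) => [/eqP|pos /(_ isT)].
  by rewrite subn_eq0 => le_ji _; apply/eqP; rewrite eqn_leq le_ij.
by rewrite leqNgt (leq_ltn_trans (leq_subr _ _) ltj).
Qed.

Lemma monic_int_poly_aint_roots (q : {poly int}) : q \is monic ->
  {r : seq aint | map_poly intr q = \prod_(z <- r) ('X - (\val z)%:P) :> {poly algC}}.
Proof.
move=> mq; have [r Dr] := closed_field_poly_normal (map_poly intr q : {poly algC}).
have mQ : map_poly intr q \is @monic algC.
  by rewrite monicE lead_coef_map_inj ?(monicP mq) //; apply: intr_inj.
rewrite (monicP mQ) scale1r in Dr.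
exists (map (insubd 0) r); rewrite Dr big_map.
apply: eq_big_seq => z rz; rewrite insubdK //.
apply: root_monic_Aint mQ _; first by rewrite Dr root_prod_XsubC.
by apply/polyOverP => i; rewrite coef_map /= intr_int.
Qed.

Lemma minCpoly_aint (x : aint) : exists2 q : {poly int},
  q \is monic & minCpoly (\val x) = map_poly intr q.
Proof.
have /floorpP[q Dq] := valP x; exists q => //.
have := minCpoly_monic (\val x); rewrite Dq !monicE lead_coef_map_inj //; last exact: intr_inj.
by rewrite -[1 in X in X -> _]/(1%:~R) => /eqP/intr_inj ->.
Qed.

Section Residue.
Variables (p : nat) (k : fieldType) (phi : {rmorphism aint -> k}).
Hypothesis chp : p \in [pchar k].

Lemma map_int_poly_residue (q : {poly int}) (r : seq aint) :
  map_poly intr q = \prod_(z <- r) ('X - (\val z)%:P) :> {poly algC} ->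
  map_poly intr q = \prod_(z <- r) ('X - (phi z)%:P) :> {poly k}.
Proof.
move=> E; have {E}E : map_poly intr q = \prod_(z <- r) ('X - z%:P) :> {poly aint}.
  apply: (map_inj_poly (f := \val : aint -> algC)) => //; first exact: val_inj.
  rewrite -map_poly_comp (eq_map_poly (g := intr)); last by move=> x; apply: (rmorph_int (\val : aint -> algC)).
  rewrite E rmorph_prod; apply: eq_bigr => z _.
  by apply/esym; apply: (map_polyXsubC (\val : aint -> algC)).
rewrite -(eq_map_poly (f := phi \o intr)); last by move=> x; rewrite /= rmorph_int.
by rewrite map_poly_comp E rmorph_prod; apply: eq_bigr => z _ /=; rewrite map_polyXsubC.
Qed.

Lemma root_int_poly_Frobenius (q : {poly int}) (x : k) :
  root (map_poly intr q) x -> root (map_poly intr q) (x ^+ p).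
Proof.
rewrite -(pFrobenius_autE chp) => /(rmorph_root (pFrobenius_aut chp)).
rewrite -map_poly_comp (eq_map_poly (g := intr)) // => z /=.
by rewrite rmorph_int.
Qed.

(* The conjugates [h b] of [b = \sum_i a_i t^i] reduce to all the roots of the reduction
   of the minimal polynomial of [b], so one of them reduces to the Frobenius
   image of [b]; as [t] varies a single [h] must serve too many values of [t]. *)
Lemma exists_Frobenius_lift (m : nat) (a : 'I_m -> aint) : (m * m ^ m < p)%N ->
  (forall (h : {rmorphism algC -> algC}) i, exists j, aint_aut h (a i) = a j) ->
  exists h : {rmorphism algC -> algC}, forall i, phi (aint_aut h (a i)) = phi (a i) ^+ p.
Proof.
move=> ltp stab.
pose real (s : {ffun 'I_m -> 'I_m}) :=
  pbool (exists h : {rmorphism algC -> algC}, forall i, aint_aut h (a i) = a (s i)).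
(* At a natural number [t], which satisfies [t ^ p = t] in [k], this takes the value
   [phi b ^ p - phi (h b)] for [h] inducing [s]. A product of at most [m ^ m] such factors of degree
   below [m] cannot vanish at [p] points unless it is zero. *)
pose Q (s : {ffun 'I_m -> 'I_m}) : {poly k} :=
  \poly_(i < m) (if insub i is Some i' then phi (a i') ^+ p - phi (a (s i')) else 0).
have [[s [/pboolP[h Dh] Qs]]|noQ] :=
    Classical_Prop.classic (exists s, real s /\ Q s = 0).
  exists h => i; rewrite Dh; apply/esym/eqP; rewrite -subr_eq0.
  by have /polyP/(_ (i : nat)) := Qs; rewrite coef_poly ltn_ord coef0 valK => ->.
have : (\prod_(s | real s) Q s != 0).
  by apply/prodf_neq0 => s rs; apply/eqP => Qs; apply: noQ; exists s.
move/max_poly_roots => /(_ [seq t%:R | t <- iota 0 p]).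
rewrite size_map size_iota map_inj_in_uniq ?iota_uniq; last first.
  move=> i j; rewrite !mem_iota !add0n => /= lti ltj.
  exact: (pchar_natr_inj chp).
have -> : all (root (\prod_(s | real s) Q s)) [seq t%:R | t <- iota 0 p].
  apply/allP => _ /mapP[t _ ->].
  pose b : aint := \sum_i a i * t%:R ^+ i.
  have [q mq Dq] := minCpoly_aint b.
  have [r Dr] := monic_int_poly_aint_roots mq.
  have Dr' := map_int_poly_residue Dr.
  have rb : b \in r.
    have := root_minCpoly (\val b); rewrite Dq Dr -(big_map val predT (fun z => 'X - z%:P)) root_prod_XsubC.
    by rewrite mem_map //; apply: val_inj.
  have : root (map_poly intr q) (phi b ^+ p).
    apply: root_int_poly_Frobenius.
    by rewrite Dr' -(big_map phi predT (fun z => 'X - z%:P)) root_prod_XsubC map_f.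
  rewrite Dr' -(big_map phi predT (fun z => 'X - z%:P)) root_prod_XsubC => /mapP[z rz Dz].
  have [h hb] : exists h : {rmorphism algC -> algC}, h (\val b) = \val z.
    apply: conj_aut; rewrite Dq Dr -(big_map val predT (fun z => 'X - z%:P)) root_prod_XsubC.
    exact: map_f.
  have [s Ds] : exists s : {ffun 'I_m -> 'I_m}, forall i, aint_aut h (a i) = a (s i).
    have [s Ds] := fin_all_exists (stab h).
    by exists (finfun s) => i; rewrite ffunE.
  have rs : real s by apply/pboolP; exists h.
  rewrite /root horner_prod (bigD1 s) //= mulf_eq0; apply/orP; left.
  have Dz' : z = \sum_i a (s i) * t%:R ^+ i.
    have val_sum (c : 'I_m -> aint) :
        \val (\sum_i c i * t%:R ^+ i) = \sum_i \val (c i) * t%:R ^+ i.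
      rewrite (rmorph_sum (\val : aint -> algC)); apply: eq_bigr => i _.
      by rewrite rmorphM rmorphXn rmorph_nat.
    apply: val_inj; rewrite -hb !val_sum rmorph_sum; apply: eq_bigr => i _.
    by rewrite rmorphM rmorphXn rmorph_nat -Ds val_aint_aut.
  apply/eqP; transitivity (phi b ^+ p - phi z); last by rewrite Dz subrr.
  rewrite -(pFrobenius_autE chp) Dz' !rmorph_sum -sumrB horner_poly.
  apply: eq_bigr => i _; rewrite valK mulrBl; congr (_ - _).
    by rewrite !rmorphM !rmorphXn !rmorph_nat /= pFrobenius_autE.
  by rewrite rmorphM rmorphXn rmorph_nat.
move=> /(_ isT isT) ltp2; suff : (p < p)%N by rewrite ltnn.
apply: leq_trans ltp2 _; apply: leq_trans (size_prod_leq _ _) _.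
rewrite leq_subLR; apply: leq_trans (_ : (m * m ^ m).+1 + #|real| <= _)%N; last first.
  by rewrite addnC leq_add2l.
apply: leq_trans (_ : (\sum_(s | real s) m).+1 <= _)%N.
  by rewrite ltnS; apply: leq_sum => s _; apply: size_poly.
rewrite sum_nat_const addSn ltnS; apply: leq_trans (leq_addr _ _).
rewrite mulnC leq_mul2l; apply/orP; right; apply: leq_trans (max_card _) _.
by rewrite card_ffun !card_ord.
Qed.

End Residue.

(** * Primes that split completely *)

Lemma exists_nonroot (R : numDomainType) (P : {poly R}) : P != 0 -> exists t : nat, P.[t%:R] != 0.
Proof.
move=> nzP; apply: Classical_Prop.NNPP => nt.
have := max_poly_roots (rs := [seq t%:R | t <- iota 0 (size P)]) nzP.
rewrite size_map size_iota ltnn => W; suff: false by []; apply: W; last first.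
  by rewrite map_inj_uniq ?iota_uniq // => i j /eqP; rewrite eqr_nat => /eqP.
apply/allP => _ /mapP[t _ ->]; rewrite /root; apply: contraT => nz.
by case: nt; exists t.
Qed.

(** Euclid's argument: [m(W a t) = a u] with [a = m(0)] and [u] congruent to 1 modulo [W], so a
    prime divisor of [u] does not divide [W]. *)
Lemma prime_dvd_value (m : {poly int}) (W : nat) : (1 < size m)%N -> (0 < W)%N ->
  exists (p : nat) (c : int), [/\ prime p, ~~ (p %| W)%N & (p %| m.[c])%Z].
Proof.
move=> szm W0; have [m0|nz0] := eqVneq m.[0] 0.
  have [p ltWp prp] := prime_above W; exists p, 0; split=> //; last by rewrite m0.
  by rewrite gtnNdvd.
pose a := m.[0]; pose N := m \Po ((W%:R * a) *: 'X).
have nzWa : W%:R * a != 0 by rewrite mulf_neq0 // pnatr_eq0 -lt0n.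
have szN : size N = size m.
  by rewrite size_comp_poly2 // size_scale // size_polyX.
have nzN (c : int) : N - c%:P != 0.
  apply: contraTneq szm => /eqP; rewrite subr_eq0 -szN => /eqP ->.
  by rewrite size_polyC; case: (c != 0).
(* The three factors keep [u] away from 1, -1 and 0. *)
have [t nzt] : exists t : nat, ((N - a%:P) * (N - (- a)%:P) * (N - 0%:P)).[t%:R] != 0.
  by apply: exists_nonroot; rewrite !mulf_neq0.
have /factor_theorem[m1 Dm1] : root (m - a%:P) 0 by rewrite /root !hornerE subrr.
have Dm : m = m1 * 'X + a%:P by rewrite -[m in LHS](subrK a%:P) Dm1 subr0.
pose u := 1 + W%:R * (t%:R * m1.[W%:R * a * t%:R]).
have Nt : N.[t%:R] = a * u.
  rewrite horner_comp hornerZ hornerX {1}Dm hornerD hornerM hornerX hornerC /u /=; ring.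
have gt1 : (1 < `|u|)%N.
  move: nzt; rewrite !hornerE Nt; apply: contraNT; rewrite -leqNgt.
  case: u {Nt} => [[|[|//]]|[|//]] _; rewrite ?mulr0 ?mulr1 ?subrr ?mulr0 ?mul0r //.
  by rewrite (_ : Negz 0 = -1) // mulrN1 subrr mulr0 mul0r.
exists (pdiv `|u|), (W%:R * a * t%:R); split; first exact: pdiv_prime.
  apply/negP => dW; have : (pdiv `|u| %| u - W%:R * (t%:R * m1.[W%:R * a * t%:R]))%Z.
    rewrite rpredB //; first by rewrite dvdzE; apply: pdiv_dvd.
    by rewrite dvdz_mulr // natz dvdzE.
  rewrite /u addrK dvdzE /= dvdn1 => /eqP E.
  by have := pdiv_prime gt1; rewrite E.
have <- : N.[t%:R] = m.[W%:R * a * t%:R] by rewrite horner_comp !hornerE.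
by rewrite Nt dvdz_mull // dvdzE; apply: pdiv_dvd.
Qed.

Lemma horner_val_aint (q : {poly int}) (x : aint) :
  \val (map_poly intr q).[x] = (map_poly intr q).[\val x].
Proof.
rewrite -(horner_map (\val : aint -> algC)) -map_poly_comp; congr _.[_].
by apply: eq_map_poly => z; apply: (rmorph_int (\val : aint -> algC)).
Qed.

(** [x] divides the constant term of its minimal polynomial, which is nonzero because 0 is not
    conjugate to [x]. *)
Lemma aint_dvd_int (x : aint) : x != 0 ->
  exists (c : int) (w : aint), c != 0 /\ c%:~R = x * w.
Proof.
move=> nzx; have [q mq Dq] := minCpoly_aint x.
have nzc : q.[0] != 0.
  apply: contraNneq nzx => q0.
  have [h hx] : exists h : {rmorphism algC -> algC}, h (\val x) = 0.
    apply: conj_aut; rewrite Dq /root -[0 in X in X == _](rmorph0 intr).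
    by rewrite horner_map q0 rmorph0.
  by apply/eqP/val_inj/(fmorph_inj h); rewrite hx rmorph0.
have /factor_theorem[m1 Dm1] : root (q - q.[0]%:P) 0 by rewrite /root !hornerE subrr.
have Dm : q = m1 * 'X + q.[0]%:P by rewrite -[q in LHS](subrK q.[0]%:P) Dm1 subr0.
exists q.[0], (- (map_poly intr m1).[x]); split => //.
have E : (map_poly intr q).[x] = (map_poly intr m1).[x] * x + (q.[0])%:~R.
  by rewrite [in LHS]Dm rmorphD rmorphM /= map_polyX map_polyC hornerMXaddC.
have E0 : (map_poly intr q).[x] = 0.
  apply: val_inj; rewrite horner_val_aint -Dq; exact/rootP/root_minCpoly.
by apply/eqP; rewrite mulrN mulrC -addr_eq0 addrC -E E0.
Qed.

Lemma intr_pchar_eq0 (k : fieldType) (p : nat) (c : int) : p \in [pchar k] ->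
  (c%:~R == 0 :> k) = (p %| `|c|)%N.
Proof.
move=> chp; case: c => n; first by rewrite -(dvdn_pcharf chp).
by rewrite NegzE mulrNz oppr_eq0 abszN -(dvdn_pcharf chp).
Qed.

Lemma residue_nonzero_bound (L : seq aint) : 0 \notin L ->
  exists2 W : nat, (0 < W)%N &
    forall (p : nat) (k : fieldType) (phi : {rmorphism aint -> k}),
      p \in [pchar k] -> ~~ (p %| W)%N -> forall x, x \in L -> phi x != 0.
Proof.
elim: L => [|x L IH]; first by exists 1%N.
rewrite inE negb_or eq_sym => /andP[nzx /IH[W W0 WP]].
have [c [w [nzc Dc]]] := aint_dvd_int nzx.
exists (`|c| * W)%N; first by rewrite muln_gt0 absz_gt0 nzc.
move=> p k phi chp; rewrite Euclid_dvdM; last by case/andP: chp.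
rewrite negb_or => /andP[ndc ndW] y; rewrite inE => /predU1P[->|]; last exact: WP chp ndW y.
apply: contra ndc => /eqP phi0.
have /eqP : (c%:~R : k) = 0 by rewrite -(rmorph_int phi) Dc rmorphM phi0 mul0r.
by rewrite (intr_pchar_eq0 _ chp).

Qed.

Lemma rat_poly_values (ps : seq {poly rat}) (z : algC) :
  exists2 W : nat, (0 < W)%N & forall q, q \in ps -> exists (a : int) (q' : {poly int}),
    [/\ a != 0, (`|a| %| W)%N & a%:~R * (map_poly ratr q).[z] = (map_poly intr q').[z]].
Proof.
elim: ps => [|q ps [W W0 WP]]; first by exists 1%N.
have [q' [a nza Dq]] := rat_poly_scale q.
exists (`|a| * W)%N; first by rewrite muln_gt0 absz_gt0 nza.
move=> q1; rewrite inE => /predU1P[-> | /WP[a1 [q2 [nza1 da1 E]]]]; last first.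
  by exists a1, q2; split => //; apply: dvdn_mull.
exists a, q'; split; rewrite ?dvdn_mulr // Dq.
rewrite map_polyZ -map_poly_comp hornerZ fmorphV rmorph_int mulrA divff ?intr_eq0 // mul1r.
by congr _.[_]; apply: eq_map_poly => c /=; rewrite rmorph_int.
Qed.

(** Let [z] be a primitive element of the field generated by [S], and [p] a prime modulo which its
    minimal polynomial has a root [c]. Some conjugate [z'] of [z] reduces to [c], and all of [S],
    being stable under conjugation, consists of polynomial expressions in [z'] with denominators
    prime to [p]. *)
Lemma exists_split_prime (S : seq aint) (B : nat) :
  (forall (h : {rmorphism algC -> algC}) x, x \in S -> aint_aut h x \in S) ->
  exists (p : nat) (k : fieldType) (phi : {rmorphism aint -> k}),
    [/\ p \in [pchar k], (B < p)%N, {in S, forall x, phi x ^+ p = phi x}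
      & {in S &, injective phi}].
Proof.
move=> stab.
have [z0 [a Dz] [ps Dps]] := algC_PET (map val S).
have [z Dz0] : exists z : aint, \val z = z0.
  suff Az : z0 \in Aint by exists (Sub z0 Az).
  rewrite Dz rpred_sum // => i _; rewrite rpredMn //.
  by have /mapP[y _ ->] := mem_nth 0 (ltn_ord i); apply: valP.
have [W1 W1_gt0 W1P] := rat_poly_values ps z0.
pose L := [seq x - y | x <- S, y <- S].
have [W2 W2_gt0 W2P] := residue_nonzero_bound (L := [seq x <- L | x != 0]) ltac:(by rewrite mem_filter eqxx).
have [m mm Dm] := minCpoly_aint z.
have szm : (1 < size m)%N.
  by rewrite -(size_map_inj_poly (f := intr : int -> algC)) ?rmorph0 -?Dm ?size_minCpoly //; apply: intr_inj.
(* [B!] forces [p > B], [W1] contains the denominators, and [W2] keeps distinct elements of [S]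
   distinct after reduction. *)
have [p [c [prp ndW dv]]] := prime_dvd_value szm (W := (B`! * (W1 * W2))%N)
  ltac:(by rewrite !muln_gt0 fact_gt0 W1_gt0).
move: ndW; rewrite !Euclid_dvdM // !negb_or => /and3P[ndB nd1 nd2].
have [k [phi chp]] := exists_residue_field prp.
have fixc (x : int) : (x%:~R : k) ^+ p = x%:~R.
  by rewrite -(pFrobenius_autE chp) rmorph_int.
exists p, k, phi; split=> //.
- by rewrite ltnNge; apply: contra ndB => le; rewrite dvdn_fact // prime_gt0.
- have [r Dr] := monic_int_poly_aint_roots mm.
  have Dr' := map_int_poly_residue phi Dr.
  have : root (map_poly intr m : {poly k}) c%:~R.
    by rewrite /root horner_map (intr_pchar_eq0 _ chp).
  rewrite Dr' -(big_map phi predT (fun z => 'X - z%:P)) root_prod_XsubC => /mapP[z' rz' Dz'].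
  have [h hz] : exists h : {rmorphism algC -> algC}, h (\val z) = \val z'.
    apply: conj_aut; rewrite Dm Dr -(big_map val predT (fun z => 'X - z%:P)) root_prod_XsubC.
    exact: map_f.
  move=> x Sx; pose x1 := aint_aut (algC_invaut h) x.
  have Sx1 : x1 \in S by apply: stab.
  have hx1 : h (\val x1) = \val x by rewrite val_aint_aut algC_invautK.
  have : \val x1 \in map val S by apply: map_f.
  rewrite Dps => /mapP[q psq Dq]; have [a1 [q' [nza da E]]] := W1P _ psq.
  have E2 : a1%:~R * x = (map_poly intr q').[z'].
    apply: val_inj; rewrite horner_val_aint -hz Dz0.
    transitivity (a1%:~R * h (\val x1)).
      by rewrite hx1 -(rmorph_int (\val : aint -> algC)).
    rewrite Dq -(rmorph_int h) -rmorphM E.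
    rewrite -horner_map -map_poly_comp; congr _.[_].
    by apply: eq_map_poly => y; rewrite /= rmorph_int.
  have nza1 : (a1%:~R : k) != 0.
    by rewrite (intr_pchar_eq0 _ chp); apply: contra nd1 => /dvdn_trans; apply.
  have : a1%:~R * phi x = (q'.[c])%:~R.
    rewrite -(rmorph_int phi) -rmorphM E2 -horner_map -map_poly_comp -Dz'.
    rewrite -(horner_map intr); congr _.[_]; apply: eq_map_poly => y; rewrite /= rmorph_int //.
  move=> E3; apply: (mulfI nza1); rewrite E3 -(fixc q'.[c]) -E3 exprMn fixc.
  by [].
move=> x y Sx Sy E; apply/eqP; rewrite -subr_eq0; apply: contraT => nz.
have : phi (x - y) != 0.
  by apply: W2P chp nd2 _ _; rewrite mem_filter nz; apply/allpairsP; exists (x, y).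
by rewrite rmorphB E subrr eqxx.
Qed.

(** * Goursat-type lemmas for alternating groups *)

Section PermutationGroups.
Variables (T : finType).
Hypothesis cardT : (4 < #|T|)%N.
Implicit Types W : {group {perm T}}.

Lemma central_perm_eq1 (w : {perm T}) : (forall x y, commute w (tperm x y)) -> w = 1%g.
Proof.
move=> cw; apply/permP => x; rewrite perm1; apply/eqP; apply: contraT => nwx.
have [z] : exists z, z \notin [set x; w x].
  apply/existsP; rewrite -negb_forall; apply: contraL cardT => /forallP sT.
  rewrite -leqNgt (leq_trans (_ : _ <= #|[set x; w x]|)%N) ?subset_leq_card //.
    by apply/subsetP => y _; apply: sT.
  by rewrite (leq_trans (leq_card_setU _ _)) // !cards1.
rewrite !inE negb_or => /andP[zx zw].
have /permP/(_ x) := cw (w x) z; rewrite !permM tpermL tpermD //.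
by move/eqP; rewrite (negbTE zw).
Qed.

(** If [W] meets [Alt] trivially, its commutators with transpositions, being even, vanish, and [W]
    is central. *)
Lemma normal_perm_group W : [set: {perm T}] \subset ('N(W))%g ->
  ('Alt_T \subset W)%g \/ W :=: 1%g.
Proof.
move=> nW; have /simpleP[_ /(_ (W :&: 'Alt_T)%G)] := simple_Alt5 cardT.
case=> [|W1|WA]; last by left; rewrite -WA subsetIl.
  rewrite /normal subsetIr normsI ?normG //.
  exact: subset_trans (subsetT _) nW.
right; apply/trivgP/subsetP => w Ww; rewrite inE; apply/eqP/central_perm_eq1 => x y.
apply/commgP; suff : [~ w, tperm x y]%g \in (W :&: 'Alt_T)%g by rewrite W1 inE.
rewrite inE Alt_even commgEl groupM ?groupV ?memJ_norm ?(subsetP nW) ?inE //.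
by rewrite odd_permM odd_permV odd_permJ addbb.
Qed.

(** A 3-cycle. Elements are made even by squaring, and this one survives it. *)
Lemma exists_nontrivial_square : exists2 a : {perm T}, a \in ('Alt_T)%g & (a * a != 1)%g.
Proof.
have [x [y [z [_ [xy yz zx]]]]] := card_gt2P (leq_trans (isT : (2 < 5)%N) cardT).
exists (tperm x y * tperm x z)%g; first by rewrite Alt_even odd_permM !odd_tperm xy eq_sym zx.
apply/eqP => /permP/(_ x); rewrite !permM perm1 tpermL (tpermD xy) 1?eq_sym // tpermR tpermL => E.
by rewrite E eqxx in zx.
Qed.
End PermutationGroups.

(** * Independence of several actions through the symmetric group *)

Section IndependentActions.
Variables (n : nat) (A : Type) (mul : A -> A -> A) (one : A) (inv : A -> A).
Variables (I : eqType) (rho : I -> A -> 'S_n).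
Hypothesis n_ge5 : (5 <= n)%N.
Hypothesis rhoM : forall i x y, rho i (mul x y) = (rho i x * rho i y)%g.
Hypothesis rho1 : forall i, rho i one = 1%g.
Hypothesis rhoV : forall i x, rho i (inv x) = (rho i x)^-1%g.
Local Notation Altn := ('Alt_('I_n))%g.

Definition acts_trivially (s : seq I) (h : A) : Prop := forall i, i \in s -> rho i h = 1%g.

Definition acts_evenly (s : seq I) (h : A) : Prop := forall i, i \in s -> rho i h \in Altn.

Definition supported_at (s : seq I) (i : I) (h : A) : Prop :=
  rho i h \in Altn /\ forall j, j \in s -> j != i -> rho j h = 1%g.

(** Products of such [h] realise every family of even permutations on [s]. Signs are left free,
    since different matrices may share their quadratic subfield. *)
Definition independent (s : seq I) : Prop :=
  uniq s /\ forall i a, i \in s -> a \in Altn -> exists h, rho i h = a /\ supported_at s i h.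

Definition full_over (s : seq I) (g : I) : Prop :=
  forall a : 'S_n, exists h, acts_trivially s h /\ rho g h = a.

(** In terms of fields: [d] and [g] have the same splitting field over the fixed field of the
    elements even on [s]. *)
Definition tracks (s : seq I) (d g : I) : Prop :=
  forall h1 h2, acts_evenly s h1 -> acts_evenly s h2 ->
    (rho d h1 = rho d h2 <-> rho g h1 = rho g h2).

Let card_In : (4 < #|'I_n|)%N. Proof. by rewrite card_ord. Qed.

(** [A] is not a group type: it will be the ring endomorphisms of [algC], whose group laws are used
    only after applying [rho]. *)
Record subgroup_pred (C : A -> Prop) : Prop := SubgroupPred {
  subgroup1 : C one;
  subgroupM : forall x y, C x -> C y -> C (mul x y);
  subgroupV : forall x, C x -> C (inv x) }.

Lemma image_group (C : A -> Prop) g : subgroup_pred C ->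
  exists W : {group 'S_n}, forall a, a \in W <-> exists h, C h /\ rho g h = a.
Proof.
move=> [C1 CM CV]; pose W := [set a : 'S_n | pbool (exists h, C h /\ rho g h = a)].
have gW : group_set W.
  apply/group_setP; split; first by rewrite inE; apply/pboolP; exists one.
  move=> a b; rewrite !inE => /pboolP[h [Ch <-]] /pboolP[k [Ck <-]].
  by apply/pboolP; exists (mul h k); rewrite rhoM; split=> //; apply: CM.
by exists (group gW) => a; rewrite inE; split=> /pboolP.
Qed.

(** The image of [C] is normal in [S_n], because [C] is stable under conjugation and [rho g] is
    onto. *)
Lemma image_dichotomy (C : A -> Prop) g : subgroup_pred C ->
  (forall h x, C x -> C (mul (inv h) (mul x h))) ->
  (forall a : 'S_n, exists h, rho g h = a) ->
  (forall a, a \in Altn -> exists h, C h /\ rho g h = a) \/ (forall h, C h -> rho g h = 1%g).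
Proof.
move=> sgC CJ full; have [W DW] := image_group g sgC.
have [|sAW|W1] := @normal_perm_group _ card_In W.
- apply/subsetP => a _; rewrite inE; apply/subsetP => _ /imsetP[w /DW[x [Cx <-]] ->].
  have [h <-] := full a.
  by apply/DW; exists (mul (inv h) (mul x h)); rewrite !rhoM rhoV; split; first exact: CJ.
- by left=> a Aa; apply/DW/(subsetP sAW).
by right=> h Ch; apply/set1gP; rewrite -[1%g]W1; apply/DW; exists h.
Qed.

Lemma acts_trivially_subgroup s : subgroup_pred (acts_trivially s).
Proof.
split=> [i|x y tx ty i si|x tx i si]; first by rewrite rho1.
  by rewrite rhoM tx // ty // mulg1.
by rewrite rhoV tx // invg1.
Qed.

Lemma acts_trivially_conj s h x :
  acts_trivially s x -> acts_trivially s (mul (inv h) (mul x h)).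
Proof. by move=> tx i si; rewrite !rhoM rhoV tx // mul1g mulVg. Qed.

Lemma supported_at_subgroup s i : subgroup_pred (supported_at s i).
Proof.
split=> [|x y [ex tx] [ey ty]|x [ex tx]].
- by split=> [|j _ _]; rewrite rho1 ?group1.
- by split=> [|j sj ji]; rewrite rhoM ?groupM // tx // ty // mulg1.
by split=> [|j sj ji]; rewrite rhoV ?groupV // tx // invg1.
Qed.

Lemma supported_at_conj s i h x :
  supported_at s i x -> supported_at s i (mul (inv h) (mul x h)).
Proof.
move=> [ex tx]; split=> [|j sj ji]; rewrite !rhoM rhoV; last by rewrite tx // mul1g mulVg.
by rewrite -[(_ * _)%g]/(rho i x ^ rho i h)%g Alt_even odd_permJ -Alt_even.
Qed.

Lemma square_acts_evenly s h : acts_evenly s (mul h h).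
Proof. by move=> i _; rewrite rhoM Alt_even odd_permM addbb. Qed.

(* Squaring makes any element even on [g], and by simplicity the squares generate [Alt n]. *)
Lemma independent_cons s g : independent s -> g \notin s ->
  (forall a, a \in Altn -> exists h, acts_trivially s h /\ rho g h = a) ->
  independent (g :: s).
Proof.
move=> [us ind] gs full; split; first by rewrite /= gs.
move=> i a; rewrite inE => /predU1P[-> Aa|si].
  have [h [th hg]] := full a Aa; exists h; split=> //; split; first by rewrite hg.
  by move=> j; rewrite inE => /predU1P[->|/th //]; rewrite eqxx.
have ig : i != g by apply: contraNneq gs => <-.
have sgC := supported_at_subgroup (g :: s) i.
have [W DW] := image_group i sgC.
suff : (Altn \subset W)%g by move=> /subsetP sAW /sAW/DW[h [Ch <-]]; exists h.
have sub_sq b : b \in Altn -> (b * b)%g \in W.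
  move=> Ab; have [h [hi [eh th]]] := ind i b si Ab.
  have [k [tk kg]] : exists k, acts_trivially s k /\ rho g k = ((rho g (mul h h))^-1)%g.
    by apply: full; rewrite groupV; apply: (square_acts_evenly (s := [:: g])); rewrite inE.
  apply/DW; exists (mul (mul h h) k); rewrite !rhoM tk // hi mulg1; split=> //; split.
    by rewrite !rhoM tk // mulg1 hi groupM.
  move=> j; rewrite inE => /predU1P[->|sj] ji; first by rewrite !rhoM kg rhoM mulgV.
  by rewrite !rhoM tk // th // !mulg1.
have /simpleP[_ simA] := simple_Alt5 card_In.
have WA : (W \subset Altn)%g by apply/subsetP => w /DW[h [[eh _] <-]].
have [] : W = 1%g :> {set _} \/ W = Altn :> {set _}; last by move=> ->.
  apply: simA; rewrite /normal WA; apply/subsetP => c Ac.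
  rewrite inE; apply/subsetP => _ /imsetP[w /DW[x [Cx <-]] ->].
  have [h [<- _]] := ind i c si Ac.
  by apply/DW; exists (mul (inv h) (mul x h)); rewrite !rhoM rhoV; split; first exact: supported_at_conj.
move=> W1; have [b Ab /eqP] := exists_nontrivial_square card_In.
by case; apply/set1gP; rewrite -W1; apply: sub_sq.
Qed.

Section Dependent.
Variables (s : seq I) (g : I).
Hypothesis ind : independent s.
Hypothesis triv : forall h, acts_trivially s h -> rho g h = 1%g.

Lemma eq_on_dependent h1 h2 :
  (forall i, i \in s -> rho i h1 = rho i h2) -> rho g h1 = rho g h2.
Proof.
move=> E; apply/eqP; rewrite eq_mulgV1 -rhoV -rhoM; apply/eqP/triv => i si.
by rewrite rhoM rhoV E // mulgV.
Qed.

(** Induction on [t]: dividing [h] by an element supported at [i] with the same action there clears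
    this component without changing [rho g h]. *)
Lemma trivial_on_dependent (t : seq I) h : {subset t <= s} -> acts_evenly s h ->
  (forall j, j \in s -> j \notin t -> rho j h = 1%g) ->
  (forall i, i \in t -> forall x, supported_at s i x -> rho g x = 1%g) ->
  rho g h = 1%g.
Proof.
elim: t h => [|i t IH] h sts eh th Wt; first by apply: triv => j sj; apply: th.
have si : i \in s by apply: sts; rewrite mem_head.
have [_ /(_ i (rho i h) si (eh i si))[x [xi sx]]] := ind.
have gx : rho g x = 1%g by apply: Wt sx; rewrite mem_head.
have <- : rho g (mul h (inv x)) = rho g h by rewrite rhoM rhoV gx invg1 mulg1.
have xj j : j \in s -> j != i -> rho j (mul h (inv x)) = rho j h.
  by case: sx => _ tx sj ji; rewrite rhoM rhoV tx // invg1 mulg1.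
have xi1 : rho i (mul h (inv x)) = 1%g by rewrite rhoM rhoV xi mulgV.
apply: IH => [j tj|j sj|j sj ntj|j tj].
- by apply: sts; rewrite inE tj orbT.
- by have [->|ji] := eqVneq j i; rewrite ?xi1 ?group1 // xj //; apply: eh.
- have [->|ji] := eqVneq j i; first by rewrite xi1.
  by rewrite xj // th // inE negb_or ji.
by apply: Wt; rewrite inE tj orbT.
Qed.

(** Goursat's argument: among the factors [Alt n] indexed by [s], only the one at [i] can act
    nontrivially on [g], and it does so faithfully. *)
Lemma tracks_dependent i : i \in s -> (forall a : 'S_n, exists h, rho g h = a) ->
  (exists x, supported_at s i x /\ rho g x <> 1%g) -> tracks s i g.
Proof.
move=> si full [x0 [sx0 nx0]].
have dich j := image_dichotomy (supported_at_subgroup s j) (@supported_at_conj s j) full.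
have ontoi : forall a, a \in Altn -> exists h, supported_at s i h /\ rho g h = a.
  by case: (dich i) => // /(_ _ sx0).
have others j : j \in s -> j != i -> forall x, supported_at s j x -> rho g x = 1%g.
  move=> sj ji; case: (dich j) => // ontoj; exfalso.
  (* Elements supported at [i] and at [j] commute in every action of [s], hence on [g]; if both
     kinds were onto, [Alt n] would be abelian. *)
  have : abelian Altn.
    apply/centsP => a /ontoi[x [[ex tx] <-]] b /ontoj[y [[ey ty] <-]].
    rewrite /commute -!rhoM; apply: eq_on_dependent => l sl; rewrite !rhoM.
    have [-> | lj] := eqVneq l j; first by rewrite tx // mul1g mulg1.
    by rewrite [rho l y]ty // mul1g mulg1.
  by move/abelian_sol; rewrite solvable_AltF.
have rest h : acts_evenly s h -> rho i h = 1%g -> rho g h = 1%g.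
  move=> eh hi; apply: (@trivial_on_dependent (filter (predC1 i) s)) => //.
  - by move=> j; rewrite mem_filter => /andP[].
  - by move=> j sj; rewrite mem_filter sj andbT /= negbK => /eqP ->.
  by move=> j; rewrite mem_filter => /andP[/= ji sj]; apply: others.
(* The elements supported at [i] and trivial on [g] have normal image in [Alt n]; it is not
   everything, because of [x0], hence trivial. *)
have inj_i h : acts_evenly s h -> rho g h = 1%g -> rho i h = 1%g.
  have sgB : subgroup_pred (fun h => supported_at s i h /\ rho g h = 1%g).
    have [S1 SM SV] := supported_at_subgroup s i.
    split=> [|x y [sx gx] [sy gy]|x [sx gx]]; rewrite ?rho1 //; split; auto.
      by rewrite rhoM gx gy mulg1.
    by rewrite rhoV gx invg1.
  have [W DW] := image_group i sgB.
  have WA : (W \subset Altn)%g by apply/subsetP => w /DW[y [[[ey _] _] <-]].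
  have /simpleP[_ simA] := simple_Alt5 card_In.
  have [] : W = 1%g :> {set _} \/ W = Altn :> {set _}.
    apply: simA; rewrite /normal WA; apply/subsetP => a Aa.
    rewrite inE; apply/subsetP => _ /imsetP[w /DW[y [[sy gy] <-]] ->].
    have [k [<- _]] := ind.2 i a si Aa.
    apply/DW; exists (mul (inv k) (mul y k)); rewrite !rhoM !rhoV gy mul1g mulVg; split=> //.
    by split=> //; apply: supported_at_conj.
  - move=> W1 eh gh; have [y [yi sy]] := ind.2 i _ si (eh i si).
    apply/set1gP; rewrite -W1; apply/DW; exists y; split=> //; split=> //.
    suff : rho g (mul h (inv y)) = 1%g by rewrite rhoM rhoV gh mul1g => /eqP; rewrite invg_eq1 => /eqP.
    apply: rest; last by rewrite rhoM rhoV yi mulgV.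
    move=> j sj; rewrite rhoM rhoV groupM ?eh // groupV.
    have [->|ji] := eqVneq j i; first by rewrite yi eh.
    by case: sy => _ /(_ _ sj ji) ->; rewrite group1.
  move=> WA' _ _; case: nx0; have /DW[y [[sy gy] yi]] : rho i x0 \in W by rewrite WA'; case: sx0.
  rewrite -gy; apply: eq_on_dependent => j sj.
  have [->|ji] := eqVneq j i; first by rewrite yi.
  by case: sx0 sy => [_ ->] // [_ ->].
move=> h1 h2 e1 e2.
have e12 : acts_evenly s (mul h1 (inv h2)).
  by move=> j sj; rewrite rhoM rhoV groupM ?groupV ?e1 ?e2.
split=> E; apply/eqP; rewrite eq_mulgV1 -rhoV -rhoM; apply/eqP; [apply: rest | apply: inj_i] => //.
  by rewrite rhoM rhoV E mulgV.
by rewrite rhoM rhoV E mulgV.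
Qed.
End Dependent.

(** Fullness over [s0] forces the tracking [d] into [s1]: otherwise everything supported at an index
    of [s1] would be trivial on [g], and so would the square of any element trivial on [s0]. In the
    application [s1] holds the representatives of the current stage, which carry the right
    prescribed group. *)
Lemma independent_or_tracked (s0 s1 : seq I) g :
  independent (s1 ++ s0) -> full_over s0 g ->
  independent (g :: s1 ++ s0) \/ exists2 d, d \in s1 & tracks (s1 ++ s0) d g.
Proof.
set s := s1 ++ s0 => ind full.
have full' a : exists h, rho g h = a by have [h [_ <-]] := full a; exists h.
have [] := image_dichotomy (acts_trivially_subgroup s) (@acts_trivially_conj s) full'.
  move=> onto; left; apply: independent_cons => //; apply/negP => gs.
  have [b Ab] := exists_nontrivial_square card_In; have [h [th hb]] := onto b Ab.
  by rewrite -hb th // mulg1 eqxx.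
move=> triv; right; apply: Classical_Prop.NNPP => nd.
have [b Ab /eqP] := exists_nontrivial_square card_In; case.
have [h [th <-]] := full b; rewrite -rhoM.
apply: (@trivial_on_dependent _ _ ind triv s1).
- by move=> i; rewrite /s mem_cat => ->.
- exact: square_acts_evenly.
- by move=> j; rewrite /s mem_cat => /orP[->|sj _] //; rewrite rhoM th // mulg1.
move=> i s1i x sx; apply: Classical_Prop.NNPP => nx; apply: nd; exists i => //.
apply: tracks_dependent => //; first by rewrite /s mem_cat s1i.
by exists x.
Qed.

End IndependentActions.

(** * Galois action on eigenvalues and Frobenius types *)

(** [s1] and [s2] make [W] transitive, which moves the transposition to one through [i0]; powers of
    [s1] fix [i0] and carry it to all transpositions through [i0], and these generate. *)
Lemma full_perm_group (T : finType) (W : {group {perm T}}) (i0 x y : T) (s1 s2 : {perm T}) :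
  s1 \in W -> s1 i0 = i0 -> (forall i j, i != i0 -> j != i0 -> exists e, (s1 ^+ e)%g i = j) ->
  s2 \in W -> s2 i0 != i0 -> x != y -> tperm x y \in W -> W :=: [set: {perm T}].
Proof.
move=> W1 fix1 cyc W2 mov2 xy Wt.
have [w Ww wx] : exists2 w, w \in W & w x = i0.
  have [->|xi0] := eqVneq x i0; first by exists 1%g; rewrite ?group1 ?perm1.
  have [|e E] := cyc x (s2^-1 i0)%g xi0.
    by apply: contraNneq mov2 => E; rewrite -[in X in X == _]E permKV.
  by exists (s1 ^+ e * s2)%g; rewrite ?groupM ?groupX // permM E permKV.
have Wt1 : tperm i0 (w y) \in W by rewrite -wx -tpermJ groupJ.
have wy : w y != i0 by rewrite -wx (inj_eq perm_inj) eq_sym.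
apply/eqP; rewrite eqEsubset subsetT -(gen_tperm i0) gen_subG.
apply/subsetP => _ /imsetP[j _ ->].
have [->|ji] := eqVneq j i0; first by rewrite tperm1 group1.
have [e <-] := cyc _ _ wy ji.
have fixe : (s1 ^+ e)%g i0 = i0 by rewrite permX; elim: e => //= e ->.
by rewrite -{1}fixe -tpermJ groupJ ?groupX.
Qed.

Section RootAction.
Variable n : nat.
Implicit Types g d : 'M[int]_n.

Local Notation Aut := {rmorphism algC -> algC}.

Definition rts g : seq aint := sval (monic_int_poly_aint_roots (char_poly_monic g)).

Lemma rtsP g :
  map_poly intr (char_poly g) = \prod_(z <- rts g) ('X - (\val z)%:P) :> {poly algC}.
Proof. exact: svalP (monic_int_poly_aint_roots (char_poly_monic g)). Qed.

Lemma size_rts g : size (rts g) = n.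
Proof.
have := congr1 (fun q : {poly algC} => size q) (rtsP g).
rewrite size_prod_XsubC size_map_inj_poly ?size_char_poly ?rmorph0 //; last exact: intr_inj.
by case.
Qed.

Definition rt g (i : 'I_n) : aint := nth 0 (rts g) i.

Lemma mem_rtsP g z : reflect (exists i, z = rt g i) (z \in rts g).
Proof.
apply: (iffP (nthP 0)) => [[i lti <-]|[i ->]].
  by rewrite size_rts in lti; exists (Ordinal lti).
by exists i; rewrite ?size_rts.
Qed.

Lemma rt_inj g : uniq (rts g) -> injective (rt g).
Proof.
move=> u i j /eqP; rewrite /rt nth_uniq ?size_rts // => /eqP E; exact: val_inj.
Qed.

Lemma aint_aut_rts (h : Aut) g z : z \in rts g -> aint_aut h z \in rts g.
Proof.
move=> rz; have : root (map_poly intr (char_poly g)) (\val z).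
  by rewrite rtsP -(big_map val predT (fun z => 'X - z%:P)) root_prod_XsubC map_f.
move=> /(rmorph_root h); rewrite -map_poly_comp (eq_map_poly (g := intr)); last first.
  by move=> c; rewrite /= rmorph_int.
rewrite rtsP -(big_map val predT (fun z => 'X - z%:P)) root_prod_XsubC -val_aint_aut.
by rewrite mem_map //; apply: val_inj.
Qed.

Lemma aint_aut_inj (h : Aut) : injective (aint_aut h).
Proof.
move=> x y /(congr1 val); rewrite !val_aint_aut => /fmorph_inj E; exact: val_inj.
Qed.

(* The identity when the characteristic polynomial of [g] is not separable. *)
Definition rho g (h : Aut) : 'S_n :=
  if uniq (rts g) then odflt 1%g [pick s : 'S_n | [forall i, aint_aut h (rt g i) == rt g (s i)]]
  else 1%g.

Lemma rhoE g h : uniq (rts g) -> forall i, aint_aut h (rt g i) = rt g (rho g h i).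
Proof.
move=> u; rewrite /rho u; case: pickP => [s /forallP Ds i|noS]; first exact/eqP.
have stab i : exists j, aint_aut h (rt g i) = rt g j.
  by apply/mem_rtsP/aint_aut_rts/mem_rtsP; exists i.
have [f Df] := fin_all_exists stab.
have f_inj : injective f.
  by move=> i j E; apply: (rt_inj u); apply: (@aint_aut_inj h); rewrite !Df E.
by have /forallP[] := noS (perm f_inj); move=> i; rewrite permE Df.
Qed.

Lemma rho_eq g h (s : 'S_n) : uniq (rts g) ->
  (forall i, aint_aut h (rt g i) = rt g (s i)) -> rho g h = s.
Proof.
by move=> u E; apply/permP => i; apply: (rt_inj u); rewrite -rhoE.
Qed.

(** The order is that of products of permutations, which act on the right; this makes [rho] a
    morphism. *)
Definition aut_mul (h1 h2 : Aut) : Aut := h2 \o h1.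
Definition aut_one : Aut := idfun.
Definition aut_inv (h : Aut) : Aut := algC_invaut h.

Lemma aint_aut_mul h1 h2 x : aint_aut (aut_mul h1 h2) x = aint_aut h2 (aint_aut h1 x).
Proof. by apply: val_inj; rewrite !val_aint_aut. Qed.

Lemma aint_aut_one x : aint_aut aut_one x = x.
Proof. by apply: val_inj; rewrite val_aint_aut. Qed.

Lemma rho_id g h : (forall i, aint_aut h (rt g i) = rt g i) -> rho g h = 1%g.
Proof.
move=> E; have [u|nu] := boolP (uniq (rts g)); last by rewrite /rho (negbTE nu).
by apply: rho_eq => // i; rewrite perm1.
Qed.

Lemma rhoM g h1 h2 : rho g (aut_mul h1 h2) = (rho g h1 * rho g h2)%g.
Proof.
have [u|nu] := boolP (uniq (rts g)); last by rewrite /rho (negbTE nu) mulg1.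
by apply: rho_eq => // i; rewrite aint_aut_mul permM -!rhoE.
Qed.

Lemma rho1 g : rho g aut_one = 1%g.
Proof. by apply: rho_id => i; rewrite aint_aut_one. Qed.

Lemma rhoV g h : rho g (aut_inv h) = (rho g h)^-1%g.
Proof.
apply: (mulgI (rho g h)); rewrite mulgV -rhoM; apply: rho_id => i.
by apply: val_inj; rewrite val_aint_aut /= algC_autK.
Qed.

End RootAction.

(** * Cycle types read off from residue polynomials *)

Section FrobeniusTypes.
Variable n : nat.
Implicit Types g d : 'M[int]_n.
Local Notation Aut := {rmorphism algC -> algC}.

Definition all_rts (s : seq 'M[int]_n) : seq aint := flatten (map (@rts n) s).

Lemma size_all_rts s : size (all_rts s) = (n * size s)%N.
Proof.
rewrite size_flatten /shape -map_comp (eq_map (g := fun=> n)); last by move=> g; apply: size_rts.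
by elim: s => [|g s] /=; rewrite ?muln0 ?mulnS // => ->.
Qed.

Lemma aint_aut_all_rts (h : Aut) s z : z \in all_rts s -> aint_aut h z \in all_rts s.
Proof.
move=> /flattenP[_ /mapP[g sg ->] rz]; apply/flattenP.
by exists (rts g); [apply: map_f | apply: aint_aut_rts].
Qed.

(** [m] counts the eigenvalues of the matrices of [s] and of one more; the bound is that of
    [exists_Frobenius_lift]. *)
Definition Frobenius_bound (s : seq 'M[int]_n) : nat :=
  let m := (n * (size s).+1)%N in (m * m ^ m)%N.

(** Complete splitting of [p] in the field generated by the eigenvalues of [s], seen through [phi]:
    Frobenius fixes their residues, and injectivity lifts this to the eigenvalues themselves. *)
Definition splits_at (s : seq 'M[int]_n) (p : nat) (k : fieldType)
    (phi : {rmorphism aint -> k}) : Prop :=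
  [/\ p \in [pchar k], (Frobenius_bound s < p)%N,
      {in all_rts s, forall z, phi z ^+ p = phi z} & {in all_rts s &, injective phi}].

Definition long_cycle_type (p : nat) (k : fieldType) (f : {poly k}) : Prop :=
  exists (c x : k),
    [/\ f = ('X - c%:P) * \prod_(j < n.-1) ('X - (x ^+ (p ^ j))%:P), c ^+ p = c,
        x ^+ (p ^ n.-1) = x & uniq (c :: [seq x ^+ (p ^ j) | j <- iota 0 n.-1])].

(** Multiple roots are allowed here; distinctness of the eigenvalues comes from the long cycle type
    at another prime. *)
Definition fixed_point_free_type (p : nat) (k : fieldType) (f : {poly k}) : Prop :=
  forall x, root f x -> x ^+ p != x.

Definition transposition_type (p : nat) (k : fieldType) (f : {poly k}) : Prop :=
  exists (y : k) (a : seq k),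
    [/\ f = ('X - y%:P) * ('X - (y ^+ p)%:P) * \prod_(z <- a) ('X - z%:P),
        y ^+ (p ^ 2) = y, {in a, forall z, z ^+ p = z} & uniq (y :: y ^+ p :: a)].

Section AtPrime.
Variables (s : seq 'M[int]_n) (p : nat) (k : fieldType) (phi : {rmorphism aint -> k}).
Hypothesis split_s : splits_at s p phi.
Variable g : 'M[int]_n.
Local Notation f := (map_poly intr (char_poly g) : {poly k}).

Let chp : p \in [pchar k]. Proof. by case: split_s. Qed.

Lemma residue_char_poly : f = \prod_(z <- map phi (rts g)) ('X - z%:P).
Proof. by rewrite big_map; apply/map_int_poly_residue/rtsP. Qed.

(* Since [p] splits completely in the splitting fields of the matrices in [s], a Frobenius lift fixes these fields pointwise. *)
Lemma exists_split_Frobenius : exists h : Aut,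
  acts_trivially (@rho n) s h /\ forall i, phi (aint_aut h (rt g i)) = phi (rt g i) ^+ p.
Proof.
have [_ bd fixs injs] := split_s.
pose L := all_rts (g :: s).
have szL : size L = (n * (size s).+1)%N by rewrite size_all_rts.
have mL i : (i < size L)%N -> nth 0 L i \in L by apply: mem_nth.
have [|h i|h Dh] := @exists_Frobenius_lift p k phi chp (size L) (fun i => nth 0 L i).
- by rewrite szL.
- have /(nthP 0)[j ltj <-] := @aint_aut_all_rts h (g :: s) _ (mem_nth 0 (ltn_ord i)).
  by exists (Ordinal ltj).
have {}Dh z : z \in L -> phi (aint_aut h z) = phi z ^+ p.
  by move=> /(nthP 0)[i lti <-]; apply: (Dh (Ordinal lti)).
exists h; split=> [d sd|i]; last first.
  by apply: Dh; rewrite mem_cat; apply/orP; left; apply/mem_rtsP; exists i.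
apply: rho_id => i.
have sz : rt d i \in all_rts s.
  by apply/flattenP; exists (rts d); [apply: map_f | apply/mem_rtsP; exists i].
apply: injs => //; first exact: aint_aut_all_rts.
by rewrite Dh ?fixs // mem_cat sz orbT.
Qed.

Lemma exists_Frobenius_perm : uniq (rts g) -> exists h : Aut,
  acts_trivially (@rho n) s h /\ forall i, phi (rt g (rho g h i)) = phi (rt g i) ^+ p.
Proof.
move=> u; have [h [th Dh]] := exists_split_Frobenius.
by exists h; split=> // i; rewrite -rhoE.
Qed.

Lemma residue_roots (r : seq k) : f = \prod_(z <- r) ('X - z%:P) -> uniq r ->
  [/\ uniq (rts g), {in rts g &, injective phi} & forall z, (z \in r) <-> exists i, z = phi (rt g i)].
Proof.
rewrite residue_char_poly => /prod_XsubC_eq E ur.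
have um : uniq (map phi (rts g)) by rewrite (perm_uniq E).
split; first exact: map_uniq um.
  move=> z t rz rt' Ezt; apply/eqP; have := um; move/(uniqP 0).
  rewrite /prop_in2 => /(_ (index z (rts g)) (index t (rts g))).
  rewrite !inE !size_map !index_mem rz rt' !(nth_map 0) ?index_mem // !nth_index // Ezt.
  by move=> /(_ isT isT erefl) /(congr1 (nth 0 (rts g))); rewrite !nth_index // => ->.
move=> z; rewrite -(perm_mem E); split.
  by move=> /mapP[t /mem_rtsP[i ->] ->]; exists i.
by move=> [i ->]; apply/map_f/mem_rtsP; exists i.
Qed.

Lemma long_cycle_perm : long_cycle_type p f -> uniq (rts g) /\
  exists h : Aut, acts_trivially (@rho n) s h /\ exists i0, rho g h i0 = i0 /\
    forall i j, i != i0 -> j != i0 -> exists e, (rho g h ^+ e)%g i = j.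
Proof.
move=> [c [x [Df cp xp ur]]].
have [|u inj mem] := residue_roots _ ur.
  by rewrite Df big_cons big_map -[n.-1]subn0 big_mkord subn0.
split=> //; have [h [th Dh]] := exists_Frobenius_perm u; exists h; split=> //.
have rti i : rt g i \in rts g by apply/mem_rtsP; exists i.
have phi_inj i j : phi (rt g i) = phi (rt g j) -> i = j.
  by move=> /inj E; apply: (rt_inj u); apply: E.
have [i0 Di0] : exists i, c = phi (rt g i) by apply/mem; rewrite mem_head.
exists i0; split; first by apply: phi_inj; rewrite Dh -Di0.
have pow i : i != i0 -> exists2 j, (j < n.-1)%N & phi (rt g i) = x ^+ (p ^ j).
  move=> ni; have : phi (rt g i) \in c :: [seq x ^+ (p ^ j) | j <- iota 0 n.-1].
    by apply/mem; exists i.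
  rewrite inE => /predU1P[E|/mapP[j]].
    by case/eqP: ni; apply: phi_inj; rewrite E.
  by rewrite mem_iota add0n => /= ltj E; exists j.
have iter e i : phi (rt g ((rho g h ^+ e)%g i)) = phi (rt g i) ^+ (p ^ e).
  elim: e => [|e IH]; first by rewrite expg0 perm1 expn0 expr1.
  by rewrite expgSr permM Dh IH -exprM -expnSr.
move=> i j /pow[a lta Ea] /pow[b ltb Eb].
(* A nonnegative representative of [b - a] modulo the period [n - 1]. *)
exists (b + (n.-1 - a))%N; apply: phi_inj.
rewrite iter Ea Eb -exprM -expnD addnC -addnA subnK ?(ltnW lta) //.
by rewrite addnC expnD exprM xp.
Qed.

Lemma fixed_point_free_perm : uniq (rts g) -> fixed_point_free_type p f ->
  exists h : Aut, acts_trivially (@rho n) s h /\ forall i, rho g h i != i.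
Proof.
move=> u ff; have [h [th Dh]] := exists_Frobenius_perm u; exists h; split=> // i.
have : phi (rt g i) ^+ p != phi (rt g i).
  apply: ff; rewrite residue_char_poly root_prod_XsubC; apply: map_f.
  by apply/mem_rtsP; exists i.
by rewrite -Dh; apply: contraNneq => ->.
Qed.

Lemma transposition_perm : transposition_type p f ->
  exists h : Aut, acts_trivially (@rho n) s h /\ exists i j, i != j /\ rho g h = tperm i j.
Proof.
move=> [y [a [Df yp ap ur]]].
have [|u inj mem] := residue_roots _ ur; first by rewrite Df !big_cons mulrA.
have [h [th Dh]] := exists_Frobenius_perm u; exists h; split=> //.
have rti i : rt g i \in rts g by apply/mem_rtsP; exists i.
have phi_inj i j : phi (rt g i) = phi (rt g j) -> i = j.
  by move=> /inj E; apply: (rt_inj u); apply: E.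
have [i Di] : exists i, y = phi (rt g i) by apply/mem; rewrite mem_head.
have [j Dj] : exists j, y ^+ p = phi (rt g j) by apply/mem; rewrite !inE eqxx orbT.
exists i, j; split.
  by move: ur; rewrite /= inE negb_or => /andP[/andP[+ _] _]; rewrite Dj Di; apply: contra_neq => ->.
apply/permP => l; apply: (phi_inj _ _); rewrite Dh permE /=.
have [->|li] := eqVneq l i; first by rewrite -Dj -Di.
have [->|lj] := eqVneq l j; first by rewrite -Dj -Di -exprM mulnn.
have : phi (rt g l) \in y :: y ^+ p :: a by apply/mem; exists l.
rewrite !inE => /or3P[/eqP E|/eqP E|/ap //].
  by case/eqP: li; apply: phi_inj; rewrite E.
by case/eqP: lj; apply: phi_inj; rewrite E.
Qed.
End AtPrime.

Lemma full_over_of_types (s : seq 'M[int]_n) (g : 'M[int]_n)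
    p1 (k1 : fieldType) (phi1 : {rmorphism aint -> k1})
    p2 (k2 : fieldType) (phi2 : {rmorphism aint -> k2})
    p3 (k3 : fieldType) (phi3 : {rmorphism aint -> k3}) :
  splits_at s p1 phi1 -> splits_at s p2 phi2 -> splits_at s p3 phi3 ->
  long_cycle_type p1 (map_poly intr (char_poly g) : {poly k1}) ->
  fixed_point_free_type p2 (map_poly intr (char_poly g) : {poly k2}) ->
  transposition_type p3 (map_poly intr (char_poly g) : {poly k3}) ->
  uniq (rts g) /\ full_over (@rho n) s g.
Proof.
move=> sp1 sp2 sp3 E1 E2 E3.
have [u [h1 [t1 [i0 [fix1 cyc1]]]]] := long_cycle_perm sp1 E1.
have [h2 [t2 mov2]] := fixed_point_free_perm sp2 u E2.
have [h3 [t3 [i [j [ij Eij]]]]] := transposition_perm sp3 E3.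
split=> // a.
have [W DW] := image_group (@rhoM n) (@rho1 n) g
  (acts_trivially_subgroup (@rhoM n) (@rho1 n) (@rhoV n) s).
apply/DW; have -> : W :=: [set: {perm 'I_n}]; last by rewrite inE.
apply: (@full_perm_group _ W i0 i j (rho g h1) (rho g h2)) => //.
- by apply/DW; exists h1.
- by apply/DW; exists h2.
by apply/DW; exists h3.
Qed.
End FrobeniusTypes.

(** * Characteristic polynomials over prime fields *)

Section ConjugacyClassCount.
Variable F : finFieldType.
Local Notation q := #|F|.

Definition SLset n : {set 'M[F]_n} := [set A | \det A == 1].

(** A matrix of determinant 1 with its first row scaled by [x] is invertible, and its determinant
    recovers [x]. *)
Lemma card_unitmx_ge_SL n : (0 < n)%N ->
  (q.-1 * #|SLset n| <= #|[set B : 'M[F]_n | B \in unitmx]|)%N.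
Proof.
case: n => // n _.
pose D (x : F) : 'M[F]_n.+1 := diag_mx (\row_i (if i == 0 then x else 1)).
have detD x : \det (D x) = x.
  rewrite det_diag big_ord_recl /= mxE eqxx big1 ?mulr1 // => i _.
  by rewrite mxE.
pose h (xA : F * 'M[F]_n.+1) := D xA.1 *m xA.2.
have -> : q.-1 = #|[set x : F | x != 0]|.
  have <- : [set~ 0] = [set x : F | x != 0] by apply/setP => x; rewrite !inE.
  by rewrite cardsC1.
rewrite -cardsX -(card_in_imset (f := h)).
  apply: subset_leq_card; apply/subsetP => _ /imsetP[[x A] + ->]; rewrite !inE /= => /andP[nzx /eqP dA].
  by rewrite unitmxE det_mulmx detD dA mulr1 unitfE.
move=> [x A] [y B]; rewrite !inE /= => /andP[nzx /eqP dA] /andP[_ /eqP dB] E.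
have xy : x = y by have := congr1 determinant E; rewrite /h !det_mulmx !detD dA dB !mulr1.
congr (_, _) => //; move: E; rewrite /h /= -xy => /(congr1 (mulmx (invmx (D x)))).
by rewrite !mulKmx // unitmxE detD unitfE.
Qed.

Lemma char_poly_conj n (B A : 'M[F]_n) : B \in unitmx ->
  char_poly (invmx B *m A *m B) = char_poly A.
Proof.
move=> uB; pose Bp := map_mx polyC B; pose Vp := map_mx polyC (invmx B).
have VB : Vp *m Bp = 1%:M by rewrite -map_mxM mulVmx // map_mx1.
rewrite /char_poly; have -> : char_poly_mx (invmx B *m A *m B) = Vp *m char_poly_mx A *m Bp.
  rewrite /char_poly_mx mulmxBr mulmxBl !map_mxM; congr (_ - _).
  by rewrite scalar_mxC -mulmxA VB mulmx1.
by rewrite !det_mulmx mulrAC -det_mulmx VB det1 mul1r.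
Qed.

(* [B A = C B] with [C] a companion matrix expresses every row of [B] through its first row. *)
Lemma card_char_poly_fiber n (f : {poly F}) : f \is monic -> size f = n.+1 -> (0 < n)%N ->
  (#|[set B : 'M[F]_n | B \in unitmx]| <= #|[set A : 'M[F]_n | char_poly A == f]| * q ^ n)%N.
Proof.
move=> mf szf n0; have {szf} Dn : n = (size f).-1 by rewrite szf.
subst n; set n := (size f).-1 in n0 *; pose C : 'M[F]_n := companionmx f.
pose h (B : 'M[F]_n) := (invmx B *m C *m B, row (Ordinal n0) B).
have -> : (q ^ n)%N = #|[set: 'rV[F]_n]| by rewrite cardsT card_mx mul1n.
rewrite -cardsX -(card_in_imset (f := h)).
  apply: subset_leq_card; apply/subsetP => _ /imsetP[B + ->]; rewrite inE => uB.
  by rewrite !inE andbT char_poly_conj // companionmxK.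
move=> B B'; rewrite !inE => uB uB' [E E0].
have rowS (X : 'M[F]_n) (i j : 'I_n) : j = i.+1 :> nat -> row j X = row i (C *m X).
  move=> ij; have lt : (i.+1 < n)%N by rewrite -ij.
  rewrite row_mul !rowE; congr (_ *m X).
  by rewrite mulmx_delta_companion; congr delta_mx; apply: val_inj.
apply/row_matrixP => i; case: i => i lti; elim: i lti => [|i IH] lti.
  by have -> : Ordinal lti = Ordinal n0 by apply: val_inj.
have lti' := ltnW lti.
rewrite (rowS B (Ordinal lti') (Ordinal lti)) // (rowS B' (Ordinal lti') (Ordinal lti)) //.
have Dm (X : 'M[F]_n) : X \in unitmx -> C *m X = X *m (invmx X *m C *m X).
  by move=> uX; rewrite !mulmxA mulmxV // mul1mx.
by rewrite (Dm B) // (Dm B') // E !row_mul IH.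
Qed.

(** Fibres over distinct polynomials are disjoint, and [card_unitmx_ge_SL] with
    [card_char_poly_fiber] bounds each from below. The constant coefficient places them inside
    [SL]. *)
Lemma card_SL_char_poly n (L : seq {poly F}) (E : pred 'M[F]_n) : (0 < n)%N -> uniq L ->
  {in L, forall f : {poly F}, [/\ f \is monic, size f = n.+1 & f`_0 = (-1) ^+ n]} ->
  (forall A, \det A = 1 -> char_poly A \in L -> E A) ->
  (size L * (q.-1 * #|SLset n|) <= #|[set A in SLset n | E A]| * q ^ n)%N.
Proof.
move=> n0 uL LP LE.
apply: leq_trans (_ : (\sum_(f <- L) #|[set A : 'M[F]_n | char_poly A == f]|) * q ^ n <= _)%N.
  rewrite big_distrl /= -sum1_size big_distrl /= !big_seq; apply: leq_sum => f Lf.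
  have [mf szf _] := LP f Lf; rewrite mul1n.
  exact: leq_trans (card_unitmx_ge_SL n0) (card_char_poly_fiber mf szf n0).
rewrite leq_mul2r; apply/orP; right.
have -> : (\sum_(f <- L) #|[set A : 'M[F]_n | char_poly A == f]|
    = #|[set A : 'M[F]_n | char_poly A \in L]|)%N.
  elim: L uL {LP LE} => [|f L IH] /=; first by move=> _; rewrite big_nil (_ : [set A | _] = set0) ?cards0 //; apply/setP => A; rewrite !inE.
  move=> /andP[nf uL]; rewrite big_cons IH // -cardsUI.
  have -> : [set A : 'M[F]_n | char_poly A == f] :&: [set A : 'M[F]_n | char_poly A \in L] = set0.
    by apply/setP => A; rewrite !inE; apply/negP => /andP[/eqP->]; apply/negP.
  by rewrite cards0 addn0; apply: eq_card => A; rewrite !inE.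
apply: subset_leq_card; apply/subsetP => A; rewrite !inE => LA.
have dA : \det A = 1.
  have [_ _] := LP _ LA; rewrite char_poly_det => E1.
  by apply: (mulfI (_ : (-1) ^+ n != 0)); rewrite ?mulr1 // signr_eq0.
by rewrite dA eqxx LE.
Qed.
End ConjugacyClassCount.

(** * The prime field inside a residue field *)

Section PrimeFieldEmbedding.
Variables (p : nat) (k : fieldType).
Hypothesis chp : p \in [pchar k].

Definition Fp_embed of p \in [pchar k] : 'F_p -> k := fun x => (x : nat)%:R.
Local Notation iota_p := (Fp_embed chp).

Let pr_p : prime p. Proof. by case/andP: chp. Qed.

Lemma natr_modp (m : nat) : (m %% p)%:R = m%:R :> k.
Proof. by rewrite [in RHS](divn_eq m p) natrD natrM (pcharf0 chp) mulr0 add0r. Qed.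

Lemma natr_Fp_trunc (m : nat) : (m %% (Zp_trunc (pdiv p)).+2)%:R = m%:R :> k.
Proof. by rewrite Fp_cast // natr_modp. Qed.

Fact Fp_embed_nmod : nmod_morphism iota_p.
Proof. by split=> // x y; rewrite /Fp_embed /= natr_Fp_trunc natrD. Qed.

Fact Fp_embed_monoid : monoid_morphism iota_p.
Proof. by split=> [|x y]; rewrite /Fp_embed /= natr_Fp_trunc ?natrM. Qed.

HB.instance Definition _ := GRing.isNmodMorphism.Build 'F_p k iota_p Fp_embed_nmod.
HB.instance Definition _ := GRing.isMonoidMorphism.Build 'F_p k iota_p Fp_embed_monoid.

Lemma Frobenius_fixedP (z : k) : reflect (exists x, z = iota_p x) (z ^+ p == z).
Proof.
apply: (iffP eqP) => [fz|[x ->]]; last first.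
  by rewrite -(pFrobenius_autE chp) /Fp_embed pFrobenius_aut_nat.
pose P : {poly k} := 'X^p - 'X.
have szP : size P = p.+1.
  by rewrite size_polyDl ?size_polyXn // size_polyN size_polyX ltnS prime_gt1.
have nzP : P != 0 by rewrite -size_poly_eq0 szP.
have rootP x : root P x = (x ^+ p == x) by rewrite /root !hornerE subr_eq0.
apply: Classical_Prop.NNPP => nz.
have := max_poly_roots (rs := z :: map iota_p (enum 'F_p)) nzP.
rewrite /= size_map -cardE card_Fp // szP ltnn => W.
suff : false by []; apply: W.
  rewrite rootP fz eqxx; apply/allP => _ /mapP[x _ ->].
  by rewrite rootP -(pFrobenius_autE chp) /Fp_embed pFrobenius_aut_nat.
rewrite map_inj_uniq ?enum_uniq ?andbT; last exact: fmorph_inj.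
by apply/negP => /mapP[x _ E]; apply: nz; exists x.
Qed.

Lemma Frobenius_fixed_poly (f : {poly k}) : map_poly (pFrobenius_aut chp) f = f ->
  exists f0 : {poly 'F_p}, map_poly iota_p f0 = f.
Proof.
move=> ff.
have co i : exists x : 'F_p, f`_i == iota_p x.
  have /Frobenius_fixedP[x ->] : f`_i ^+ p == f`_i; last by exists x.
  by rewrite -(pFrobenius_autE chp) -{2}ff coef_map.
exists (\poly_(i < size f) xchoose (co i)); apply/polyP => i.
rewrite coef_map coef_poly /=; case: ltnP => [_|le]; first exact/esym/eqP/(xchooseP (co i)).
by rewrite /Fp_embed mulr0n nth_default.
Qed.
End PrimeFieldEmbedding.

Lemma coef0_prod_XsubC (k : fieldType) (r : seq k) :
  (\prod_(z <- r) ('X - z%:P))`_0 = (-1) ^+ size r * \prod_(z <- r) z.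
Proof.
elim: r => [|z r IH]; first by rewrite !big_nil mul1r coef1.
by rewrite !big_cons coef0M IH !coefE exprS /=; ring.
Qed.

(** A polynomial of degree at most [m] has at most [m] roots [y t], so it comes from at most [m]
    parameters. *)
Lemma card_fibers_le (T : eqType) (k : fieldType) (m : nat) (ts : seq T)
    (f : T -> {poly k}) (y : T -> k) :
  uniq ts -> {in ts &, injective (fun t => (f t, y t))} ->
  {in ts, forall t, [/\ root (f t) (y t), f t != 0 & (size (f t) <= m.+1)%N]} ->
  (size ts <= m * size (undup (map f ts)))%N.
Proof.
move=> uts inj P.
pose R g := undup [seq y t | t <- ts & f t == g].
rewrite -(size_map (fun t => (f t, y t))).
apply: (@leq_trans (size [seq (g, z) | g <- undup (map f ts), z <- R g])).
  apply: uniq_leq_size; first by rewrite map_inj_in_uniq.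
  move=> _ /mapP[t tt ->]; apply/allpairsPdep; exists (f t), (y t); split=> //.
    by rewrite mem_undup map_f.
  by rewrite mem_undup; apply/mapP; exists t => //; rewrite mem_filter eqxx.
rewrite size_allpairs_dep sumnE big_map.
apply: (@leq_trans (\sum_(g <- undup (map f ts)) m)%N); last first.
  by rewrite big_const_seq count_predT iter_addn_0.
rewrite !big_seq; apply: leq_sum => g; rewrite mem_undup => /mapP[t tt Dg].
have [_ nz sz] := P t tt; rewrite -ltnS; apply: leq_trans (_ : size g <= _)%N; last by rewrite Dg.
apply: max_poly_roots; rewrite ?Dg ?undup_uniq //.
apply/allP => z; rewrite mem_undup => /mapP[t' ]; rewrite mem_filter => /andP[/eqP Dg' tt'] ->.
by rewrite -Dg'; case: (P t' tt').
Qed.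

(** * Counting polynomials of each factorisation type *)

Section PolynomialCount.
Variables (p : nat) (k : fieldType) (phi : {rmorphism aint -> k}).
Hypothesis chp : p \in [pchar k].
Local Notation Frob := (pFrobenius_aut chp).
Local Notation iota_p := (Fp_embed chp).

Let pr_p : prime p. Proof. by case/andP: chp. Qed.

Lemma exp_p_inj : injective (fun x : k => x ^+ p).
Proof. by move=> x y; rewrite -!(pFrobenius_autE chp) => /fmorph_inj. Qed.

Lemma exp_pX_inj i : injective (fun x : k => x ^+ (p ^ i)).
Proof.
elim: i => [|i IH] x y; first by rewrite !expn0 !expr1.
by rewrite !expnSr !exprM => /exp_p_inj/IH.
Qed.

(** [k] is not assumed algebraically closed; the roots come from [aint] through [phi]. *)
Lemma int_poly_splits (q : {poly int}) : q \is monic ->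
  exists r : seq k, map_poly intr q = \prod_(z <- r) ('X - z%:P).
Proof.
move=> mq; have [r Dr] := monic_int_poly_aint_roots mq.
by exists (map phi r); rewrite (map_int_poly_residue phi Dr) big_map.
Qed.

Lemma Xn_sub_splits N (c : int) : (0 < N)%N ->
  exists2 r : seq k, 'X^N - (c%:~R)%:P = \prod_(z <- r) ('X - z%:P) & size r = N.
Proof.
move=> N0; have [|r Dr] := @int_poly_splits ('X^N - c%:P); first exact: monicXnsubC.
have E : 'X^N - (c%:~R)%:P = \prod_(z <- r) ('X - z%:P) :> {poly k}.
  by rewrite -Dr rmorphB /= map_polyXn map_polyC.
exists r => //; have := congr1 (fun f : {poly k} => size f) E.
by rewrite size_XnsubC // size_prod_XsubC => -[].
Qed.

(** One solution comes from an integer lift of [c]; the others are its multiples by the [N]-th roots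
    of unity, distinct because [X^N - 1] is separable. *)
Lemma power_solutions N (c : 'F_p) : ~~ (p %| N)%N -> c != 0 ->
  exists r : seq k, [/\ uniq r, size r = N & forall x, (x \in r) = (x ^+ N == iota_p c)].
Proof.
move=> ndN nzc.
have N0 : (0 < N)%N by case: N ndN => //; rewrite dvdn0.
have nzN : N%:R != 0 :> k by rewrite -(dvdn_pcharf chp).
have nzic : iota_p c != 0 by rewrite fmorph_eq0.
have [y0 Dy0] : exists y0, y0 ^+ N = iota_p c.
  have [r Dr szr] := @Xn_sub_splits N (c : nat)%:Z N0.
  case: r Dr szr => [|y r Dr _]; first by move=> _ N0'; rewrite -N0' in N0.
  exists y; apply/eqP; rewrite -subr_eq0; have : root ('X^N - ((c : nat)%:Z%:~R)%:P) y.
    by rewrite Dr root_prod_XsubC mem_head.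
  by rewrite /root !hornerE.
have nzy0 : y0 != 0 by apply: contraNneq nzic => y00; rewrite -Dy0 y00 expr0n gtn_eqF.
have [r Dr szr] := @Xn_sub_splits N 1 N0.
have ur : uniq r by rewrite -separable_prod_XsubC -Dr cyclotomic.separable_Xn_sub_1.
exists [seq y0 * z | z <- r]; split; rewrite ?size_map ?map_inj_uniq //; first exact: mulfI.
move=> x; have -> : x = y0 * (x / y0) by rewrite mulrC divfK.
rewrite mem_map; last exact: mulfI.
move: (x / y0) => w; rewrite -root_prod_XsubC -Dr /root !hornerE exprMn Dy0 subr_eq0.
by rewrite -[X in _ = (_ == X)]mulr1 (inj_eq (mulfI nzic)).
Qed.

Definition orbit_poly m (x : k) : {poly k} := \prod_(j < m) ('X - (x ^+ (p ^ j))%:P).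

Lemma orbit_polyE m x :
  orbit_poly m x = \prod_(z <- [seq x ^+ (p ^ j) | j <- iota 0 m]) ('X - z%:P).
Proof. by rewrite big_map -{2}[m]subn0 big_mkord. Qed.

Lemma Frobenius_orbit_poly m x : x ^+ (p ^ m) = x -> map_poly Frob (orbit_poly m x) = orbit_poly m x.
Proof.
case: m => [_|m xm]; first by rewrite /orbit_poly !big_ord0 rmorph1.
have E : map_poly Frob (orbit_poly m.+1 x) = \prod_(j < m.+1) ('X - (x ^+ (p ^ j.+1))%:P).
  rewrite rmorph_prod; apply: eq_bigr => j _.
  by rewrite /= map_polyXsubC -[LHS]/('X - ((x ^+ (p ^ j)) ^+ p)%:P) -exprM -expnSr.
by rewrite E /orbit_poly big_ord_recr /= xm [RHS]big_ord_recl /= expr1 mulrC.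
Qed.

Lemma root_orbit_poly m x : (0 < m)%N -> root (orbit_poly m x) x.
Proof.
by case: m => // m _; rewrite orbit_polyE root_prod_XsubC mem_head.
Qed.

Lemma prod_orbit m (x : k) :
  \prod_(z <- [seq x ^+ (p ^ j) | j <- iota 0 m]) z = x ^+ (\sum_(j < m) p ^ j)%N.
Proof.
rewrite big_map -(big_mkord xpredT (fun j => p ^ j)%N) /index_iota subn0.
elim: (iota 0 m) => [|j s IH]; first by rewrite !big_nil.
by rewrite !big_cons IH exprD.
Qed.

(** Such [x] lie in the union of the root sets of [X^(p^d) - X] for [1 <= d <= m]. *)
Lemma size_small_orbits (r : seq k) m : uniq r ->
  (forall x, x \in r -> exists d, (0 < d <= m)%N /\ x ^+ (p ^ d) = x) ->
  (size r <= \sum_(d < m) p ^ d.+1)%N.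
Proof.
elim: m r => [|m IH] r ur P.
  case: r ur P => // x r _ /(_ x (mem_head _ _))[d [+ _]].
  by rewrite leqn0; case: d.
rewrite big_ord_recr /= -(count_predC (fun x => x ^+ (p ^ m.+1) == x)) addnC -!size_filter.
apply: leq_add.
  apply: IH; first exact: filter_uniq.
  move=> x; rewrite mem_filter /= => /andP[nx /P[d [/andP[d0 led] E]]]; exists d; split=> //.
  rewrite d0 /=; rewrite leq_eqVlt ltnS in led; case/predU1P: led => [Ed|//].
  by rewrite -Ed E eqxx in nx.
pose Q : {poly k} := 'X^(p ^ m.+1) - 'X.
have szQ : size Q = (p ^ m.+1).+1.
  rewrite size_polyDl ?size_polyXn // size_polyN size_polyX ltnS.
  by rewrite expnS (leq_trans (prime_gt1 pr_p)) // leq_pmulr // expn_gt0 prime_gt0.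
rewrite -ltnS -szQ; apply: max_poly_roots; rewrite -?size_poly_eq0 ?szQ ?filter_uniq //.
by apply/allP => x; rewrite mem_filter /root !hornerE subr_eq0 => /andP[].
Qed.

Lemma geometric_sum m : (p.-1 * \sum_(j < m) p ^ j = (p ^ m).-1)%N.
Proof.
elim: m => [|m IH]; first by rewrite big_ord0 muln0 expn0.
rewrite big_ord_recr /= mulnDr IH expnS; have := prime_gt1 pr_p.
have : (0 < p ^ m)%N by rewrite expn_gt0 prime_gt0.
by case: p (p ^ m)%N => [|q] [|r] //= _ _; rewrite mulSn mulnS; lia.
Qed.

(** The conditions for [f] to come from [SL_n(F_p)]: coefficients fixed by Frobenius lie in [F_p],
    and the constant one encodes determinant 1. *)
Definition realizable n (f : {poly k}) : Prop :=
  [/\ f \is monic, size f = n.+1, f`_0 = (-1) ^+ n & map_poly Frob f = f].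

End PolynomialCount.

Section TypeCount.
Variables (p : nat) (k : fieldType) (phi : {rmorphism aint -> k}).
Hypothesis chp : p \in [pchar k].
Variable n : nat.
Hypothesis n_ge5 : (5 <= n)%N.
Hypothesis le_2n_p : (2 * n <= p)%N.
Local Notation Frob := (pFrobenius_aut chp).
Local Notation iota_p := (Fp_embed chp).

Let pr_p : prime p. Proof. by case/andP: chp. Qed.
Let p_gt1 : (1 < p)%N. Proof. exact: prime_gt1. Qed.

Lemma realizable_prod (r : seq k) : size r = n -> \prod_(z <- r) z = 1 ->
  map_poly Frob (\prod_(z <- r) ('X - z%:P)) = \prod_(z <- r) ('X - z%:P) ->
  realizable chp n (\prod_(z <- r) ('X - z%:P)).
Proof.
move=> szr r1 Fr; split; rewrite ?monic_prod_XsubC ?size_prod_XsubC ?szr //.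
by rewrite coef0_prod_XsubC r1 mulr1 szr.
Qed.

Lemma size_filterC (T : Type) (a : pred T) (s : seq T) :
  (size (filter a s) = size s - size (filter (predC a) s))%N.
Proof. by rewrite !size_filter -(count_predC a s) addnK. Qed.

Lemma sum_expn_recr m : (0 < m)%N ->
  (\sum_(j < m) p ^ j = \sum_(j < m.-1) p ^ j + p ^ m.-1)%N.
Proof. by case: m => // m _; rewrite big_ord_recr. Qed.

Lemma sum_expn_recl m : (0 < m)%N ->
  (\sum_(j < m) p ^ j = 1 + \sum_(j < m.-1) p ^ j.+1)%N.
Proof. by case: m => // m _; rewrite big_ord_recl. Qed.

(** The [x] are elements of norm 1 from [F_(p^n)] to [F_p], that is [x ^ N = 1], outside [F_p]. The
    orbit of [x] may be shorter than [n]; its polynomial is then a power of a smaller one, still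
    without root in [F_p]. *)
Lemma fixed_point_free_count : exists fs : seq {poly k},
  [/\ uniq fs, {in fs, forall f, realizable chp n f /\ fixed_point_free_type p f}
    & (p ^ n.-1 <= n * size fs)%N].
Proof.
have n0 : (0 < n)%N by apply: leq_trans n_ge5.
pose N := (\sum_(j < n) p ^ j)%N.
have ND : N = (p ^ n.-1 + \sum_(j < n.-1) p ^ j)%N.
  by rewrite /N sum_expn_recr // addnC.
have ndN : ~~ (p %| N)%N.
  rewrite /N sum_expn_recl // dvdn_addl ?dvdn1 ?gtn_eqF //.
  by apply: dvdn_sum => i _; rewrite /= expnS dvdn_mulr.
have [r [ur szr rP]] := power_solutions phi chp ndN (oner_neq0 'F_p).
pose ts := [seq x <- r | x ^+ p != x].
have xN x : x \in ts -> x ^+ N = 1.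
  by rewrite mem_filter rP rmorph1 => /andP[_ /eqP].
have xpn x : x \in ts -> x ^+ (p ^ n) = x.
  move=> /xN x1; have -> : (p ^ n = (p.-1 * N).+1)%N.
    by rewrite (geometric_sum chp) prednK // expn_gt0 ltnW.
  by rewrite exprS mulnC exprM x1 expr1n mulr1.
exists (undup (map (orbit_poly p n) ts)); split; first exact: undup_uniq.
  move=> f; rewrite mem_undup => /mapP[x tx ->]; split.
    rewrite orbit_polyE; apply: realizable_prod.
    - by rewrite size_map size_iota.
    - by rewrite prod_orbit xN.
    by rewrite -orbit_polyE Frobenius_orbit_poly ?xpn.
  move=> z; rewrite orbit_polyE root_prod_XsubC => /mapP[j _ ->].
  rewrite -exprM mulnC exprM (inj_eq (@exp_pX_inj _ _ chp j)).
  by move: tx; rewrite mem_filter => /andP[].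
apply: leq_trans (card_fibers_le (y := id) (m := n) (filter_uniq _ ur) _ _).
- have -> : (size ts = N - size [seq x <- r | predC (fun x => x ^+ p != x) x])%N.
    by rewrite /ts size_filterC szr.
  have le1 : (size [seq x <- r | predC (fun x : k => x ^+ p != x) x] <= \sum_(d < 1) p ^ d.+1)%N.
    apply: (size_small_orbits chp (filter_uniq _ ur)) => x.
    by rewrite mem_filter /= negbK => /andP[/eqP E _]; exists 1%N; rewrite expn1.
  rewrite big_ord1 expn1 in le1; apply: leq_trans (leq_sub2l _ le1).
  rewrite ND -addnBA ?leq_addr //.
  have lt1 : (1 < n.-1)%N by case: n n_ge5 => [|[|[|m]]].
  by rewrite (bigD1 (Ordinal lt1)) //= expn1 leq_addr.
- by move=> x y _ _ [].
move=> x tx; split; first by apply: root_orbit_poly.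
  by rewrite orbit_polyE monic_neq0 ?monic_prod_XsubC.
by rewrite orbit_polyE size_prod_XsubC size_map size_iota.
Qed.

(** [x] generates [F_(p^(n-1))], and [c x] is the inverse of its norm, so that all the roots
    multiply to 1. *)
Lemma long_cycle_count : exists fs : seq {poly k},
  [/\ uniq fs, {in fs, forall f, realizable chp n f /\ long_cycle_type n p f}
    & (p ^ n.-1 <= 2 * n * size fs)%N].
Proof.
have n0 : (0 < n)%N by apply: leq_trans n_ge5.
pose M := n.-1; have M_gt1 : (1 < M)%N by rewrite /M; case: n n_ge5 => [|[|[|m]]].
have pM0 : (0 < p ^ M)%N by rewrite expn_gt0 ltnW.
pose N := (p ^ M).-1.
have ndN : ~~ (p %| N)%N.
  apply/negP => dN; have : (p %| N.+1)%N by rewrite prednK // dvdn_exp // ltnW.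
  by rewrite -addn1 dvdn_addr // dvdn1 gtn_eqF.
have [r [ur szr rP]] := power_solutions phi chp ndN (oner_neq0 'F_p).
pose small (x : k) := has (fun d => x ^+ (p ^ d) == x) (iota 1 M.-1).
pose ts := [seq x <- r | ~~ small x].
have xN x : x \in ts -> x ^+ N = 1.
  by rewrite mem_filter rP rmorph1 => /andP[_ /eqP].
have nzx x : x \in ts -> x != 0.
  move=> /xN; apply: contra_eq_neq => ->; rewrite expr0n gtn_eqF 1?eq_sym ?oner_neq0 //.
  by rewrite /N -ltnS prednK // -{1}(expn0 p) ltn_exp2l // ltnW.
have xpM x : x \in ts -> x ^+ (p ^ M) = x.
  by move=> /xN x1; rewrite -(prednK pM0) exprS x1 mulr1.
have per x d : x \in ts -> (0 < d < M)%N -> x ^+ (p ^ d) != x.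
  rewrite mem_filter => /andP[/hasPn h _] /andP[d0 dM]; apply: h.
  by rewrite mem_iota d0 addnC addn1 prednK // ltnW.
pose S := (\sum_(j < M) p ^ j)%N.
pose c (x : k) : k := (x ^+ S)^-1.
pose f (x : k) : {poly k} := ('X - (c x)%:P) * orbit_poly p M x.
have fE x : f x = \prod_(z <- c x :: [seq x ^+ (p ^ j) | j <- iota 0 M]) ('X - z%:P).
  by rewrite big_cons -orbit_polyE.
have cp x : x \in ts -> c x ^+ p = c x.
  move=> tx; rewrite /c exprVn -exprM; congr (_^-1).
  rewrite {1}/S (sum_expn_recr (ltnW M_gt1)) mulnDl -expnSr prednK ?(ltnW M_gt1) //.
  rewrite /S (sum_expn_recl (ltnW M_gt1)) !exprD xpM // expr1 mulrC; congr (_ * x ^+ _).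
  by rewrite big_distrl /=; apply: eq_bigr => j _; rewrite -expnSr.
exists (undup (map f ts)); split; first exact: undup_uniq.
  move=> g; rewrite mem_undup => /mapP[x tx ->]; split.
    rewrite fE; apply: realizable_prod.
    - by rewrite /= size_map size_iota prednK.
    - by rewrite big_cons prod_orbit // mulVf // expf_neq0 ?nzx.
    rewrite -fE /f rmorphM /= Frobenius_orbit_poly ?xpM // map_polyXsubC.
    by congr (('X - _%:P) * _); apply: cp.
  exists (c x), x; split; rewrite ?cp ?xpM //= .
  have ninj i j : (i < j < M)%N -> x ^+ (p ^ i) != x ^+ (p ^ j).
    move=> /andP[ij jM]; rewrite -(subnK (ltnW ij)) expnD exprM eq_sym.
    by rewrite (inj_eq (@exp_pX_inj _ _ chp i)) per // subn_gt0 ij (leq_ltn_trans (leq_subr _ _)).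
  apply/andP; split.
    apply/negP => /mapP[j]; rewrite mem_iota add0n => /andP[_ jM] E.
    have := cp x tx; rewrite E -exprM mulnC exprM => /(@exp_pX_inj _ _ chp j) E1.
    by have := per x 1%N tx; rewrite expn1 E1 eqxx M_gt1 => /(_ isT).
  rewrite map_inj_in_uniq ?iota_uniq // => i j; rewrite !mem_iota !add0n /= => iM jM E.
  by case: (ltngtP i j) => // lt; [have := ninj i j | have := ninj j i]; rewrite lt ?iM ?jM E eqxx => /(_ isT).
have le1 : (2 * size ts >= p ^ n.-1)%N.
  have -> : (size ts = N - size [seq x <- r | predC (fun x => ~~ small x) x])%N.
    by rewrite /ts size_filterC szr.
  have le1 : (size [seq x <- r | predC (fun x => ~~ small x) x] <= \sum_(d < M.-1) p ^ d.+1)%N.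
    apply: (size_small_orbits chp (filter_uniq _ ur)) => x.
    rewrite mem_filter /= negbK => /andP[/hasP[d]]; rewrite mem_iota => /andP[d0 dM] /eqP E _.
    by exists d; split=> //; rewrite d0 -ltnS -[in X in (_ < X)%N]add1n.
  have SD : S = (1 + \sum_(d < M.-1) p ^ d.+1)%N.
    exact: sum_expn_recl (ltnW M_gt1).
  (* [p >= 3], so [N = (p - 1) * S >= 2 * S], while fewer than [S] solutions are small: at least
     half of [p ^ M] remain. *)
  have := geometric_sum chp M; rewrite -/S -/N => gs.
  have : (2 * S <= p.-1 * S)%N by rewrite leq_mul2r; apply/orP; right; lia.
  rewrite gs -/M => leS; have NE : (p ^ M = N.+1)%N by rewrite prednK.
  rewrite NE; move: SD le1 leS; set X := (\sum_(d < M.-1) _)%N; set Y := size _.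
  by clear; lia.
apply: leq_trans le1 _; rewrite -mulnA leq_mul2l /=.
apply: (card_fibers_le (y := id) (m := n) (filter_uniq _ ur)).
- by move=> x y _ _ [].
move=> x tx; split; first by rewrite /f rootM root_orbit_poly ?orbT // ltnW.
  by rewrite fE monic_neq0 ?monic_prod_XsubC.
by rewrite fE size_prod_XsubC /= size_map size_iota prednK.
Qed.

Lemma ffact_ge_exp (m l : nat) : ((m.+1 - l) ^ l <= m ^_ l)%N.
Proof.
elim: l => [|l IH]; first by rewrite expn0 ffactn0.
rewrite ffactnSr expnSr subSS leq_mul // (leq_trans _ IH) //.
by case: l {IH} => [|l]; rewrite ?expn0 // leq_exp2r // leq_sub2r.
Qed.

(** A norm equation from [F_(p^2)] to [F_p]: of its [p + 1] solutions, those in [F_p] satisfy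
    [y ^ 2 = v] and number at most two. *)
Lemma transposition_solutions (A : {set 'F_p}) : 0 \notin A ->
  exists r : seq k, [/\ uniq r, (p.-1 <= size r)%N
    & forall y, y \in r -> [/\ y ^+ p.+1 = iota_p (\prod_(a in A) a)^-1, y ^+ p != y & y ^+ (p ^ 2) = y]].
Proof.
move=> nA; pose v : 'F_p := (\prod_(a in A) a)^-1.
have nzv : v != 0.
  by rewrite invr_eq0; apply/prodf_neq0 => a aA; apply: contraNneq nA => <-.
have ndp : ~~ (p %| p.+1)%N by rewrite -addn1 dvdn_addr // dvdn1 gtn_eqF.
have [r [ur szr rP]] := power_solutions phi chp ndp nzv.
exists [seq y <- r | y ^+ p != y]; split; rewrite ?filter_uniq //; last first.
  move=> y; rewrite mem_filter rP => /andP[yp /eqP E]; split=> //.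
  have nzy : y != 0.
    by apply: contraNneq nzv => y0; move/eqP: E; rewrite y0 expr0n /= eq_sym fmorph_eq0.
  have : (y ^+ p.+1) ^+ p == y ^+ p.+1 by apply/Frobenius_fixedP; rewrite E; exists v.
  rewrite -exprM mulSn mulnn exprD exprS mulrC => /eqP E2.
  by apply: (mulIf (_ : y ^+ p != 0)); rewrite ?expf_neq0.
rewrite size_filterC szr.
have : (size [seq y <- r | predC (fun y : k => y ^+ p != y) y] <= 2)%N.
  pose Q : {poly k} := 'X^2 - (iota_p v)%:P.
  have szQ : size Q = 3%N by rewrite size_XnsubC.
  rewrite -ltnS -szQ; apply: max_poly_roots; rewrite -?size_poly_eq0 ?szQ ?filter_uniq //.
  apply/allP => y; rewrite mem_filter rP /= negbK => /andP[/eqP yp /eqP E].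
  by rewrite /root !hornerE -E [y ^+ p.+1]exprS yp -expr2 subrr.
move=> le2; apply: leq_trans (leq_sub2l _ le2).
by rewrite subSS subn1.
Qed.

(** The conjugate roots [y] and [y ^ p] have as norm the inverse of the product over a set [A] of
    [n - 2] nonzero elements of [F_p]. The polynomial determines [A] as the set of its roots in
    [F_p], so at most [n] pairs [(y, A)] share it. *)
Lemma transposition_count : exists fs : seq {poly k},
  [/\ uniq fs, {in fs, forall f, realizable chp n f /\ transposition_type p f}
    & (p ^ n.-1 <= (n.-2)`! * 2 ^ n.-1 * n * size fs)%N].
Proof.
pose l := n.-2.
have Dn : n = l.+2 by rewrite /l; case: n n_ge5 => [|[]].
have [rA rP] : exists rA : {set 'F_p} -> seq k, forall A : {set 'F_p}, 0 \notin A ->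
    [/\ uniq (rA A), (p.-1 <= size (rA A))%N & forall y, y \in rA A ->
      [/\ y ^+ p.+1 = iota_p (\prod_(a in A) a)^-1, y ^+ p != y & y ^+ (p ^ 2) = y]].
  have sol (A : {set 'F_p}) : exists r : seq k, 0 \notin A -> [/\ uniq r, (p.-1 <= size r)%N
      & forall y, y \in r ->
        [/\ y ^+ p.+1 = iota_p (\prod_(a in A) a)^-1, y ^+ p != y & y ^+ (p ^ 2) = y]].
    have [nA|] := boolP (0 \notin A); last by exists [::].
    by have [r Pr] := transposition_solutions nA; exists r.
  exact: fin_all_exists sol.
pose Sets := [set A : {set 'F_p} | (A \subset [set~ 0]) && (#|A| == l)].
have SetsP A : A \in Sets -> 0 \notin A /\ #|A| = l.
  by rewrite inE => /andP[/subsetP sA /eqP ->]; split=> //; apply/negP => /sA; rewrite !inE eqxx.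
pose ts := [seq (y, A) | A <- enum Sets, y <- rA A].
pose rs (t : k * {set 'F_p}) := [:: t.1, t.1 ^+ p & map iota_p (enum t.2)].
pose f t := \prod_(z <- rs t) ('X - z%:P).
have tsP y A : (y, A) \in ts -> [/\ 0 \notin A, #|A| = l & [/\
    y ^+ p.+1 = iota_p (\prod_(a in A) a)^-1, y ^+ p != y & y ^+ (p ^ 2) = y]].
  move=> /allpairsPdep[B [z [+ zB [-> ->]]]]; rewrite mem_enum => /SetsP[nB cB].
  by have [_ _ /(_ z zB)] := rP B nB.
have szrs t : t \in ts -> size (rs t) = n.
  by case: t => y A /tsP[_ cA _]; rewrite /rs /= size_map -cardE cA -Dn.
have fixed_iota a : iota_p a ^+ p = iota_p a.
  by apply/eqP/Frobenius_fixedP; exists a.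
exists (undup (map f ts)); split; first exact: undup_uniq.
  move=> g; rewrite mem_undup => /mapP[[y A] tt ->]; have [nA cA [E yp yp2]] := tsP _ _ tt.
  have nzA : \prod_(a in A) a != 0.
    by apply/prodf_neq0 => a aA; apply: contraNneq nA => <-.
  split.
    apply: realizable_prod; first exact: szrs.
      rewrite !big_cons big_map mulrA -exprS E -big_enum fmorphV rmorph_prod /=.
      by rewrite mulVf // -rmorph_prod big_enum fmorph_eq0.
    rewrite rmorph_prod [LHS](eq_bigr (fun z => 'X - (z ^+ p)%:P)); last first.
      by move=> z _; apply: map_polyXsubC.
    rewrite !big_cons /= -exprM mulnn yp2 mulrCA; congr (_ * (_ * _)).
    by rewrite !big_map; apply: eq_bigr => a _; rewrite fixed_iota.
  exists y, (map iota_p (enum A)); split=> //; first by rewrite /f !big_cons mulrA.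
    by move=> _ /mapP[a _ ->].
  have nfix z : z ^+ p != z -> z \notin map iota_p (enum A).
    by apply: contraNN => /mapP[a _ ->]; rewrite fixed_iota.
  rewrite /= inE negb_or eq_sym yp nfix //= nfix /=; last first.
    by rewrite -exprM mulnn yp2 eq_sym.
  by rewrite map_inj_uniq ?enum_uniq //; apply: fmorph_inj.
rewrite -!mulnA; apply: leq_trans (_ : l`! * (2 ^ n.-1 * size ts) <= _)%N; last first.
  rewrite !leq_mul2l; apply/orP; right; apply/orP; right.
  apply: (card_fibers_le (y := fst) (m := n)).
  - apply: allpairs_uniq_dep; first exact: enum_uniq.
      by move=> A; rewrite mem_enum => /SetsP[nA _]; have [] := rP A nA.
    by move=> [A y] [B z] _ _ /= [-> ->].
  - move=> [y A] [z B] tt uu [fE /= Dz]; subst z; congr (_, _); apply/setP => a.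
    have memE C : (y, C) \in ts -> (a \in C) = root (f (y, C)) (iota_p a).
      move=> /tsP[_ _ [_ yp yp2]]; rewrite root_prod_XsubC !inE.
      rewrite [_ == y](_ : _ = false); last by apply: contraNF yp => /eqP <-; rewrite fixed_iota.
      rewrite [_ == y ^+ p](_ : _ = false) /=; last first.
        by apply: contraNF yp => /eqP E; rewrite -{2}yp2 -mulnn exprM -E !fixed_iota.
      by rewrite mem_map ?mem_enum //; apply: fmorph_inj.
    by rewrite (memE A tt) (memE B uu) fE.
  move=> t tt; split; rewrite /f ?monic_neq0 ?monic_prod_XsubC ?size_prod_XsubC ?szrs //.
  by rewrite root_prod_XsubC mem_head.
have szts : ('C(p.-1, l) * p.-1 <= size ts)%N.
  have <- : #|Sets| = 'C(p.-1, l).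
    by rewrite /Sets cards_draws cardsC1 card_Fp.
  rewrite size_allpairs_dep sumnE big_map -sum1_card big_distrl /= -big_enum /= !big_seq.
  apply: leq_sum => A; rewrite mem_enum => /SetsP[nA _]; rewrite mul1n.
  by have [] := rP A nA.
have half : (p ^ l <= 2 ^ l * p.-1 ^_ l)%N.
  apply: leq_trans (_ : 2 ^ l * (p.-1.+1 - l) ^ l <= _)%N; last first.
    by rewrite leq_mul2l ffact_ge_exp orbT.
  (* Here [p >= 2 n] enters: the falling factorial is [p ^ l] up to the factor [2 ^ l]. *)
  have le_p : (p <= 2 * (p.-1.+1 - l))%N.
    by rewrite prednK ?(ltnW p_gt1) //; move: le_2n_p; rewrite Dn; clear; lia.
  by rewrite -expnMn; case: (l) le_p => // l' le_p; rewrite leq_exp2r.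
apply: leq_trans (_ : l`! * (2 ^ n.-1 * ('C(p.-1, l) * p.-1)) <= _)%N; last first.
  by rewrite !leq_mul2l szts !orbT.
have -> : (l`! * (2 ^ n.-1 * ('C(p.-1, l) * p.-1)) = (2 ^ l * p.-1 ^_ l) * (2 * p.-1))%N.
  by rewrite -bin_ffact Dn /= expnS; ring.
rewrite Dn /= expnSr leq_mul //; move: p_gt1; clear; lia.
Qed.
End TypeCount.

Section TypeDensity.
Variables (p : nat) (k : fieldType) (phi : {rmorphism aint -> k}).
Hypothesis chp : p \in [pchar k].
Variable n : nat.
Hypothesis n_ge5 : (5 <= n)%N.
Hypothesis le_2n_p : (2 * n <= p)%N.

Definition residue_type (E : {poly k} -> Prop) (A : 'M['F_p]_n) : bool :=
  pbool (E (map_poly (Fp_embed chp) (char_poly A))).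

Lemma residue_type_int (E : {poly k} -> Prop) (g : 'M[int]_n) :
  residue_type E (map_mx intr g) = pbool (E (map_poly intr (char_poly g))).
Proof.
rewrite /residue_type -map_char_poly -map_poly_comp.
by rewrite (eq_map_poly (g := intr)) // => c; rewrite /= rmorph_int.
Qed.

(** The polynomials descend to [F_p], where [card_SL_char_poly] applies; the factor 2 is from
    [p <= 2 * (p - 1)]. *)
Lemma type_density (E : {poly k} -> Prop) (fs : seq {poly k}) (D : nat) :
  uniq fs -> {in fs, forall f, realizable chp n f /\ E f} -> (p ^ n.-1 <= D * size fs)%N ->
  (#|SLset 'F_p n| <= 2 * D * #|[set A in SLset 'F_p n | residue_type E A]|)%N.
Proof.
move=> ufs fsP le_fs.
have n0 : (0 < n)%N by apply: leq_trans n_ge5.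
have pr_p : prime p by case/andP: chp.
have p0 : (0 < p)%N by apply: prime_gt0.
have [L DL] : exists L : seq {poly 'F_p}, map (map_poly (Fp_embed chp)) L = fs.
  have {fsP}: {in fs, forall f, map_poly (pFrobenius_aut chp) f = f}.
    by move=> f /fsP[[]].
  elim: fs {ufs le_fs} => [|f fs IH] P; first by exists [::].
  have [|L <-] := IH; first by move=> g fsg; apply: P; rewrite inE fsg orbT.
  have [f0 <-] := Frobenius_fixed_poly (P f (mem_head _ _)).
  by exists (f0 :: L).
have uL : uniq L by move: ufs; rewrite -DL => /map_uniq.
have szL : size L = size fs by rewrite -DL size_map.
have LP : {in L, forall f : {poly 'F_p}, [/\ f \is monic, size f = n.+1 & f`_0 = (-1) ^+ n]}.
  move=> f Lf; have [[mf szf cf _] _] := fsP _ (etrans (esym (congr1 (fun s => _ \in s) DL)) (map_f _ Lf)).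
  rewrite map_monic in mf; rewrite size_map_poly in szf; split=> //.
  by apply: (fmorph_inj (Fp_embed chp)); rewrite -coef_map cf rmorphXn rmorphN1.
have LE A : \det A = 1 -> char_poly A \in L -> residue_type E A.
  move=> _ LA; apply/pboolP.
  by have [_] := fsP _ (etrans (esym (congr1 (fun s => _ \in s) DL)) (map_f _ LA)).
have := card_SL_char_poly n0 uL LP LE; rewrite szL card_Fp //.
set S := #|SLset _ _|; set T := #|_|; set m := size fs in le_fs * => main.
have {main} : (p ^ n * S <= p ^ n * (2 * D * T))%N.
  apply: (@leq_trans (2 * (D * (m * (p.-1 * S))))%N); last first.
    by rewrite mulnA [(_ * (2 * D * T))%N]mulnC -[(2 * D * T * _)%N]mulnA leq_mul2l mulnC main orbT.
  have -> : (p ^ n = p * p ^ n.-1)%N by rewrite -expnS prednK.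
  have -> : (2 * (D * (m * (p.-1 * S))) = (2 * p.-1) * (D * m) * S)%N by ring.
  rewrite leq_mul2r leq_mul ?orbT //; have := prime_gt1 pr_p; clear; lia.
by rewrite leq_pmul2l // expn_gt0 p0.
Qed.

(** Dominates the three counting constants, with the factor 2 of [type_density]. It does not depend
    on [p], so failure at many primes becomes improbable. *)
Definition density_constant : nat := (2 * ((n.-2)`! * 2 ^ n.-1 * n + 2 * n))%N.

Lemma types_dense :
  [/\ (#|SLset 'F_p n| <= density_constant
         * #|[set A in SLset 'F_p n | residue_type (@long_cycle_type n p k) A]|)%N,
      (#|SLset 'F_p n| <= density_constant
         * #|[set A in SLset 'F_p n | residue_type (@fixed_point_free_type p k) A]|)%N
    & (#|SLset 'F_p n| <= density_constant
         * #|[set A in SLset 'F_p n | residue_type (@transposition_type p k) A]|)%N].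
Proof.
have [fs1 [u1 P1 D1]] := long_cycle_count phi chp n_ge5 le_2n_p.
have [fs2 [u2 P2 D2]] := fixed_point_free_count phi chp n_ge5.
have [fs3 [u3 P3 D3]] := transposition_count phi chp n_ge5 le_2n_p.
split.
- apply: leq_trans (type_density u1 P1 D1) _.
  by rewrite /density_constant leq_mul2r leq_mul2l leq_addl ?orbT.
- apply: leq_trans (type_density u2 P2 D2) _; rewrite /density_constant leq_mul2r leq_mul2l.
  by apply/orP; right; rewrite /= (leq_trans _ (leq_addl _ _)) // leq_pmull.
apply: leq_trans (type_density u3 P3 D3) _.
by rewrite /density_constant leq_mul2r leq_mul2l leq_addr ?orbT.
Qed.
End TypeDensity.

(** * Congruence quotients and equidistribution *)

Section CongruenceLift.
Variables (p N : nat).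
Hypotheses (pr_p : prime p) (ndN : ~~ (p %| N)%N).

Definition congruent_one (n : nat) (g : 'M[int]_n) : Prop :=
  exists h : 'M[int]_n, g = 1%:M + N%:R *: h.

Definition liftable (n : nat) (B : 'M['F_p]_n) : Prop :=
  exists g : 'M[int]_n, [/\ \det g = 1, congruent_one g & map_mx intr g = B].

Lemma liftable_mul n (A B : 'M['F_p]_n) : liftable A -> liftable B -> liftable (A *m B).
Proof.
move=> [g [dg [a Dg] <-]] [h [dh [b Dh] <-]]; exists (g *m h); split.
- by rewrite det_mulmx dg dh mul1r.
- exists (a + b + N%:R *: (a *m b)); rewrite Dg Dh mulmxDl !mulmxDr !mul1mx mulmx1.
  by rewrite -scalemxAl -scalemxAr !scalerDr !addrA [X in X + _ = _]addrAC.
by rewrite map_mxM.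
Qed.

Lemma exists_int_lift m n (A : 'M['F_p]_(m, n)) : exists h : 'M[int]_(m, n), map_mx intr (N%:R *: h) = A.
Proof.
have nzN : N%:R != 0 :> 'F_p by rewrite -(dvdn_pcharf (pchar_Fp pr_p)).
exists (\matrix_(i, j) ((A i j / N%:R : 'F_p) : nat)%:Z).
have intK (x : 'F_p) : ((x : nat)%:Z)%:~R = x by apply: natr_Zp.
apply/matrixP => i j; rewrite !mxE rmorphM rmorph_nat.
transitivity (N%:R * (A i j / N%:R) : 'F_p); last by rewrite mulrC divfK.
by congr (_ * _); apply: intK.
Qed.

Lemma liftable_ublock n (r : 'rV['F_p]_n) : liftable (block_mx 1%:M r 0 1%:M : 'M_(1 + n)).
Proof.
have [h Dh] := exists_int_lift r.
exists (block_mx 1%:M (N%:R *: h) 0 1%:M); split; first by rewrite det_ublock !det1 mul1r.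
  exists (block_mx 0 h 0 0); rewrite scale_block_mx.
  by rewrite [1%:M in RHS]scalar_mx_block add_block_mx !scaler0 !addr0 !add0r.
by rewrite map_block_mx Dh !map_mx1 map_mx0.
Qed.

Lemma liftable_lblock n (c : 'cV['F_p]_n) : liftable (block_mx 1%:M 0 c 1%:M : 'M_(1 + n)).
Proof.
have [h Dh] := exists_int_lift c.
exists (block_mx 1%:M 0 (N%:R *: h) 1%:M); split; first by rewrite det_lblock !det1 mul1r.
  exists (block_mx 0 0 h 0); rewrite scale_block_mx.
  by rewrite [1%:M in RHS]scalar_mx_block add_block_mx !scaler0 !addr0 !add0r.
by rewrite map_block_mx Dh !map_mx1 map_mx0.
Qed.

Lemma liftable_diag n (D : 'M['F_p]_n) : liftable D -> liftable (block_mx 1%:M 0 0 D : 'M_(1 + n)).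
Proof.
move=> [g [dg [h Dg] <-]]; exists (block_mx 1%:M 0 0 g); split.
- by rewrite det_ublock det1 mul1r.
- exists (block_mx 0 0 0 h); rewrite scale_block_mx.
  by rewrite [1%:M in RHS]scalar_mx_block add_block_mx !scaler0 !addr0 -Dg.
by rewrite map_block_mx map_mx1 !map_mx0.
Qed.

(** Strong approximation by elimination: elementary blocks lift to matrices congruent to 1 modulo
    [N], because [N] is invertible modulo [p]. *)
Lemma liftable_SL n (B : 'M['F_p]_n) : \det B = 1 -> liftable B.
Proof.
elim: n B => [|n IH] B dB.
  by exists 1%:M; split; [rewrite det1 | exists 0; rewrite scaler0 addr0 | apply/matrixP => -[]].
rewrite -[n.+1]/(1 + n)%N in B dB *.
(* Corner 1: block elimination reduces to size [n]. *)
have ul1 (A : 'M['F_p]_(1 + n)) : \det A = 1 -> ulsubmx A = 1%:M -> liftable A.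
  move=> dA a1; set r := ursubmx A; set c := dlsubmx A.
  have DA : A = block_mx 1%:M 0 c 1%:M *m (block_mx 1%:M 0 0 (drsubmx A - c *m r) *m block_mx 1%:M r 0 1%:M).
    rewrite !mulmx_block !mul1mx !mulmx1 !mul0mx !mulmx0 !add0r !addr0 addrC subrK.
    by rewrite mulmx1 -a1 /r /c submxK.
  rewrite DA; apply: liftable_mul; first exact: liftable_lblock.
  apply: liftable_mul; last exact: liftable_ublock.
  apply/liftable_diag/IH; move: dA; rewrite {1}DA !det_mulmx det_lblock !det_ublock !det1.
  by rewrite !mul1r mulr1.
(* A nonzero entry below the corner: a row operation turns the corner into 1. *)
have dl (A : 'M['F_p]_(1 + n)) : \det A = 1 -> dlsubmx A != 0 -> liftable A.
  move=> dA nzc.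
  have [i nzi] : exists i, dlsubmx A i 0 != 0.
    apply/existsP; apply: contraNT nzc; rewrite negb_exists => /forallP c0.
    apply/eqP/matrixP => i j; rewrite ord1 [RHS]mxE; apply/eqP.
    by have := c0 i; rewrite negbK.
  pose r : 'rV['F_p]_n := \row_j (if j == i then (1 - ulsubmx A 0 0) / dlsubmx A i 0 else 0).
  have -> : A = block_mx 1%:M (- r) 0 1%:M *m (block_mx 1%:M r 0 1%:M *m A).
    rewrite mulmxA mulmx_block !mul1mx !mulmx1 !mul0mx !mulmx0 !add0r !addr0 subrr.
    by rewrite -scalar_mx_block mul1mx.
  apply: liftable_mul; first exact: liftable_ublock.
  apply: ul1; first by rewrite det_mulmx det_ublock !det1 !mul1r.
  rewrite -[A in LHS]submxK mulmx_block block_mxKul mul1mx; apply/matrixP => j l.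
  rewrite !ord1 mxE [X in _ + X]mxE (bigD1 i) //= big1; last by move=> j' nj; rewrite [r _ _]mxE (negbTE nj) mul0r.
  by rewrite [r _ _]mxE eqxx divfK // addr0 [RHS]mxE eqxx addrC subrK.
have [c0|] := eqVneq (dlsubmx B) 0; last exact: dl.
have dB' : ulsubmx B 0 0 * \det (drsubmx B) = 1.
  by rewrite -dB -[B in RHS]submxK c0 det_ublock det_mx11.
have nza : ulsubmx B 0 0 != 0 by apply: contra_eq_neq dB' => ->; rewrite mul0r eq_sym oner_neq0.
have [n0|n_gt0] := posnP n.
  have detD : \det (drsubmx B) = 1.
    by move: (drsubmx B); rewrite n0 => D; apply: det_mx00.
  apply: ul1 => //; apply/matrixP => i j.
  by rewrite !ord1 [RHS]mxE eqxx -dB' detD mulr1.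
(* Only zeros below the nonzero corner: adding the first row to the second creates a nonzero entry
   there. *)
pose e : 'cV['F_p]_n := delta_mx (Ordinal n_gt0) 0.
have -> : B = block_mx 1%:M 0 (- e) 1%:M *m (block_mx 1%:M 0 e 1%:M *m B).
  rewrite mulmxA mulmx_block !mul1mx !mulmx1 !mul0mx !mulmx0 !add0r !addr0 addNr.
  by rewrite -scalar_mx_block mul1mx.
apply: liftable_mul; first exact: liftable_lblock.
apply: dl; first by rewrite det_mulmx det_lblock !det1 !mul1r.
rewrite -[B in X in dlsubmx X]submxK mulmx_block block_mxKdl c0 mulmx0 addr0.
apply: contraNneq nza => /matrixP/(_ (Ordinal n_gt0) 0) E.
have <- : (e *m ulsubmx B) (Ordinal n_gt0) 0 = ulsubmx B 0 0.
  by rewrite mxE big_ord1 [e _ _]mxE !eqxx mul1r.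
by rewrite E mxE.
Qed.
End CongruenceLift.

Section DenseQuotient.
Variable n : nat.

(** A finite transitive [SL_n(Z)]-set on which the principal congruence subgroup of level [N] acts
    trivially. The laws are limited to determinant 1 because [act] is defined on all matrices. *)
Record congruence_quotient (X : finType) (act : 'M[int]_n -> X -> X) (x0 : X) (N : nat) : Prop :=
  CongruenceQuotient {
    quotient_mul : forall g h x, \det g = 1 -> \det h = 1 -> act (g *m h) x = act g (act h x);
    quotient_trans : forall x, exists g, \det g = 1 /\ act g x0 = x;
    quotient_level : forall g x, \det g = 1 -> congruent_one N g -> act g x = x;
    quotient_level_gt0 : (0 < N)%N }.

Definition SLtype (p : nat) : Type := {A : 'M['F_p]_n | \det A == 1}.
HB.instance Definition _ p := Finite.on (SLtype p).

Definition SLact (p : nat) (g : 'M[int]_n) (A : SLtype p) : SLtype p :=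
  insubd A (map_mx intr g *m val A).

Lemma val_SLact p g (A : SLtype p) : \det g = 1 -> val (SLact g A) = map_mx intr g *m val A.
Proof.
move=> dg; rewrite insubdK // -topredE /= det_mulmx det_map_mx dg rmorph1 mul1r.
exact: (valP A).
Qed.

Definition SLone p : SLtype p := exist _ 1%:M (introT eqP (det1 _ _)).

Lemma card_SLtype p (T : pred 'M['F_p]_n) :
  #|[set A : SLtype p | T (val A)]| = #|[set A in SLset 'F_p n | T A]|.
Proof.
rewrite -(card_imset _ (val_inj : injective (val : SLtype p -> _))).
apply: eq_card => A; rewrite !inE; apply/imsetP/andP => [[B + ->]|[dA TA]].
  by rewrite inE => TB; rewrite (valP B).
by exists (exist _ A dA); rewrite ?inE.
Qed.

(** Transitivity on the product: [g] places the first coordinate, then [h] congruent to 1 modulo [N]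
    corrects the second without moving the first. *)
Lemma congruence_quotient_extend (X : finType) (act : 'M[int]_n -> X -> X) x0 N p :
  congruence_quotient act x0 N -> prime p -> ~~ (p %| N)%N ->
  congruence_quotient (fun g (x : X * SLtype p) => (act g x.1, SLact g x.2)) (x0, SLone p) (N * p).
Proof.
move=> [qM qT qL qN] pr_p ndN; split.
- move=> g h [x A] dg dh /=; congr (_, _); first exact: qM.
  by apply: val_inj; rewrite !val_SLact ?det_mulmx ?dg ?dh ?mulr1 // map_mxM mulmxA.
- move=> [x [A dA]]; have [g [dg Dg]] := qT x.
  have ug : map_mx intr g \in @unitmx 'F_p n by rewrite unitmxE det_map_mx dg rmorph1 unitr1.
  have dB : \det (invmx (map_mx intr g) *m A) = 1.
    by rewrite det_mulmx det_inv det_map_mx dg rmorph1 invr1 mul1r (eqP dA).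
  have [h [dh ch Dh]] := liftable_SL pr_p ndN dB.
  exists (g *m h); rewrite det_mulmx dg dh mulr1; split=> //; congr (_, _).
    by rewrite /= qM // (qL h).
  by apply: val_inj; rewrite val_SLact ?det_mulmx ?dg ?dh ?mulr1 //= map_mxM Dh mulmx1 mulKVmx.
- move=> g [x A] dg [h Dg] /=; congr (_, _).
    by apply: qL => //; exists (p%:R *: h); rewrite Dg scalerA -natrM.
  apply: val_inj; rewrite val_SLact // Dg map_mxD map_mx1 map_mxZ natrM rmorphM.
  by rewrite !rmorph_nat pchar_Fp_0 // mulr0 scale0r addr0 mul1mx.
by rewrite muln_gt0 qN prime_gt0.
Qed.

Variables (J : finType) (Q : J -> 'M[int]_n -> Prop) (C : nat).
Hypothesis C_gt0 : (0 < C)%N.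
Hypothesis tests : forall B : nat, exists p, [/\ prime p, (B < p)%N &
  exists T : J -> pred 'M['F_p]_n, forall j,
    (#|SLset 'F_p n| <= C * #|[set A in SLset 'F_p n | T j A]|)%N /\
    forall g, \det g = 1 -> T j (map_mx intr g) -> Q j g].

(** [Bad j] collects the points where test [j] fails at all [r] primes. Each new prime, chosen prime
    to the level, multiplies its proportion by at most [1 - 1 / C]. *)
Lemma dense_quotient (r : nat) :
  exists (X : finType) (act : 'M[int]_n -> X -> X) (x0 : X) (N : nat) (Bad : J -> {set X}),
    congruence_quotient act x0 N /\
    forall j, (#|Bad j| * C ^ r <= C.-1 ^ r * #|X|)%N /\
      forall g, \det g = 1 -> act g x0 \notin Bad j -> Q j g.
Proof.
elim: r => [|r [X [act [x0 [N [Bad [qX BadP]]]]]]].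
  exists unit, (fun _ x => x), tt, 1%N, (fun=> setT); split; last first.
    by move=> j; rewrite cardsT !expn0 muln1 mul1n; split=> // g _; rewrite inE.
  by split=> // -[]; exists 1%:M; rewrite det1.
have [p [pr_p ltNp [T TP]]] := tests N.
have ndN : ~~ (p %| N)%N by rewrite gtnNdvd // (quotient_level_gt0 qX).
exists (X * SLtype p)%type, (fun g x => (act g x.1, SLact g x.2)), (x0, SLone p), (N * p)%N.
exists (fun j => setX (Bad j) [set A : SLtype p | ~~ T j (val A)]).
split; first exact: congruence_quotient_extend.
move=> j; have [cB BQ] := BadP j; have [cT TQ] := TP j; split; last first.
  move=> g dg; rewrite !inE negb_and negbK => /orP[/(BQ g dg)//|].
  by rewrite val_SLact // mulmx1; apply: TQ.
rewrite cardsX card_prod.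
have cS : #|{: SLtype p}| = #|SLset 'F_p n|.
  transitivity #|[set A : SLtype p | xpredT (val A)]|; first by rewrite cardsE.
  by rewrite (card_SLtype xpredT); apply: eq_card => A; rewrite !inE andbT.
rewrite cS (card_SLtype (predC (T j))) /=.
have split_S : (#|[set A in SLset 'F_p n | T j A]| + #|[set A in SLset 'F_p n | ~~ T j A]|
    = #|SLset 'F_p n|)%N.
  have I0 : [set A in SLset 'F_p n | T j A] :&: [set A in SLset 'F_p n | ~~ T j A] = set0.
    by apply/setP => A; rewrite !inE; case: (T j A); rewrite ?andbF.
  rewrite -cardsUI I0 cards0 addn0.
  by apply: eq_card => A; rewrite !inE; case: (T j A); rewrite ?andbT ?andbF ?orbF.
move: cT; rewrite -split_S; set t := #|_|; set u := #|_| => cT.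
rewrite !expnS.
have -> : (#|Bad j| * u * (C * C ^ r) = (u * C) * (#|Bad j| * C ^ r))%N by ring.
have -> : (C.-1 * C.-1 ^ r * (#|X| * (t + u)) = (C.-1 * (t + u)) * (C.-1 ^ r * #|X|))%N by ring.
apply: leq_mul cB.
by case: C C_gt0 cT => // c _; rewrite /= mulSn; lia.
Qed.
End DenseQuotient.

(** * Equidistribution of the walk on a finite quotient *)

Section Walk.
Variables (n : nat) (Sigma : seq 'M[int]_n).
Hypotheses (genS : generates_SLZ Sigma) (S_gt0 : (0 < size Sigma)%N).
Variables (X : finType) (act : 'M[int]_n -> X -> X) (x0 : X) (N : nat).
Hypothesis qX : congruence_quotient act x0 N.

Local Notation m := (size Sigma).
Local Notation V := {ffun X -> rat^o}.
Local Notation step := (fun j : 'I_m => nth 1%:M Sigma j).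

Let S_SL (j : 'I_m) : \det (step j) = 1.
Proof. by apply: genS.1; apply: mem_nth. Qed.

Lemma act1 x : act 1%:M x = x.
Proof.
apply: (quotient_level qX); rewrite ?det1 //.
by exists 0; rewrite scaler0 addr0.
Qed.

Lemma act_inv g x : \det g = 1 -> act (invmx g) (act g x) = x.
Proof.
move=> dg; rewrite -(quotient_mul qX) ?det_inv ?dg ?invr1 // mulVmx ?act1 //.
by rewrite unitmxE dg unitr1.
Qed.

Lemma act_inj g : \det g = 1 -> injective (act g).
Proof. by move=> dg x y E; rewrite -(act_inv x dg) E act_inv. Qed.

(** Inverses of generators need not be steps. But the steps permute the finite set [X], so a set
    mapped into itself is also stable under the inverses. *)
Lemma invariant_set_full (Z : {set X}) x1 : x1 \in Z ->
  (forall (j : 'I_m) x, x \in Z -> act (step j) x \in Z) -> Z = setT.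
Proof.
move=> Zx1 Zstep.
have stab g : gen_by Sigma g -> forall x, x \in Z -> act g x \in Z.
  elim=> [x|h Sh x Zx|h gh IH x Zx|h1 h2 g1 IH1 g2 IH2 x Zx].
  - by rewrite act1.
  - have lth : (index h Sigma < m)%N by rewrite index_mem.
    by have := Zstep (Ordinal lth) x Zx; rewrite /= nth_index.
  - have dh : \det h = 1 by apply/genS.2.
    have ZE : [set act h z | z in Z] = Z.
      apply/eqP; rewrite eqEcard card_imset ?leqnn ?andbT; last exact: act_inj.
      by apply/subsetP => _ /imsetP[z Zz ->]; apply: IH.
    by move: Zx; rewrite -{1}ZE => /imsetP[z Zz ->]; rewrite act_inv.
  by rewrite (quotient_mul qX); [apply/IH1/IH2 | apply/genS.2 | apply/genS.2].
apply/setP => y; rewrite inE.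
have [[g [dg <-]] [h [dh Dh]]] := (quotient_trans qX y, quotient_trans qX x1).
have dhV : \det (invmx h) = 1 by rewrite det_inv dh invr1.
have -> : act g x0 = act (g *m invmx h) x1.
  by rewrite -Dh (quotient_mul qX) // act_inv.
by apply: stab => //; apply/genS.2; rewrite /SLZ det_mulmx dg dhV mulr1.
Qed.

Definition avg (u : V) : V := [ffun x => (m%:R)^-1 * \sum_(j < m) u (act (step j) x)].

(** Where [u] is maximal it stays so after every step, and the steps reach all of [X]. *)
Lemma avg_fixed_const (u : V) : avg u = u -> exists c, forall x, u x = c.
Proof.
move=> Eu; pose x1 := [arg max_(x > x0) u x]%O; exists (u x1).
have maxu x : u x <= u x1 by rewrite /x1; case: Order.TotalTheory.arg_maxP => // i _; apply.
pose Z := [set x | u x == u x1].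
suff ZT : Z = setT by move=> x; apply/eqP; have := in_setT x; rewrite -ZT inE.
apply: (@invariant_set_full Z x1); first by rewrite inE.
move=> j x; rewrite !inE => /eqP ux.
have m0 : m%:R != 0 :> rat by rewrite pnatr_eq0 -lt0n.
have /eqP : \sum_(i < m) (u x1 - u (act (step i) x)) = 0.
  have := congr1 (fun v : V => m%:R * v x) Eu; rewrite ffunE mulrA divff // mul1r ux => E.
  by rewrite sumrB E sumr_const card_ord mulr_natl subrr.
rewrite psumr_eq0; last by move=> i _; rewrite subr_ge0.
by move=> /allP/(_ j (mem_index_enum _)) /=; rewrite subr_eq0 eq_sym.
Qed.

Definition diff (u : V) : V := avg u - u.

Fact diff_linear : linear diff.
Proof.
move=> a u v; apply/ffunP => x; rewrite !ffunE.
rewrite (eq_bigr (fun j : 'I_m => a * u (act (step j) x) + v (act (step j) x))); last first.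
  by move=> j _; rewrite !ffunE.
rewrite big_split /= -mulr_sumr.
have scE (y : rat^o) : a *: y = a * y by [].
by rewrite !scE; move: (\sum_i _) (\sum_i _) (u x) (v x) m%:R^-1 => s1 s2 y1 y2 b; rewrite mulrBr mulrDr; ring.
Qed.

Lemma sum_diff u : \sum_x diff u x = 0.
Proof.
rewrite (eq_bigr (fun x => avg u x - u x)); last by move=> x _; rewrite !ffunE.
rewrite sumrB; apply/eqP; rewrite subr_eq0; apply/eqP.
rewrite (eq_bigr (fun x => m%:R^-1 * \sum_(j < m) u (act (step j) x))); last by move=> x _; rewrite ffunE.
rewrite -mulr_sumr exchange_big /=.
rewrite (eq_bigr (fun=> \sum_x u x)); last first.
  by move=> j _; rewrite [RHS](reindex_inj (act_inj (S_SL j))).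
have mK (y : rat) : m%:R^-1 * (y *+ m) = y.
  by rewrite -[y *+ m]mulr_natl mulrA mulVf ?mul1r // pnatr_eq0 -lt0n.
by rewrite sumr_const card_ord; apply: mK.
Qed.

HB.instance Definition _ := GRing.isLinear.Build rat V V *:%R diff diff_linear.

Definition total (u : V) : rat^o := \sum_x u x.

Fact total_linear : linear total.
Proof.
move=> a u v; rewrite /total scaler_sumr -big_split; apply: eq_bigr => x _.
by rewrite !ffunE.
Qed.

HB.instance Definition _ := GRing.isLinear.Build rat V rat^o *:%R total total_linear.

(* [diff] has a one-dimensional kernel, by the maximum principle, and its image lies in the hyperplane [total = 0]. *)
Lemma diff_onto (f : V) : \sum_x f x = 0 -> exists u : V, f = diff u.
Proof.
move=> f0; pose h := linfun diff; pose t := linfun total.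
have sub : (limg h <= lker t)%VS.
  by apply/subvP => _ /memv_imgP[u _ ->]; rewrite memv_ker !lfunE /= /total sum_diff.
have dim_ker : (\dim (lker h) <= 1)%N.
  pose c : V := [ffun=> 1].
  apply: leq_trans (_ : \dim <[c]>%VS <= _)%N; last by rewrite dim_vline; case: (_ != _).
  apply: dimvS; apply/subvP => u; rewrite memv_ker lfunE /= subr_eq0 => /eqP.
  move=> /avg_fixed_const[a ua]; apply/vlineP; exists a; apply/ffunP => x.
  by rewrite !ffunE ua /GRing.scale /= mulr1.
have dim_img : (0 < \dim (limg t))%N.
  rewrite lt0n dimv_eq0; apply/eqP => t0.
  have : t [ffun x => (x == x0)%:R] \in (limg t)%VS by apply/memv_img/memvf.
  rewrite t0 memv0 lfunE /= /total (bigD1 x0) //= ffunE eqxx big1 ?addr0 ?oner_eq0 //.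
  by move=> x nx; rewrite ffunE (negbTE nx).
have eq_dim : (\dim (lker t) <= \dim (limg h))%N.
  have := limg_ker_dim h fullv; have := limg_ker_dim t fullv; rewrite !capfv.
  by move: dim_ker dim_img; clear; lia.
have : f \in lker t by rewrite memv_ker lfunE /= /total f0.
have -> : lker t = limg h by apply/esym/eqP; rewrite eqEdim sub.
by move=> /memv_imgP[u _ ->]; exists u; rewrite lfunE.
Qed.

Definition walk_avg (k : nat) (u : V) : rat :=
  (\sum_(w : k.-tuple 'I_m) u (act (walk w) x0)) / (m ^ k)%N%:R.

Lemma walk_SL k (w : k.-tuple 'I_m) : \det (walk w) = 1.
Proof.
rewrite /walk; elim: (tval w) => [|j s IH] /=; first by rewrite det1.
by rewrite det_mulmx IH mulr1 S_SL.
Qed.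

Lemma sum_tupleS (k : nat) (F : k.+1.-tuple 'I_m -> rat) :
  \sum_(w : k.+1.-tuple 'I_m) F w = \sum_(w : k.-tuple 'I_m) \sum_j F [tuple of j :: w].
Proof.
rewrite pair_big /= (reindex (fun x : k.-tuple 'I_m * 'I_m => [tuple of x.2 :: x.1])) //.
exists (fun w : k.+1.-tuple 'I_m => ([tuple of behead w], thead w)) => [[w j] _|w _] /=.
  by rewrite theadE; congr (_, _); apply: val_inj.
by rewrite [RHS]tuple_eta; apply: val_inj.
Qed.

(** The first letter of a word is the leftmost factor and acts last; [avg] accounts for one more
    letter at the head. *)
Lemma walk_avg_avg k u : walk_avg k (avg u) = walk_avg k.+1 u.
Proof.
rewrite /walk_avg sum_tupleS expnS natrM invfM mulrA [RHS]mulrAC -mulrA [RHS]mulrC.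
rewrite [LHS]mulr_suml mulr_sumr; apply: eq_bigr => w _.
rewrite (eq_bigr (fun j : 'I_m => u (act (step j) (act (walk w) x0)))); last first.
  by move=> j _; rewrite -(quotient_mul qX) ?walk_SL.
by rewrite ffunE; apply: (etrans (mulrC _ _)); apply: mulrA.
Qed.

Lemma walk_avgB k u v : walk_avg k (u - v) = walk_avg k u - walk_avg k v.
Proof.
rewrite /walk_avg -mulrBl -sumrB; congr (_ / _); apply: eq_bigr => w _.
by rewrite !ffunE.
Qed.

Let mk_gt0 k : 0 < (m ^ k)%N%:R :> rat.
Proof. by rewrite ltr0n expn_gt0 S_gt0. Qed.

Lemma walk_avg_le k (u : V) (c : rat) : (forall x, u x <= c) -> walk_avg k u <= c.
Proof.
move=> ub; rewrite /walk_avg ler_pdivrMr ?mk_gt0 //.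
apply: le_trans (_ : \sum_(w : k.-tuple 'I_m) c <= _); first by apply: ler_sum.
by rewrite sumr_const card_tuple card_ord mulr_natr.
Qed.

Lemma walk_avg_ge k (u : V) (c : rat) : (forall x, c <= u x) -> c <= walk_avg k u.
Proof.
move=> lb; rewrite /walk_avg ler_pdivlMr ?mk_gt0 //.
apply: le_trans (_ : _ <= \sum_(w : k.-tuple 'I_m) c) _; last by apply: ler_sum.
by rewrite sumr_const card_tuple card_ord mulr_natr.
Qed.

Lemma sum_walk_avg_diff u K :
  \sum_(k < K) walk_avg k (diff u) = walk_avg K u - walk_avg 0 u.
Proof.
elim: K => [|K IH]; first by rewrite big_ord0 subrr.
rewrite big_ord_recr /= IH /diff walk_avgB walk_avg_avg.
by rewrite addrC addrA subrK.
Qed.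

(* The Cesaro averages of [diff u] along the walk telescope. *)
Lemma walk_avg_small (f : V) (e : rat) : \sum_x f x = 0 -> 0 < e ->
  exists k, walk_avg k f <= e.
Proof.
move=> /diff_onto[u ->] e0; pose b := \sum_x `|u x|.
have ub x : `|u x| <= b by rewrite /b (bigD1 x) //= lerDl sumr_ge0.
have [K KP] : exists K : nat, 2 * b / e < K%:R.
  exists (Num.bound (2 * b / e)); apply: archi_boundP.
  by rewrite divr_ge0 ?(ltW e0) // mulr_ge0 // sumr_ge0.
apply: Classical_Prop.NNPP => nk.
have big_all k : e <= walk_avg k (diff u).
  by rewrite leNgt; apply/negP => lt; apply: nk; exists k; apply: ltW.
have : K%:R * e <= 2 * b.
  apply: (@le_trans _ _ (\sum_(k < K) walk_avg k (diff u))).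
    rewrite mulr_natl -[K in X in X <= _]card_ord -sumr_const; exact: ler_sum.
  rewrite sum_walk_avg_diff mulr_natl mulr2n; apply: lerD.
    by apply: walk_avg_le => x; apply: le_trans (ler_norm _) (ub x).
  rewrite lerNl; apply: walk_avg_ge => x; rewrite lerNl.
  by apply: le_trans (ub x); rewrite -normrN ler_norm.
by rewrite leNgt -ltr_pdivrMr // KP.
Qed.

(** A single time is claimed: the walk on [X] may be periodic, and the proportion may stay large at
    other times. *)
Lemma walk_hits (Bad : {set X}) (e : rat) : 0 < e ->
  exists k, (#|[set w : k.-tuple 'I_m | act (walk w) x0 \in Bad]|%:R / (m ^ k)%N%:R : rat)
    <= #|Bad|%:R / #|X|%:R + e.
Proof.
move=> e0; pose d : rat := #|Bad|%:R / #|X|%:R.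
have X0 : #|X|%:R != 0 :> rat.
  by rewrite pnatr_eq0 -lt0n; apply/card_gt0P; exists x0.
pose ind : V := [ffun x => (x \in Bad)%:R]; pose cst : V := [ffun=> d].
have [|k lek] := @walk_avg_small (ind - cst) e _ e0.
  rewrite (eq_bigr (fun x => (x \in Bad)%:R - d)); last by move=> x _; rewrite !ffunE.
  rewrite sumrB sumr_const -natr_sum; apply/eqP; rewrite subr_eq0; apply/eqP.
  rewrite -[RHS]mulr_natr /d [#|xpredT|]cardT -cardT divfK //; congr _%:R.
  by rewrite -sum1_card [RHS]big_mkcond; apply: eq_bigr => x _; case: (x \in Bad).
exists k; move: lek; rewrite walk_avgB lerBlDr addrC => lek.
have lec : walk_avg k cst <= d by apply: walk_avg_le => x; rewrite ffunE.
apply: le_trans (le_trans lek _); last by rewrite lerD2r.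
rewrite /walk_avg ler_pdivrMr ?mk_gt0 // divfK ?gt_eqF ?mk_gt0 //.
rewrite (eq_bigr (fun w : k.-tuple 'I_m => (act (walk w) x0 \in Bad)%:R)); last first.
  by move=> w _; rewrite ffunE.
rewrite -natr_sum ler_nat -sum1_card big_mkcond; apply: leq_sum => w _.
by rewrite inE; case: (_ \in Bad).
Qed.
End Walk.

Lemma generating_seq_gt0 n (Sigma : seq 'M[int]_n) :
  (5 <= n)%N -> generates_SLZ Sigma -> (0 < size Sigma)%N.
Proof.
move=> n5 [_ genS]; case: Sigma genS => // genS.
have only1 g : gen_by [::] g -> g = 1%:M.
  by elim=> // [h _ ->|h1 h2 _ -> _ ->]; rewrite ?invmx1 ?mulmx1.
have [|a Aa na] := @exists_nontrivial_square 'I_n; first by rewrite card_ord.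
have /only1 : gen_by [::] (perm_mx a : 'M[int]_n).
  by apply/genS; rewrite /SLZ det_perm; move: Aa; rewrite Alt_even => /negbTE ->.
move=> E; case/eqP: na; apply/permP => i; rewrite permM perm1.
have ai j : a j = j.
  by have /matrixP/(_ j (a j)) := E; rewrite !mxE eqxx; case: eqVneq.
by rewrite !ai.
Qed.

(** That is [(1 - 1 / C) ^ r <= c / r] for [C = c + 1], a crude decay that suffices. *)
Lemma nat_geometric_decay (c r : nat) : (r * c ^ r <= c * c.+1 ^ r)%N.
Proof.
elim: r => // r IH; rewrite !expnS.
have le : (c ^ r <= c.+1 ^ r)%N by case: r {IH} => // r; rewrite leq_exp2r.
by move: IH le; move: (c ^ r)%N (c.+1 ^ r)%N => x y IH le; nia.
Qed.

(** * Times at which the walk is generic *)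

Section GenericWalk.
Variables (n : nat) (Sigma : seq 'M[int]_n).
Hypotheses (n_ge5 : (5 <= n)%N) (genS : generates_SLZ Sigma).

Definition type_pred (j : 'I_3) (p : nat) (k : fieldType) : {poly k} -> Prop :=
  match val j with
  | 0 => @long_cycle_type n p k
  | 1 => @fixed_point_free_type p k
  | _ => @transposition_type p k
  end.

Definition has_type_at_split (s : seq 'M[int]_n) (j : 'I_3) (g : 'M[int]_n) : Prop :=
  exists p (k : fieldType) (phi : {rmorphism aint -> k}),
    splits_at s p phi /\ type_pred j p (map_poly intr (char_poly g) : {poly k}).

Lemma full_over_of_split_types s g : (forall j, has_type_at_split s j g) ->
  uniq (rts g) /\ full_over (@rho n) s g.
Proof.
move=> E; have [p1 [k1 [phi1 [s1 E1]]]] := E ord0.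
have [p2 [k2 [phi2 [s2 E2]]]] := E (Ordinal (isT : (1 < 3)%N)).
have [p3 [k3 [phi3 [s3 E3]]]] := E ord_max.
exact: full_over_of_types s1 s2 s3 E1 E2 E3.
Qed.

Lemma split_type_tests s (B : nat) : exists p, [/\ prime p, (B < p)%N &
  exists T : 'I_3 -> pred 'M['F_p]_n, forall j,
    (#|SLset 'F_p n| <= density_constant n * #|[set A in SLset 'F_p n | T j A]|)%N /\
    forall g, \det g = 1 -> T j (map_mx intr g) -> has_type_at_split s j g].
Proof.
have [|p [k [phi [chp ltp fixs injs]]]] :=
    @exists_split_prime (all_rts s) (maxn B (maxn (Frobenius_bound s) (2 * n))).
  by move=> h x; apply: aint_aut_all_rts.
move: ltp; rewrite !gtn_max => /and3P[ltB ltF lt2].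
exists p; split=> //; first by case/andP: chp.
exists (fun j => residue_type chp (type_pred j p (k := k))) => j; split; last first.
  move=> g _; rewrite residue_type_int => /pboolP Ej.
  by exists p, k, phi.
have [d1 d2 d3] := types_dense phi chp n_ge5 (ltnW lt2).
by case: j => -[|[|[|//]]] ltj.
Qed.

Lemma walk_generic (s : seq 'M[int]_n) (e : rat) : 0 < e ->
  exists k, 1 - e <= prob_walk Sigma k (fun g => uniq (rts g) /\ full_over (@rho n) s g).
Proof.
move=> e0; have S0 := generating_seq_gt0 n_ge5 genS.
have C0 : (0 < density_constant n)%N.
  by rewrite /density_constant !muln_gt0 addn_gt0 !muln_gt0 (leq_trans _ n_ge5) ?orbT.
set c := (density_constant n).-1.
(* Three tests fail each with proportion at most [c / r], and [3 * c / r <= e / 2]; the other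
   [e / 2] is left to equidistribution. *)
pose r := (Num.bound (6 * c%:R / e : rat)).+1.
have [X [act [x0 [N [Bad [qX BadP]]]]]] := dense_quotient C0 (split_type_tests s) r.
have e2 : 0 < e / 2 by rewrite divr_gt0.
have [k lek] := walk_hits genS S0 qX (\bigcup_j Bad j) e2.
exists k.
have X0 : 0 < #|X|%:R :> rat by rewrite ltr0n; apply/card_gt0P; exists x0.
have r0 : 0 < r%:R :> rat by rewrite ltr0n.
have badj j : (r * #|Bad j| <= c * #|X|)%N.
  have [le _] := BadP j; rewrite -(leq_pmul2r (_ : 0 < (density_constant n) ^ r)%N); last first.
    by rewrite expn_gt0 C0.
  rewrite -mulnA; apply: leq_trans (leq_mul (leqnn r) le) _; rewrite -/c.
  have := nat_geometric_decay c r; rewrite /c (prednK C0) -/c => gd.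
  by rewrite mulnA [leqRHS]mulnAC leq_mul2r gd orbT.
have dens : #|\bigcup_j Bad j|%:R / #|X|%:R <= e / 2.
  have le1 : (#|\bigcup_j Bad j| <= \sum_j #|Bad j|)%N.
    elim/big_rec2: _ => [|j b A _ IH]; first by rewrite cards0.
    by rewrite (leq_trans (leq_card_setU _ _)) // leq_add2l.
  have le2 : (r * #|\bigcup_j Bad j| <= 3 * (c * #|X|))%N.
    apply: leq_trans (leq_mul (leqnn r) le1) _; rewrite big_distrr /=.
    apply: leq_trans (_ : \sum_(j < 3) c * #|X| <= _)%N; first exact: leq_sum.
    by rewrite sum_nat_const card_ord.
  rewrite ler_pdivrMr // -(ler_pM2l r0).
  move: le2; rewrite -(ler_nat rat) !natrM => le2; apply: (le_trans le2).
  have bd : 6 * c%:R / e <= r%:R.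
    apply: ltW; apply: lt_trans (_ : (Num.bound (6 * c%:R / e : rat))%:R < _); last by rewrite ltr_nat.
    by apply: archi_boundP; rewrite divr_ge0 ?mulr_ge0 ?ler0n // ltW.
  rewrite ler_pdivrMr // in bd.
  have -> : r%:R * (e / 2 * #|X|%:R) = (r%:R * e) * #|X|%:R / 2 by field.
  rewrite ler_pdivlMr // -[X in X <= _]mulrA.
  have -> : 3 * (c%:R * #|X|%:R * 2) = (6 * c%:R) * #|X|%:R :> rat by ring.
  by rewrite ler_pM2r.
rewrite /prob_walk; set G := [set w | _].
have mk0 : 0 < (size Sigma ^ k)%N%:R :> rat by rewrite ltr0n expn_gt0 S0.
rewrite lerBlDr -lerBlDl.
apply: le_trans (le_trans lek _); last first.
  by rewrite [leRHS]splitr lerD2r.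
rewrite ler_pdivlMr // mulrBl mul1r divfK ?lt0r_neq0 // lerBlDr -natrD ler_nat.
have -> : (size Sigma ^ k)%N = #|[set: k.-tuple 'I_(size Sigma)]|.
  by rewrite cardsT card_tuple card_ord.
rewrite -(setUCr G) setUC (leq_trans (leq_card_setU _ _)) // leq_add2r.
apply: subset_leq_card; apply/subsetP => w; rewrite !inE => /pboolP nG.
apply: contraT => nBad; case: nG; apply: full_over_of_split_types => j.
have [_ Q] := BadP j; apply: Q; first exact: walk_SL.
by apply: contra nBad => Bj; apply/bigcupP; exists j.
Qed.
End GenericWalk.

(** * The base field *)

Section SubfieldFacts.
Implicit Types F K : algC -> Prop.

Lemma subfield0 F : is_subfield F -> F 0. Proof. by case. Qed.
Lemma subfield1 F : is_subfield F -> F 1. Proof. by case=> _ []. Qed.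
Lemma subfieldD F x y : is_subfield F -> F x -> F y -> F (x + y).
Proof. by move=> [_ [_ [FD _]]]; apply: FD. Qed.
Lemma subfieldN F x : is_subfield F -> F x -> F (- x).
Proof. by move=> [_ [_ [_ [FN _]]]]; apply: FN. Qed.
Lemma subfieldM F x y : is_subfield F -> F x -> F y -> F (x * y).
Proof. by move=> [_ [_ [_ [_ [FM _]]]]]; apply: FM. Qed.
Lemma subfieldV F x : is_subfield F -> F x -> x != 0 -> F x^-1.
Proof. by move=> [_ [_ [_ [_ [_ FV]]]]]; apply: FV. Qed.

Lemma subfield_sum F (I : Type) (r : seq I) (u : I -> algC) : is_subfield F ->
  (forall i, F (u i)) -> F (\sum_(i <- r) u i).
Proof. by move=> sF Fu; elim/big_ind: _ => // [|x y]; [apply: subfield0 | apply: subfieldD]. Qed.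

Lemma subfieldX F x i : is_subfield F -> F x -> F (x ^+ i).
Proof.
move=> sF Fx; elim: i => [|i IH]; first exact: subfield1.
by rewrite exprS; apply: subfieldM.
Qed.

Lemma subfield_nat F i : is_subfield F -> F i%:R.
Proof.
move=> sF; elim: i => [|i IH]; first exact: subfield0.
by rewrite mulrS; apply: subfieldD => //; apply: subfield1.
Qed.

Section SplitField.
Variables (F : algC -> Prop) (n : nat) (g : 'M[int]_n).
Hypothesis sF : is_subfield F.
Local Notation K := (split_field F g).

Lemma rootsP z : root (char_poly (map_mx intr g)) z <-> exists i, z = \val (rt g i).
Proof.
rewrite -map_char_poly rtsP -(big_map val predT (fun z => 'X - z%:P)) root_prod_XsubC.
split=> [/mapP[t /mem_rtsP[i ->] ->]|[i ->]]; first by exists i.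
by apply/map_f/mem_rtsP; exists i.
Qed.

Lemma split_field_base x : F x -> K x. Proof. by move=> Fx L _ FL _; apply: FL. Qed.

Lemma split_field_root i : K (\val (rt g i)).
Proof. by move=> L _ _ RL; apply/RL/rootsP; exists i. Qed.

Lemma split_field_subfield : is_subfield K.
Proof.
split; first by move=> L sL _ _; apply: subfield0.
split; first by move=> L sL _ _; apply: subfield1.
split; first by move=> x y Kx Ky L sL FL RL; apply: subfieldD => //; [apply: Kx | apply: Ky].
split; first by move=> x Kx L sL FL RL; apply: subfieldN => //; apply: Kx.
split; first by move=> x y Kx Ky L sL FL RL; apply: subfieldM => //; [apply: Kx | apply: Ky].
by move=> x Kx nzx L sL FL RL; apply: subfieldV => //; apply: Kx.
Qed.

Lemma split_field_ind (P : algC -> Prop) : is_subfield P -> (forall x, F x -> P x) ->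
  (forall i, P (\val (rt g i))) -> forall x, K x -> P x.
Proof. by move=> sP FP RP x Kx; apply: Kx => // z /rootsP[i ->]. Qed.

End SplitField.

Section GaloisAction.
Variables (F K : algC -> Prop) (s : algC -> algC).
Hypotheses (sF : is_subfield F) (sK : is_subfield K) (FK : forall x, F x -> K x).
Hypothesis galS : galAut F K s.

Let stab x : K x -> K (s x). Proof. by case: galS => h _; apply: h. Qed.
Let sD x y : K x -> K y -> s (x + y) = s x + s y.
Proof. by case: galS => _ [_ [_ [h _]]]; apply: h. Qed.
Let sM x y : K x -> K y -> s (x * y) = s x * s y.
Proof. by case: galS => _ [_ [_ [_ [h _]]]]; apply: h. Qed.
Let s1 : s 1 = 1. Proof. by case: galS => _ [_ [_ [_ [_ [h _]]]]]. Qed.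
Let sfix x : F x -> s x = x.
Proof. by case: galS => _ [_ [_ [_ [_ [_ [h _]]]]]]; apply: h. Qed.

Lemma galAut0 : s 0 = 0. Proof. by apply: sfix; apply: subfield0. Qed.

Lemma galAutN x : K x -> s (- x) = - s x.
Proof.
by move=> Kx; apply/eqP; rewrite -addr_eq0 addrC -sD ?subrr ?galAut0 //; apply: subfieldN.
Qed.

Lemma galAutV x : K x -> x != 0 -> s x^-1 = (s x)^-1.
Proof.
move=> Kx nzx; have E : s x * s x^-1 = 1.
  by rewrite -sM ?divff //; apply: subfieldV.
have nz : s x != 0 by apply: contra_eq_neq E => ->; rewrite mul0r eq_sym oner_neq0.
by apply: (mulfI nz); rewrite E divff.
Qed.

Lemma galAut_sum (I : Type) (r : seq I) (u : I -> algC) : (forall i, K (u i)) ->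
  s (\sum_(i <- r) u i) = \sum_(i <- r) s (u i).
Proof.
move=> Ku; elim: r => [|i r IH]; first by rewrite !big_nil galAut0.
by rewrite !big_cons sD ?IH //; apply: subfield_sum.
Qed.

Lemma galAutX x i : K x -> s (x ^+ i) = s x ^+ i.
Proof.
move=> Kx; elim: i => [|i IH]; first exact: s1.
by rewrite !exprS sM ?IH //; apply: subfieldX.
Qed.

Lemma galAut_root (P : {poly algC}) x : (forall i, F P`_i) -> K x -> root P x -> root P (s x).
Proof.
move=> FP Kx /rootP P0; apply/rootP; rewrite -galAut0 -P0 !horner_coef galAut_sum.
  apply: eq_bigr => i _; have KX : K (x ^+ i) by apply: subfieldX.
  by rewrite (sM (FK (FP i)) KX) galAutX // (sfix (FP i)).
by move=> i; apply: subfieldM => //; [apply: FK | apply: subfieldX].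
Qed.
End GaloisAction.

Lemma galAut_eq (F : algC -> Prop) n (g : 'M[int]_n) (s t : algC -> algC) : is_subfield F ->
  galAut F (split_field F g) s -> galAut F (split_field F g) t ->
  (forall i, s (\val (rt g i)) = t (\val (rt g i))) -> s = t.
Proof.
move=> sF gs gt E; apply: FunctionalExtensionality.functional_extensionality => x.
have sK := @split_field_subfield F n g.
set K := split_field F g in gs gt sK.
have [Kx|nK] := Classical_Prop.classic (K x); last first.
  have [_ [_ [_ [_ [_ [_ [_ os]]]]]]] := gs; have [_ [_ [_ [_ [_ [_ [_ ot]]]]]]] := gt.
  by rewrite os // ot.
suff : K x /\ s x = t x by case.
have [_ [_ [_ [sD [sM [s1 [sfix _]]]]]]] := gs; have [_ [_ [_ [tD [tM [t1 [tfix _]]]]]]] := gt.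
move: x Kx; apply: (@split_field_ind F n g) => [|x Fx|i]; last 1 first.
- by split; [apply: split_field_root | apply: E].
- split; first by split; [apply: (subfield0 sK) | rewrite (galAut0 sF gs) (galAut0 sF gt)].
  split; first by split; [apply: (subfield1 sK) | rewrite s1 t1].
  split.
    by move=> x y [Kx Ex] [Ky Ey]; split; [apply: (subfieldD sK) | rewrite sD // tD // Ex Ey].
  split.
    move=> x [Kx Ex]; split; first exact: (subfieldN sK).
    by rewrite (galAutN sF sK gs) // (galAutN sF sK gt) // Ex.
  split.
    by move=> x y [Kx Ex] [Ky Ey]; split; [apply: (subfieldM sK) | rewrite sM // tM // Ex Ey].
  move=> x [Kx Ex] nzx; split; first exact: (subfieldV sK).
  by rewrite (galAutV sK gs) // (galAutV sK gt) // Ex.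
by split; [apply: split_field_base | rewrite sfix // tfix].
Qed.
End SubfieldFacts.

Lemma uniq_snd_inj (T U : eqType) (s : seq (T * U)) x y d :
  uniq (map snd s) -> (x, d) \in s -> (y, d) \in s -> x = y.
Proof.
elim: s => // -[z e] s IH /= /andP[ne us]; rewrite !inE.
move=> /predU1P[[-> De]|sx] /predU1P[[-> De']|sy] //; last exact: IH.
  by case/negP: ne; rewrite -De; apply/mapP; exists (y, d).
by case/negP: ne; rewrite -De'; apply/mapP; exists (x, d).
Qed.

(** * Galois groups over the union of the fixed fields *)

Section TaggedChain.
Variables (n : nat) (G : bool -> {group 'S_n}).
Local Notation Aut := {rmorphism algC -> algC}.
Local Notation state := (seq (bool * 'M[int]_n)).
Hypothesis G_Alt : forall b, G b \subset ('Alt_('I_n))%g.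

Definition acts_inside (s : state) (h : Aut) : Prop :=
  forall b d, (b, d) \in s -> rho d h \in G b.

Definition tracked (s : state) (b : bool) (g : 'M[int]_n) : Prop :=
  uniq (rts g) /\ exists d, (b, d) \in s /\ tracks (@rho n) (map snd s) d g.

Lemma acts_inside_even s h : acts_inside s h -> acts_evenly (@rho n) (map snd s) h.
Proof.
by move=> Hh d /mapP[[b d'] sd ->]; apply: (subsetP (G_Alt b)); apply: Hh.
Qed.

Lemma acts_inside_subgroup s : subgroup_pred (@aut_mul) aut_one aut_inv (acts_inside s).
Proof.
split=> [b d _|x y Hx Hy b d sd|x Hx b d sd].
- by rewrite rho1 group1.
- by rewrite rhoM groupM ?Hx ?Hy.
by rewrite rhoV groupV Hx.
Qed.

(** Independence gives [h] acting by [a] on [d] and trivially on the other representatives; [d]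
    carries only one tag. *)
Lemma acts_inside_realize s b d a : independent (@rho n) (map snd s) -> (b, d) \in s ->
  a \in G b -> exists2 h, acts_inside s h & rho d h = a.
Proof.
move=> [us ind] sd Ga.
have [|h [hd [_ th]]] := ind d a (map_f _ sd); first exact: (subsetP (G_Alt b)).
exists h => // b' d' sd'; have [E|nd] := eqVneq d' d; last by rewrite th ?group1 ?(map_f _ sd').
by rewrite E in sd' *; rewrite -(uniq_snd_inj us sd sd') hd.
Qed.

Variable st : nat -> state.
Hypothesis st_ind : forall t, independent (@rho n) (map snd (st t)).
Hypothesis st_mono : forall t t', (t <= t')%N -> {subset st t <= st t'}.

Local Notation H := (fun t => acts_inside (st t)).

Lemma acts_inside_mono t t' h : (t <= t')%N -> H t' h -> H t h.
Proof. by move=> le Hh b d sd; apply: Hh; apply: st_mono le _ sd. Qed.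

Definition chain_field (x : algC) : Prop := exists t, forall h, H t h -> h x = x.
Local Notation F := chain_field.

Lemma chain_field_subfield : is_subfield F.
Proof.
have two x y t t' : (forall h, H t h -> h x = x) -> (forall h, H t' h -> h y = y) ->
    forall h, H (maxn t t') h -> h x = x /\ h y = y.
  move=> Ex Ey h Hh; split; [apply: Ex|apply: Ey]; apply: acts_inside_mono Hh.
    exact: leq_maxl.
  exact: leq_maxr.
split; first by exists 0%N => h _; rewrite rmorph0.
split; first by exists 0%N => h _; rewrite rmorph1.
split.
  move=> x y [t Ex] [t' Ey]; exists (maxn t t') => h /(two _ _ _ _ Ex Ey)[hx hy].
  by rewrite rmorphD hx hy.
split; first by move=> x [t Ex]; exists t => h /Ex hx; rewrite rmorphN hx.
split.
  move=> x y [t Ex] [t' Ey]; exists (maxn t t') => h /(two _ _ _ _ Ex Ey)[hx hy].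
  by rewrite rmorphM hx hy.
by move=> x [t Ex] _; exists t => h /Ex hx; rewrite fmorphV hx.
Qed.

Section TrackedMatrix.
Variables (t0 : nat) (b : bool) (g : 'M[int]_n).
Hypothesis tr_g : tracked (st t0) b g.
Local Notation K := (split_field F g).
Local Notation rtv i := (\val (rt g i)).

Let sF := chain_field_subfield.
Let sK : is_subfield K := @split_field_subfield F n g.

Lemma rho_val (h : Aut) i : h (rtv i) = rtv (rho g h i).
Proof. by rewrite -val_aint_aut (rhoE _ (proj1 tr_g)). Qed.

(** [x] is built from the eigenvalues of [g] and finitely many elements of [F]; from some stage on
    the latter are all fixed, and only the action on [g] matters. *)
Lemma split_field_stable_value x : K x -> exists t, forall h1 h2, H t h1 -> H t h2 ->
  rho g h1 = rho g h2 -> h1 x = h2 x.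
Proof.
move: x; apply: (@split_field_ind F n g) => [|x [t Ex]|i]; last 1 first.
- by exists 0%N => h1 h2 _ _ E; rewrite !rho_val E.
- have two x y t t' : (forall h1 h2, H t h1 -> H t h2 -> rho g h1 = rho g h2 -> h1 x = h2 x) ->
      (forall h1 h2, H t' h1 -> H t' h2 -> rho g h1 = rho g h2 -> h1 y = h2 y) ->
      forall h1 h2, H (maxn t t') h1 -> H (maxn t t') h2 -> rho g h1 = rho g h2 ->
        h1 x = h2 x /\ h1 y = h2 y.
    move=> Ex Ey h1 h2 H1 H2 E; have [lt lt'] := (leq_maxl t t', leq_maxr t t').
    split; [apply: Ex|apply: Ey] => //; by [apply: acts_inside_mono H1 | apply: acts_inside_mono H2].
  split; first by exists 0%N => h1 h2 *; rewrite !rmorph0.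
  split; first by exists 0%N => h1 h2 *; rewrite !rmorph1.
  split.
    move=> x y [t Ex] [t' Ey]; exists (maxn t t') => h1 h2 H1 H2 E.
    by have [Ex' Ey'] := two _ _ _ _ Ex Ey _ _ H1 H2 E; rewrite !rmorphD Ex' Ey'.
  split; first by move=> x [t Ex]; exists t => h1 h2 H1 H2 E; rewrite !rmorphN (Ex h1 h2).
  split.
    move=> x y [t Ex] [t' Ey]; exists (maxn t t') => h1 h2 H1 H2 E.
    by have [Ex' Ey'] := two _ _ _ _ Ex Ey _ _ H1 H2 E; rewrite !rmorphM Ex' Ey'.
  by move=> x [t Ex] _; exists t => h1 h2 H1 H2 E; rewrite !fmorphV (Ex h1 h2).
by exists t => h1 h2 H1 H2 _; rewrite !Ex.
Qed.

Section Witness.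
Variable d : 'M[int]_n.
Hypotheses (sd : (b, d) \in st t0) (tr : tracks (@rho n) (map snd (st t0)) d g).

Lemma rho_track h1 h2 : H t0 h1 -> H t0 h2 -> (rho d h1 = rho d h2 <-> rho g h1 = rho g h2).
Proof. by move=> H1 H2; apply: tr; apply: acts_inside_even. Qed.

Lemma realize t a : (t0 <= t)%N -> a \in G b -> exists2 h, H t h & rho d h = a.
Proof. by move=> le Ga; apply: acts_inside_realize Ga => //; apply: st_mono le _ sd. Qed.

(* [takes a x y]: the automorphisms inducing [a^-1] on the representative [d] eventually send [x] to [y]; the inverse turns the right action of permutations into composition. *)
Definition takes (a : 'S_n) (x y : algC) : Prop :=
  exists2 t, (t0 <= t)%N & forall h, H t h -> rho d h = a^-1%g -> h x = y.

(** The condition in [takes] is never vacuous: [a^-1] is realised at every stage. *)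
Lemma takes_fun a x y y' : a \in G b -> takes a x y -> takes a x y' -> y = y'.
Proof.
move=> Ga [t le E] [t' le' E'].
have [|h Hh hd] := @realize (maxn t t') (a^-1)%g _ (groupVr Ga).
  by rewrite (leq_trans le) ?leq_maxl.
by rewrite -(E h) -?(E' h) //; apply: acts_inside_mono Hh; rewrite ?leq_maxl ?leq_maxr.
Qed.

Lemma takes_exists a x : a \in G b -> K x -> exists y, takes a x y.
Proof.
move=> Ga /split_field_stable_value[t E].
have [|h Hh hd] := @realize (maxn t t0) (a^-1)%g _ (groupVr Ga); first exact: leq_maxr.
exists (h x), (maxn t t0); first exact: leq_maxr.
move=> h' Hh' hd'.
apply: E (acts_inside_mono (leq_maxl _ _) Hh') (acts_inside_mono (leq_maxl _ _) Hh) _.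
have [track _] := rho_track (acts_inside_mono (leq_maxr _ _) Hh') (acts_inside_mono (leq_maxr _ _) Hh).
by apply: track; rewrite hd hd'.
Qed.

Lemma takes_ind2 a x1 y1 x2 y2 x y : takes a x1 y1 -> takes a x2 y2 ->
  (forall h : Aut, h x1 = y1 -> h x2 = y2 -> h x = y) -> takes a x y.
Proof.
move=> [t le E] [t' le' E'] W; exists (maxn t t'); first by rewrite (leq_trans le) ?leq_maxl.
move=> h Hh hd; apply: W; [apply: E|apply: E'] => //; apply: acts_inside_mono Hh.
  exact: leq_maxl.
exact: leq_maxr.
Qed.

Lemma takes_base a x : F x -> takes a x x.
Proof.
move=> [t E]; exists (maxn t t0); first exact: leq_maxr.
by move=> h Hh _; apply: E; apply: acts_inside_mono Hh; apply: leq_maxl.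
Qed.

Lemma takes_mul a c x y z : a \in G b -> c \in G b -> K x ->
  takes c x y -> takes a y z -> takes (a * c)%g x z.
Proof.
move=> Ga Gc Kx [t le E] [t' le' E'].
have [w tw] := takes_exists (groupM Ga Gc) Kx; have [t'' le'' E''] := tw.
set T := maxn (maxn t t') t''.
have leT : [/\ (t <= T)%N, (t' <= T)%N & (t'' <= T)%N].
  by rewrite /T !leq_max !leqnn !orbT.
have [leT1 leT2 leT3] := leT.
have leT0 : (t0 <= T)%N by apply: leq_trans leT1.
have [hc Hc dc] := realize leT0 (groupVr Gc); have [ha Ha da] := realize leT0 (groupVr Ga).
suff -> : z = w by [].
(* This automorphism induces [c^-1 * a^-1], the inverse of [a * c], and sends [x] to [z] through
   [y]. *)
have HT : H T (aut_mul hc ha) by case: (acts_inside_subgroup (st T)) => _ M _; apply: M.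
rewrite -(E'' (aut_mul hc ha)); first last.
- by rewrite rhoM dc da invMg.
- exact: acts_inside_mono leT3 HT.
rewrite /= (E hc) ?(E' ha) //; by [exact: acts_inside_mono leT1 Hc | exact: acts_inside_mono leT2 Ha].
Qed.

(** The stage depends on [x], so values are chosen point by point rather than by restricting one
    automorphism of [algC]. *)
Definition act_on (a : 'S_n) (x : algC) : algC :=
  if pbool (K x) then ClassicalEpsilon.epsilon (inhabits 0) (takes a x) else x.

Lemma act_onP a x : a \in G b -> K x -> takes a x (act_on a x).
Proof.
move=> Ga Kx; rewrite /act_on; case: pboolP => // _.
by apply: ClassicalEpsilon.epsilon_spec; apply: takes_exists.
Qed.

Lemma act_on_out a x : ~ K x -> act_on a x = x.
Proof. by move=> nK; rewrite /act_on; case: pboolP. Qed.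

Lemma act_on_eq a x y : a \in G b -> K x -> takes a x y -> act_on a x = y.
Proof. by move=> Ga Kx; apply: takes_fun => //; apply: act_onP. Qed.

Lemma act_on_root a h i : a \in G b -> H t0 h -> rho d h = a^-1%g -> act_on a (rtv i) = h (rtv i).
Proof.
move=> Ga Hh hd; apply: act_on_eq => //; first exact: split_field_root.
exists t0 => // h' Hh' hd'; rewrite !rho_val.
have [track _] := rho_track Hh' Hh.
by rewrite track // hd hd'.
Qed.

Lemma act_onD a x y : a \in G b -> K x -> K y -> act_on a (x + y) = act_on a x + act_on a y.
Proof.
move=> Ga Kx Ky; apply: act_on_eq => //; first exact: (subfieldD sK).
by apply: takes_ind2 (act_onP Ga Kx) (act_onP Ga Ky) _ => h <- <-; rewrite rmorphD.
Qed.

Lemma act_onM a x y : a \in G b -> K x -> K y -> act_on a (x * y) = act_on a x * act_on a y.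
Proof.
move=> Ga Kx Ky; apply: act_on_eq => //; first exact: (subfieldM sK).
by apply: takes_ind2 (act_onP Ga Kx) (act_onP Ga Ky) _ => h <- <-; rewrite rmorphM.
Qed.

Lemma act_onF a x : a \in G b -> F x -> act_on a x = x.
Proof.
move=> Ga Fx; have Kx : K x by apply: split_field_base.
exact: act_on_eq Ga Kx (takes_base a Fx).
Qed.

Lemma act_on_stable a x : a \in G b -> K x -> K (act_on a x).
Proof.
move=> Ga Kx; suff : K x /\ K (act_on a x) by case.
move: x Kx; apply: (@split_field_ind F n g) => [|x Fx|i]; last 1 first.
- split; first exact: split_field_root.
  have [h Hh hd] := realize (leqnn t0) (groupVr Ga).
  by rewrite (act_on_root _ Ga Hh hd) rho_val; apply: split_field_root.
- have [F0 F1] := (subfield0 sF, subfield1 sF).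
  split; first by rewrite act_onF //; split; apply: (subfield0 sK).
  split; first by rewrite act_onF //; split; apply: (subfield1 sK).
  split.
    move=> x y [Kx Kx'] [Ky Ky']; split; first exact: (subfieldD sK).
    by rewrite act_onD //; apply: (subfieldD sK).
  split.
    move=> x [Kx Kx']; split; first exact: (subfieldN sK).
    rewrite (act_on_eq (y := - act_on a x)) //; by [apply: (subfieldN sK)|
      apply: takes_ind2 (act_onP Ga Kx) (act_onP Ga Kx) _ => h <- _; rewrite rmorphN].
  split.
    move=> x y [Kx Kx'] [Ky Ky']; split; first exact: (subfieldM sK).
    by rewrite act_onM //; apply: (subfieldM sK).
  move=> x [Kx Kx'] nzx; split; first exact: (subfieldV sK).
  have tx : takes a x^-1 (act_on a x)^-1.
    by apply: takes_ind2 (act_onP Ga Kx) (act_onP Ga Kx) _ => h <- _; rewrite fmorphV.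
  rewrite (act_on_eq _ _ tx) //; last exact: (subfieldV sK).
  apply: (subfieldV sK) => //.
  have [t le E] := act_onP Ga Kx; have [h Hh hd] := realize le (groupVr Ga).
  by rewrite -(E h) // fmorph_eq0.
by rewrite act_onF //; split; apply: split_field_base.
Qed.

Lemma act_on_mul a c x : a \in G b -> c \in G b -> act_on (a * c)%g x = act_on a (act_on c x).
Proof.
move=> Ga Gc; have [Kx|nK] := Classical_Prop.classic (K x); last by rewrite !act_on_out.
apply: act_on_eq; rewrite ?groupM //; apply: takes_mul (act_onP Gc Kx) _ => //.
by apply: act_onP => //; apply: act_on_stable.
Qed.

Lemma act_on1 x : act_on 1%g x = x.
Proof.
have [Kx|nK] := Classical_Prop.classic (K x); last by rewrite !act_on_out.
have [t le E] := act_onP (group1 (G b)) Kx.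
rewrite -(E aut_one) ?rho1 ?invg1 //.
by case: (acts_inside_subgroup (st t)).
Qed.

Lemma galAut_act_on a : a \in G b -> galAut F K (act_on a).
Proof.
move=> Ga; have GV := groupVr Ga.
have aVa x : act_on a^-1%g (act_on a x) = x by rewrite -act_on_mul // mulVg act_on1.
have aaV x : act_on a (act_on a^-1%g x) = x by rewrite -act_on_mul // mulgV act_on1.
split; first by move=> x; apply: act_on_stable.
split; first by move=> y Ky; exists (act_on a^-1%g y); split; [apply: act_on_stable|].
split; first by move=> x y _ _ E; rewrite -[x]aVa E aVa.
split; first by move=> x y; apply: act_onD.
split; first by move=> x y; apply: act_onM.
split; first by apply: act_onF => //; apply: (subfield1 sF).
split; first by move=> x; apply: act_onF.
by move=> x; apply: act_on_out.
Qed.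

Lemma act_on_inj : {in G b &, injective act_on}.
Proof.
move=> a c Ga Gc E.
have [ha Ha da] := realize (leqnn t0) (groupVr Ga).
have [hc Hc dc] := realize (leqnn t0) (groupVr Gc).
have [_ track] := rho_track Ha Hc.
apply: invg_inj; rewrite -da -dc; apply: track.
apply/permP => i; apply: (rt_inj (proj1 tr_g)); apply: val_inj.
by rewrite -!rho_val -(act_on_root i Ga Ha da) -(act_on_root i Gc Hc dc) E.
Qed.

(* Artin's argument: [\sum_i a_i t^i] is a root of a polynomial over [F] all of whose roots are
   its images under automorphisms in [H t0]; one of these serves infinitely many [t]. *)
Lemma galAut_on_roots s : galAut F K s ->
  exists2 h, H t0 h & forall i, s (rtv i) = h (rtv i).
Proof.
move=> gs; have FK x : F x -> K x by apply: split_field_base.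
have [W DW] := image_group (@rhoM n) (@rho1 n) g (acts_inside_subgroup (st t0)).
pose lin t (a : 'S_n) : algC := \sum_i rtv (a i) * t%:R ^+ i.
pose R t : {poly algC} := \prod_(a in W) ('X - (lin t a)%:P).
have FR t i : F (R t)`_i.
  exists t0 => h Hh; rewrite -coef_map.
  suff -> : map_poly h (R t) = R t by [].
  have Wh : rho g h \in W by apply/DW; exists h.
  rewrite /R rmorph_prod [RHS](reindex_inj (mulIg (rho g h))) /=.
  apply: eq_big => [a|a _]; first by rewrite groupMr.
  rewrite map_polyXsubC; congr ('X - _%:P); rewrite rmorph_sum; apply: eq_bigr => j _.
  by rewrite rmorphM rmorphXn rmorph_nat permM; congr (_ * _); apply: rho_val.
have Klin t : K (lin t 1%g).
  apply: (subfield_sum _ sK) => i; apply: (subfieldM sK); first exact: split_field_root.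
  exact: subfieldX _ sK (subfield_nat _ sK).
(* At [t], [P a] has the value [s (lin t 1) - lin t a]. Some factor vanishes for each [t], so the
   product is zero and one [P a] is zero; its coefficients compare [s] with [a] root by root. *)
pose P (a : 'S_n) : {poly algC} := \poly_(i < n)
  (if insub i is Some i' then s (rtv i') - rtv (a i') else 0).
have P0 : \prod_(a in W) P a = 0.
  apply/eqP; apply: contraT => /exists_nonroot[t]; rewrite horner_prod => /negP[].
  have rt1 : root (R t) (lin t 1%g).
    by rewrite /root horner_prod (bigD1 1%g) ?group1 //= !hornerE subrr mul0r.
  have := galAut_root sF sK FK gs (FR t) (Klin t) rt1.
  rewrite /root horner_prod => /prodf_eq0[a Wa]; rewrite !hornerE subr_eq0 => /eqP E.
  apply/prodf_eq0; exists a => //; apply/eqP.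
  transitivity (s (lin t 1%g) - lin t a); last by rewrite E subrr.
  rewrite (galAut_sum sF sK gs); last first.
    move=> i; apply: (subfieldM sK); first exact: split_field_root.
    exact: subfieldX _ sK (subfield_nat _ sK).
  rewrite -sumrB horner_poly; apply: eq_bigr => i _; rewrite valK mulrBl; congr (_ - _).
  have [_ [_ [_ [_ [sM [_ [sfix _]]]]]]] := gs.
  rewrite sM; [|exact: split_field_root|exact: subfieldX _ sK (subfield_nat _ sK)].
  by rewrite perm1 [s (_ ^+ _)]sfix //; apply: subfieldX _ sF (subfield_nat _ sF).
have /eqP/prodf_eq0[a Wa /eqP Pa] := P0.
have /DW[h [Hh ha]] := Wa; exists h => // i; rewrite rho_val ha.
apply/eqP; rewrite -subr_eq0.
by have /polyP/(_ (i : nat)) := Pa; rewrite coef_poly ltn_ord coef0 valK => ->.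
Qed.

End Witness.

Lemma gal_isog_tracked : gal_isog F K (G b).
Proof.
have [u [d [sd tr]]] := tr_g; exists (act_on d); split.
  by move=> a Ga; apply: galAut_act_on.
split; last split; first last.
- by move=> a c Ga Gc; apply: FunctionalExtensionality.functional_extensionality => x; apply: act_on_mul.
- exact: act_on_inj.
move=> s gs; have [h Hh Eh] := galAut_on_roots gs.
(* The inverse appears because [act_on a] follows the automorphisms inducing [a^-1]. *)
have Ga : (rho d h)^-1%g \in G b by rewrite groupV; apply: Hh.
exists (rho d h)^-1%g => //.
apply: (galAut_eq sF _ gs) => [|i]; first exact: galAut_act_on.
by rewrite Eh; apply: act_on_root; rewrite ?invgK.
Qed.
End TrackedMatrix.
End TaggedChain.

Lemma prob_walk_mono n (Sigma : seq 'M[int]_n) k (E E' : 'M[int]_n -> Prop) :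
  (forall w : k.-tuple 'I_(size Sigma), E (walk w) -> E' (walk w)) ->
  prob_walk Sigma k E <= prob_walk Sigma k E'.
Proof.
move=> EE'; rewrite /prob_walk ler_wpM2r ?invr_ge0 ?ler0n // ler_nat.
by apply: subset_leq_card; apply/subsetP => w; rewrite !inE => /pboolP/EE' ?; apply/pboolP.
Qed.

(** * Inductive choice of the times and representatives *)

Section ChainConstruction.
Variables (n : nat) (Sigma : seq 'M[int]_n).
Hypotheses (n_ge5 : (5 <= n)%N) (genS : generates_SLZ Sigma).
Local Notation state := (seq (bool * 'M[int]_n)).
Implicit Types s : state.

Definition independent_state s : Prop := independent (@rho n) (map snd s).

Lemma tracked_cat s1 s b g : tracked s b g -> tracked (s1 ++ s) b g.
Proof.
move=> [u [d [sd tr]]]; split=> //; exists d; split; first by rewrite mem_cat sd orbT.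
by move=> h1 h2 e1 e2; apply: tr => i si; [apply: e1 | apply: e2]; rewrite map_cat mem_cat si orbT.
Qed.

(** Each matrix of [L] becomes a new representative with tag [b] or is tracked by one added for the
    same list. Earlier representatives, possibly with the other tag, are excluded by fullness over
    [s0]. *)
Lemma extend_state s0 b (L : seq 'M[int]_n) : independent_state s0 ->
  (forall g, g \in L -> uniq (rts g) /\ full_over (@rho n) (map snd s0) g) ->
  exists s1, [/\ independent_state (s1 ++ s0), forall x, x \in s1 -> x.1 = b
    & forall g, g \in L -> tracked (s1 ++ s0) b g].
Proof.
move=> ind0; elim: L => [|g L IH] P; first by exists [::].
have [|s1 [ind1 tag1 tr1]] := IH; first by move=> h Lh; apply: P; rewrite inE Lh orbT.
have [u full] := P g (mem_head _ _).
have ind1' : independent (@rho n) (map snd s1 ++ map snd s0) by rewrite -map_cat.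
have [ind2|[d s1d tr]] := independent_or_tracked n_ge5 (@rhoM n) (@rho1 n) (@rhoV n) ind1' full.
  exists ((b, g) :: s1); split=> [|x|h].
  - by rewrite /independent_state /= map_cat.
  - by rewrite inE => /predU1P[->|/tag1].
  rewrite inE => /predU1P[->|/tr1 /(@tracked_cat [:: (b, g)])//].
  by split=> //; exists g; split; first exact: mem_head.
exists s1; split=> // h; rewrite inE => /predU1P[->|/tr1//].
split=> //; exists d; split; last by rewrite map_cat.
rewrite mem_cat; apply/orP; left; move: s1d => /mapP[[b' d'] sd ->].
by have := tag1 _ sd => /= <-.
Qed.

Lemma extend_state_generic s0 b (e : rat) : 0 < e -> independent_state s0 ->
  exists (k : nat) s1, independent_state (s1 ++ s0) /\
    1 - e <= prob_walk Sigma k (tracked (s1 ++ s0) b).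
Proof.
move=> e0 ind0; have [k le] := walk_generic n_ge5 genS (map snd s0) e0.
pose good g := pbool (uniq (rts g) /\ full_over (@rho n) (map snd s0) g).
(* Words of length [k] are finite in number, so all good values are treated together. *)
pose L := [seq g <- map (@walk n Sigma k) (enum {: k.-tuple 'I_(size Sigma)}) | good g].
have [|s1 [ind1 _ tr1]] := @extend_state s0 b L ind0.
  by move=> g; rewrite mem_filter => /andP[/pboolP].
exists k, s1; split=> //; apply: le_trans le _; apply: prob_walk_mono => w gw.
by apply: tr1; rewrite mem_filter; apply/andP; split; [apply/pboolP | rewrite map_f ?mem_enum].
Qed.

Lemma exists_chain (e : nat -> rat) (b : nat -> bool) : (forall t, 0 < e t) ->
  exists (st : nat -> state) (k : nat -> nat),
    [/\ forall t, independent_state (st t), forall t t', (t <= t')%N -> {subset st t <= st t'}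
      & forall t, 1 - e t <= prob_walk Sigma (k t) (tracked (st t.+1) (b t))].
Proof.
move=> e0.
(* Putting independence inside the chosen property makes the choice total, so that [st] is a plain
   recursion. *)
have ext (x : state * nat) : {y : nat * state | independent_state x.1 ->
    independent_state (y.2 ++ x.1) /\
    1 - e x.2 <= prob_walk Sigma y.1 (tracked (y.2 ++ x.1) (b x.2))}.
  apply: ClassicalEpsilon.constructive_indefinite_description.
  have [ind|nind] := Classical_Prop.classic (independent_state x.1); last by exists (0%N, [::]).
  by have [k [s1 P]] := extend_state_generic (b x.2) (e0 x.2) ind; exists (k, s1).
pose next s t := (sval (ext (s, t))).2 ++ s.
pose st := fix st t := if t is t'.+1 then next (st t') t' else [::].
have st_ind t : independent_state (st t).
  elim: t => [|t IH]; first by split.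
  by have [] := svalP (ext (st t, t)) IH.
exists st, (fun t => (sval (ext (st t, t))).1); split=> //; last first.
  by move=> t; have [] := svalP (ext (st t, t)) (st_ind t).
move=> t t' /subnK <-; elim: (t' - t)%N => [|u IH] x //= stx.
by rewrite mem_cat IH ?orbT.
Qed.
End ChainConstruction.

Theorem theorem6 (n : nat) (Sigma : seq 'M[int]_n) (G1 G2 : {group 'S_n}) :
  (5 <= n)%N ->
  uniq Sigma -> generates_SLZ Sigma ->
  G1 \subset ('Alt_('I_n))%g -> G2 \subset ('Alt_('I_n))%g ->
  exists (F : algC -> Prop) (ns ks : nat -> nat),
    is_subfield F /\
    forall i : nat, (1 <= i)%N ->
      1 - (2 ^+ i)^-1 <= prob_walk Sigma (ns i)
                           (fun g => gal_isog F (split_field F g) G1) /\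
      1 - (2 ^+ i)^-1 <= prob_walk Sigma (ks i)
                           (fun g => gal_isog F (split_field F g) G2).
Proof.
move=> n5 _ genS A1 A2; pose G b := if b then G1 else G2.
have GA b : G b \subset ('Alt_('I_n))%g by case: b.
(* Stages [2i] serve [G1] and stages [2i + 1] serve [G2]; halving [t] gives both the error
   [2 ^ -i]. *)
have [|st [k [ind mono prob]]] := exists_chain n5 genS (fun t => ~~ odd t) (e := fun t => (2 ^+ t./2)^-1).
  by move=> t; rewrite invr_gt0 exprn_gt0.
exists (chain_field G st), (fun i => k i.*2), (fun i => k i.*2.+1).
split; first exact: chain_field_subfield.
have step t : 1 - (2 ^+ t./2)^-1 <=
    prob_walk Sigma (k t) (fun g => gal_isog (chain_field G st) (split_field (chain_field G st) g) (G (~~ odd t))).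
  apply: le_trans (prob t) _; apply: prob_walk_mono => w tr.
  exact: (gal_isog_tracked GA ind mono tr).
move=> i _; split.
  by have := step i.*2; rewrite doubleK odd_double.
by have := step i.*2.+1; rewrite /= uphalf_double odd_double.
Qed.
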